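(* Let $(M,\omega)$ be a symplectic manifold and let $F,G\in C_c^\infty(M)$. Put $I=[0,1/\|\{F,G\}\|)$ (with $1/\|\{F,G\}\|=+\infty$ if $\{F,G\}\equiv0$) and $\omega_s=\omega-s\,dF\wedge dG$ for $s\in I$ (each $\omega_s$ is a symplectic form). Assume that there exist - a family of almost complex structures $J_s$, $s\in I$, on $M$ such that each $J_s$ is compatible with $\omega_s$; - a family of $J_s$-holomorphic maps $u_s:\Sigma_s\to M$, $s\in I$, where each $\Sigma_s$ is a compact Riemann surface with boundary and possibly with corners; - positive constants $C_1,C_2$; so that for all $s\in I$ $$\int_{\Sigma_s}u_s^*\omega\le C_1\qquad\text{and}\qquad\int_{\partial\Sigma_s}u_s^*(F\,dG)\ge C_2.$$ Then $\|\{F,G\}\|\ge C_2/C_1$.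
   Context: $C^\infty_c(M)$ is the space of smooth compactly supported real functions on $M$, $\|F\|=\max_M|F|$. The Hamiltonian vector field of $F$ is given by $i_{\mathrm{sgrad}F}\,\omega=-dF$ and $\{F,G\}=\omega(\mathrm{sgrad}\,G,\mathrm{sgrad}\,F)$; with $\dim M=2n$ one has $dF\wedge dG\wedge\omega^{n-1}=\frac1n\{F,G\}\,\omega^n$. An almost complex structure $J$ is compatible with a symplectic form $\Omega$ if $\Omega(\xi,J\eta)$ is a Riemannian metric. $\partial\Sigma_s$ carries the boundary orientation. *)

(* Defs.v *)
From HB Require Import structures.
From mathcomp Require Import all_boot all_order all_algebra.
From mathcomp Require Import all_classical all_reals all_analysis.

Set Implicit Arguments.
Unset Strict Implicit.
Unset Printing Implicit Defensive.

Import Order.TTheory GRing.Theory Num.Theory.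
Import numFieldNormedType.Exports.

Local Open Scope classical_set_scope.
Local Open Scope ring_scope.

Section Calculus.
Context {R : realType} {m : nat} {V : normedModType R}.
Implicit Types (U A : set 'rV[R]_m) (f g : 'rV[R]_m -> V).

(* g is of class C^k at every point of the open set U. *)
Fixpoint Ck (k : nat) U g : Prop :=
  match k with
  | 0 => forall x, U x -> {for x, continuous g}
  | k'.+1 => (forall x, U x -> differentiable g x) /\
             (forall v, Ck k' U (fun x => 'D_v g x))
  end.

(* Smoothness on a set that need not be open: near each of its points f is the
   restriction of a smooth function defined on an open set. *)
Definition smooth_on A f : Prop :=
  forall x, A x -> exists (U : set 'rV[R]_m) g,
    [/\ open U, U x, (forall k, Ck k U g) &
        forall y, (A `&` U) y -> g y = f y].

(* Partial derivatives are taken from the right, so that they also make sense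
   at the boundary points of a quadrant [0, +oo[^m; for a function that is
   smooth_on an open subset of 'rV_m or of the quadrant they are the partial
   derivatives of any local smooth extension. *)
Definition pderiv f (x : 'rV[R]_m) (i : 'I_m) : V :=
  lim (h^-1 *: (f (x + h *: delta_mx 0 i) - f x) @[h --> (0 : R)^'+]).

End Calculus.

(* The i-th row is the i-th partial derivative: the differential acts on row
   vectors by v |-> v *m jac f x, as the library's jacobian does. *)
Definition jac (R : realType) (m k : nat) (f : 'rV[R]_m -> 'rV[R]_k)
    (x : 'rV[R]_m) : 'M[R]_(m, k) :=
  \matrix_(i, j) pderiv f x i 0 j.

Definition grad (R : realType) (m : nat) (f : 'rV[R]_m -> R)
    (x : 'rV[R]_m) : 'rV[R]_m :=
  \row_i pderiv (V := R^o) f x i.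

(* coord and param are meaningful on dom and coord @` dom only. *)
Record chart (R : realType) (T : Type) (m : nat) := Chart {
  dom : set T;
  coord : T -> 'rV[R]_m;
  param : 'rV[R]_m -> T
}.

Definition image_of (R : realType) (T : Type) (m : nat) (c : chart R T m) :
  set 'rV[R]_m := coord c @` dom c.

(* A homeomorphism from an open subset of T to a relatively open subset of the
   model space H. *)
Definition is_chart (R : realType) (T : topologicalType) (m : nat)
    (H : set 'rV[R]_m) (c : chart R T m) : Prop :=
  [/\ open (dom c),
      (exists2 U, open U & image_of c = U `&` H),
      (forall p, dom c p -> param c (coord c p) = p),
      {within dom c, continuous (coord c)} &
      {within image_of c, continuous (param c)}].

(* Manifolds modelled on a subset H of R^m: H = setT gives manifolds without
   boundary, H = [0, +oo[^m gives manifolds with boundary and corners.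
   chart_at selects a preferred chart around each point; the tangent space at
   p is 'rV[R]_m, a tangent vector being given by its components in
   chart_at p. *)
Record manifold (R : realType) (m : nat) (H : set 'rV[R]_m) := Manifold {
  carrier :> topologicalType;
  atlas : set (chart R carrier m);
  chart_at : carrier -> chart R carrier m;
  manifold_hausdorff : hausdorff_space carrier;
  manifold_second_countable : @second_countable carrier;
  atlas_chart : forall c, atlas c -> is_chart H c;
  atlas_chart_at : forall p, atlas (chart_at p);
  dom_chart_at : forall p, dom (chart_at p) p;
  atlas_smooth : forall c c', atlas c -> atlas c' ->
    smooth_on (coord c @` (dom c `&` dom c')) (coord c' \o param c)
}.

Section Tensors.
Context {R : realType} {m : nat} {H : set 'rV[R]_m} (X : manifold H).

Definition smooth_fun (F : X -> R) : Prop :=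
  forall c, atlas c -> smooth_on (V := R^o) (image_of c) (F \o param c).

(* C^oo_c(X) *)
Definition smooth_compact_support (F : X -> R) : Prop :=
  smooth_fun F /\ compact (closure [set p | F p != 0]).

(* A covector is the row of its values on the canonical basis of T_pX. *)
Definition dfun (F : X -> R) (p : X) : 'rV[R]_m :=
  grad (F \o param (chart_at p)) (coord (chart_at p) p).

(* The i-th row consists of the components in T_pX of the i-th coordinate
   vector field of c. *)
Definition frame (c : chart R X m) (p : X) : 'M[R]_m :=
  jac (coord (chart_at p) \o param c) (coord c p).

(* Components, in the coordinates of c, of a covector field, of a field of
   bilinear forms (v, w) |-> v *m B p *m w^T and of a field of endomorphisms
   v |-> v *m J p. *)
Definition covector_in (c : chart R X m) (a : X -> 'rV[R]_m) (p : X) :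
  'rV[R]_m := a p *m (frame c p)^T.

Definition bilinear_in (c : chart R X m) (B : X -> 'M[R]_m) (p : X) :
  'M[R]_m := frame c p *m B p *m (frame c p)^T.

Definition endo_in (c : chart R X m) (J : X -> 'M[R]_m) (p : X) :
  'M[R]_m := frame c p *m J p *m invmx (frame c p).

Definition smooth_bilinear (B : X -> 'M[R]_m) : Prop :=
  forall c, atlas c -> smooth_on (image_of c) (bilinear_in c B \o param c).

Definition smooth_endo (J : X -> 'M[R]_m) : Prop :=
  forall c, atlas c -> smooth_on (image_of c) (endo_in c J \o param c).

(* d B = 0, for B skew-symmetric *)
Definition closed_2form (B : X -> 'M[R]_m) : Prop :=
  forall c, atlas c -> forall x, image_of c x -> forall i j k,
    let b := fun i j (y : 'rV[R]_m) => bilinear_in c B (param c y) i j in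
    pderiv (V := R^o) (b j k) x i + pderiv (V := R^o) (b k i) x j
      + pderiv (V := R^o) (b i j) x k = 0.

Definition symplectic_form (w : X -> 'M[R]_m) : Prop :=
  [/\ smooth_bilinear w, (forall p, (w p)^T = - w p),
      (forall p, w p \in unitmx) & closed_2form w].

Definition almost_complex (J : X -> 'M[R]_m) : Prop :=
  smooth_endo J /\ (forall p, J p *m J p = - 1%:M).

Definition riemannian_metric (g : X -> 'M[R]_m) : Prop :=
  [/\ smooth_bilinear g, (forall p, (g p)^T = g p) &
      forall p (v : 'rV[R]_m), v != 0 -> 0 < (v *m g p *m v^T) 0 0].

(* w p *m (J p)^T is the matrix of (v, v') |-> w (v, J v'). *)
Definition compatible (J w : X -> 'M[R]_m) : Prop :=
  riemannian_metric (fun p => w p *m (J p)^T).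

(* (dF /\ dG)(v, v') = dF(v) dG(v') - dF(v') dG(v) *)
Definition wedge_d (F G : X -> R) (p : X) : 'M[R]_m :=
  (dfun F p)^T *m dfun G p - (dfun G p)^T *m dfun F p.

(* F dG *)
Definition fun_d (F G : X -> R) (p : X) : 'rV[R]_m := F p *: dfun G p.

(* The solution v of v *m w p = - dF, i.e. of i_v w = - dF. *)
Definition sgrad (w : X -> 'M[R]_m) (F : X -> R) (p : X) : 'rV[R]_m :=
  - dfun F p *m invmx (w p).

Definition poisson (w : X -> 'M[R]_m) (F G : X -> R) (p : X) : R :=
  (sgrad w G p *m w p *m (sgrad w F p)^T) 0 0.

Definition max_norm (F : X -> R) : R := sup [set `|F p| | p in [set: X]].

(* [0, 1 / ||{F, G}||), and [0, +oo) when {F, G} vanishes identically *)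
Definition parameter_interval (w : X -> 'M[R]_m) (F G : X -> R) : set R :=
  [set s | 0 <= s /\
    ((forall p, poisson w F G p = 0) \/ s < (max_norm (poisson w F G))^-1)].

Definition perturbed_form (w : X -> 'M[R]_m) (F G : X -> R) (s : R) (p : X) :
  'M[R]_m := w p - s *: wedge_d F G p.

(* A finite smooth partition of unity, the support of rho i being contained in
   the domain of the chart c i. *)
Definition partition_of_unity (k : nat) (rho : 'I_k -> X -> R)
    (c : 'I_k -> chart R X m) : Prop :=
  [/\ (forall i, atlas (c i)), (forall i, smooth_fun (rho i)),
      (forall i p, 0 <= rho i p),
      (forall i, closure [set p | rho i p != 0] `<=` dom (c i)) &
      forall p, \sum_(i < k) rho i p = 1].

End Tensors.

Section Maps.
Context {R : realType} {m m' : nat} {H : set 'rV[R]_m} {H' : set 'rV[R]_m'}.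
Variables (X : manifold H) (Y : manifold H').

Definition smooth_map (u : X -> Y) : Prop :=
  continuous u /\
  forall c c', atlas c -> atlas c' ->
    smooth_on (coord c @` (dom c `&` u @^-1` dom c'))
              (coord c' \o u \o param c).

(* The differential T_pX -> T_(u p)Y is v |-> v *m dmap u p. *)
Definition dmap (u : X -> Y) (p : X) : 'M[R]_(m, m') :=
  jac (coord (chart_at (u p)) \o u \o param (chart_at p))
      (coord (chart_at p) p).

Definition pullback1 (u : X -> Y) (a : Y -> 'rV[R]_m') (p : X) : 'rV[R]_m :=
  a (u p) *m (dmap u p)^T.

Definition pullback2 (u : X -> Y) (B : Y -> 'M[R]_m') (p : X) : 'M[R]_m :=
  dmap u p *m B (u p) *m (dmap u p)^T.

End Maps.

Definition quadrant (R : realType) : set 'rV[R]_2 :=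
  [set x | forall i, 0 <= x 0 i].

Definition pt (R : realType) (x y : R) : 'rV[R]_2 :=
  \row_(i < 2) if i == ord0 then x else y.

(* A compact surface with boundary and corners with a complex structure j (in
   real dimension 2 every almost complex structure is integrable).  The surface
   carries the orientation given by j, and surface_oriented says that the
   charts are positive: if (e1, e2) is the coordinate basis then (e1, j e1) and
   (e1, e2) have the same orientation. *)
Record riemann_surface (R : realType) := RiemannSurface {
  surface :> manifold (@quadrant R);
  surface_compact : compact [set: surface];
  surface_j : surface -> 'M[R]_2;
  surface_complex : almost_complex surface_j;
  surface_oriented : forall c, atlas c -> forall z, dom c z ->
    0 < endo_in c surface_j z ord0 ord_max
}.

(* The integral of a field of skew-symmetric bilinear forms b over S. *)
Definition is_surface_integral (R : realType) (S : riemann_surface R)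
    (b : S -> 'M[R]_2) (v : R) : Prop :=
  exists (k : nat) (rho : 'I_k -> S -> R) (c : 'I_k -> chart R S 2),
    partition_of_unity rho c /\
    v = \sum_(i < k)
      Rintegral (lebesgue_measure \x lebesgue_measure)%E
        [set xy : R * R | image_of (c i) (pt xy.1 xy.2)]
        (fun xy => let z := param (c i) (pt xy.1 xy.2) in
                   rho i z * bilinear_in (c i) b z ord0 ord_max).

(* The integral of a covector field a over the boundary of S.  The boundary
   points of a chart are those on the edges y = 0 and x = 0 of the quadrant;
   the outward normal being first, the boundary orientation is by increasing x
   on the former and by decreasing y on the latter. *)
Definition is_boundary_integral (R : realType) (S : riemann_surface R)
    (a : S -> 'rV[R]_2) (v : R) : Prop :=
  exists (k : nat) (rho : 'I_k -> S -> R) (c : 'I_k -> chart R S 2),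
    partition_of_unity rho c /\
    v = \sum_(i < k)
      (Rintegral lebesgue_measure [set x : R | image_of (c i) (pt x 0)]
         (fun x => let z := param (c i) (pt x 0) in
                   rho i z * covector_in (c i) a z 0 ord0)
       - Rintegral lebesgue_measure [set y : R | image_of (c i) (pt 0 y)]
           (fun y => let z := param (c i) (pt 0 y) in
                     rho i z * covector_in (c i) a z 0 ord_max)).

(* du o j = J o du *)
Definition holomorphic (R : realType) (m : nat) (H : set 'rV[R]_m)
    (M : manifold H) (J : M -> 'M[R]_m) (S : riemann_surface R) (u : S -> M) :
  Prop :=
  smooth_map u /\
  forall z : S, surface_j z *m dmap u z = dmap u z *m J (u z).

(* Main.v *)
(** Write [f = F o u_s] and [g = G o u_s].  The form [u_s^* omega_s] is
    nonnegative because [u_s] is holomorphic and [J_s] is compatible with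
    [omega_s], so that by Stokes' formula
    [0 <= int u_s^* omega - s int df /\ dg = int u_s^* omega - s int_bd f dg
       <= C1 - s C2]
    for every [s] in [I]; letting [s] tend to [1 / ||{F, G}||] gives the claim
    (the bracket is bounded, since [F] has compact support).

    The two integrals are computed with unrelated partitions of unity, so
    Stokes' formula needs the change of variables formula in the quadrant.  The
    latter is obtained by bisection: an additive function of squares which is
    infinitesimally at most [o(area)] at every point is nonpositive, and locally
    a diffeomorphism maps small squares into slightly enlarged parallelograms,
    whose area is computed by shearing. *)
Require Import Defs.
From HB Require Import structures.
From mathcomp Require Import all_boot all_order all_algebra.
From mathcomp Require Import all_classical all_reals all_analysis.
From mathcomp Require Import measurable_realfun ring lra.

Set Implicit Arguments.
Unset Strict Implicit.
Unset Printing Implicit Defensive.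

Import Order.TTheory GRing.Theory Num.Theory.
Import numFieldNormedType.Exports.

Local Open Scope classical_set_scope.
Local Open Scope ring_scope.

(** * Functions of class C^k *)

Section Germs.
Context {R : realType} {V W : normedModType R}.

(** Two features of the setting shape the proof. At boundary points of the quadrant smoothness means
    the existence of a local extension, and partial derivatives are right-hand limits; the
    differential rules are therefore proved for extensions and transferred to relatively open sets.
    Moreover [chart_at] is an arbitrary choice, so the components of [dfun], [dmap] or a pulled back
    form may jump from point to point; continuity and integrals are read off in one fixed chart,
    once the frames have cancelled.

    For the change of variables, one inequality for nonnegative densities suffices: applied also to
    the inverse map it gives equality, and a general density is a combination of nonnegative ones.
    The transition determinants are positive because transition maps intertwine the matrices of [j]
    in positive charts. The final limit is replaced by a single [s] strictly between [C1 / C2] and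
    [1 / ||{F, G}||]. *)

Lemma near_eq_differentiable (f g : V -> W) x :
  {near x, f =1 g} -> differentiable f x ->
  differentiable g x /\ 'd g x = 'd f x :> (V -> W).
Proof.
move=> fg df; have [dc dE] := (diff_locallyP x f).1 df.
have gE : g \o shift x = cst (g x) + 'd f x +o_ 0 id.
  apply/eqaddoP => e e0; rewrite -(nbhs_singleton fg).
  have /eqaddoP/(_ e e0) := dE.
  have : \forall y \near (0 : V), f (y + x) = g (y + x).
    by have := fg; rewrite (near_shift 0 x) subr0.
  by apply: filterS2 => y /= fgy; rewrite !fctE /= fgy.
have dgE : 'd g x = 'd f x :> (V -> W) by exact: diff_unique.
split; last exact: dgE.
apply/diff_locallyP; rewrite dgE; split; [exact: dc|exact: gE].
Qed.

Lemma near_eq_continuous (f g : V -> W) x :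
  {near x, f =1 g} -> {for x, continuous f} -> {for x, continuous g}.
Proof.
move=> fg cf; rewrite /prop_for /continuous_at -(nbhs_singleton fg).
by apply: cvg_trans cf; apply: near_eq_cvg; apply: filterS fg => y ->.
Qed.

End Germs.

Section CkTheory.
Context {R : realType} {m : nat} {V : normedModType R}.
Implicit Types (U : set 'rV[R]_m) (f g : 'rV[R]_m -> V).

Lemma open_near U x : open U -> U x -> \forall y \near x, U y.
Proof. by move=> oU Ux; exact: open_nbhs_nbhs. Qed.

Lemma eq_near U x f g : open U -> U x -> (forall y, U y -> f y = g y) ->
  {near x, f =1 g}.
Proof. by move=> oU Ux fg; apply: filterS (open_near oU Ux) => y /fg. Qed.

(** Since [U] is open, equality on [U] is equality of germs at its points and passes to directional
    derivatives. The inductions below use this to replace derivatives by explicit formulas. *)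
Lemma Ck_eq k U f g : open U -> (forall x, U x -> f x = g x) ->
  Ck k U f -> Ck k U g.
Proof.
move=> oU; elim: k f g => [|k IH] f g fg /=.
  by move=> Cf x Ux; apply: near_eq_continuous (Cf x Ux); exact: eq_near fg.
move=> [df Cf]; split.
  move=> x Ux.
  by have [] := near_eq_differentiable (eq_near oU Ux fg) (df x Ux).
move=> v; apply: IH (Cf v) => x Ux.
by apply: near_eq_derive; exact: eq_near fg.
Qed.

Lemma CkS k U f : Ck k.+1 U f -> Ck k U f.
Proof.
elim: k f => [|k IH] f [df Cf].
  by move=> x Ux; apply: differentiable_continuous; exact: df.
by split => // v; apply: IH; exact: Cf.
Qed.

Lemma Ck_sub k U U' f : U' `<=` U -> Ck k U f -> Ck k U' f.
Proof.
elim: k f => [|k IH] f sU /=; first by move=> Cf x /sU; exact: Cf.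
by move=> [df Cf]; split=> [x /sU|v]; [exact: df|apply: IH].
Qed.

Lemma CkD k U f g : open U -> Ck k U f -> Ck k U g ->
  Ck k U (fun x => f x + g x).
Proof.
move=> oU; elim: k f g => [|k IH] f g /=.
  by move=> Cf Cg x Ux; exact: (cvgD (Cf x Ux) (Cg x Ux)).
move=> [df Cf] [dg Cg]; split=> [x Ux|v].
  by apply: differentiableD; [exact: df|exact: dg].
apply: (Ck_eq oU _ (IH _ _ (Cf v) (Cg v))) => x Ux.
by rewrite -deriveD //; apply: diff_derivable; [exact: df|exact: dg].
Qed.

Lemma Ck_cst k U (a : V) : open U -> Ck k U (fun=> a).
Proof.
move=> oU; elim: k a => [|k IH] a /=; first by move=> x _;
  exact: cst_continuous.
split=> [x _|v]; first exact: differentiable_cst.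
by apply: (Ck_eq oU _ (IH 0)) => x _; rewrite derive_cst.
Qed.

Lemma Ck_sum k U n (f : 'I_n -> 'rV[R]_m -> V) : open U ->
  (forall i, Ck k U (f i)) -> Ck k U (fun x => \sum_i f i x).
Proof.
move=> oU; elim: n f => [|n IH] f Cf.
  apply: (Ck_eq oU _ (Ck_cst k 0 oU)) => x _; by rewrite big_ord0.
have C1 : Ck k U (fun x => \sum_i f (lift ord0 i) x) by apply: IH.
apply: (Ck_eq oU _ (CkD oU (Cf ord0) C1)) => x _.
by rewrite [RHS]big_ord_recl.
Qed.

End CkTheory.

Section CkScalar.
Context {R : realType} {m : nat}.
Implicit Types (U : set 'rV[R]_m) (f g : 'rV[R]_m -> R^o).

Lemma CkM k U f g : open U -> Ck k U f -> Ck k U g ->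
  Ck k U (fun x => f x * g x : R^o).
Proof.
move=> oU; elim: k f g => [|k IH] f g.
  by move=> Cf Cg x Ux; exact: (cvgM (Cf x Ux) (Cg x Ux)).
move=> Cf Cg; have [df Cf'] := Cf; have [dg Cg'] := Cg; split=> [x Ux|v].
  by apply: differentiableM; [exact: df|exact: dg].
(* The product rule keeps undifferentiated factors, to which the induction hypothesis applies only
   after [CkS] lowers their order. *)
have H := CkD oU (IH _ _ (CkS Cf) (Cg' v)) (IH _ _ (CkS Cg) (Cf' v)).
apply: (Ck_eq oU _ H) => x Ux.
by rewrite [RHS]deriveM //; apply: diff_derivable; [exact: df|exact: dg].
Qed.

Lemma Ck_coord k n U (f : 'rV[R]_m -> 'rV[R]_n) j : open U -> Ck k U f ->
  Ck k U (fun x => f x 0 j : R^o).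
Proof.
move=> oU; elim: k f => [|k IH] f.
  move=> Cf x Ux; apply: (@continuous_comp _ _ _ f (fun M => M 0 j)).
    exact: Cf.
  exact: coord_continuous.
move=> [df Cf]; split=> [x Ux|v].
  apply: (@differentiable_comp _ _ _ _ f (fun M => M 0 j)); first exact: df.
  exact: differentiable_coord.
apply: (Ck_eq oU _ (IH _ (Cf v))) => x Ux.
by rewrite derive_mx ?mxE //; apply: diff_derivable; exact: df.
Qed.

End CkScalar.

Section ChainRule.
Context {R : realType} {m n : nat}.

Lemma derive_comp_row {V : normedModType R} (u : 'rV[R]_m -> 'rV[R]_n)
    (g : 'rV[R]_n -> V) x v :
  differentiable u x -> differentiable g (u x) ->
  'D_v (g \o u) x = \sum_j 'D_v u x 0 j *: 'D_(delta_mx 0 j) g (u x).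
Proof.
move=> du dg.
rewrite deriveE; last exact: differentiable_comp.
rewrite diff_comp //= [in LHS](row_sum_delta ('d u x v)) linear_sum.
apply: eq_bigr => j _.
by rewrite [LHS]linearZ /= -!deriveE.
Qed.

(** By [derive_comp_row] the derivative of [g \o u] is a sum of products of components of a
    derivative of [u] with partial derivatives of [g] along [u]. With [g] scalar, [CkM] and the
    induction hypothesis handle each product. *)
Lemma Ck_comp k (U : set 'rV[R]_m) (W : set 'rV[R]_n)
    (u : 'rV[R]_m -> 'rV[R]_n) (g : 'rV[R]_n -> R^o) :
  open U -> (forall x, U x -> W (u x)) -> Ck k U u -> Ck k W g ->
  Ck k U (g \o u).
Proof.
move=> oU uW; elim: k g => [|k IH] g.
  move=> Cu Cg x Ux; apply: continuous_comp; first exact: Cu.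
  by apply: Cg; exact: uW.
move=> Cu Cg; have [du Cu'] := Cu; have [dg Cg'] := Cg; split=> [x Ux|v].
  by apply: differentiable_comp; [exact: du|apply: dg; exact: uW].
have H j := CkM oU (Ck_coord j oU (Cu' v)) (IH _ (CkS Cu) (Cg' (delta_mx 0 j))).
apply: (Ck_eq oU _ (Ck_sum oU H)) => x Ux.
by rewrite derive_comp_row //; [exact: du|apply: dg; exact: uW].
Qed.

End ChainRule.

(** * Right partial derivatives and Jacobian matrices *)

Section RelativelyOpen.
Context {R : realType} {m : nat}.
Implicit Types (H A U : set 'rV[R]_m).

(* The property of the model spaces 'rV_m and [0, +oo[^m which makes the right
   partial derivatives of functions defined on their open subsets meaningful. *)
Definition forward_closed H := forall x (i : 'I_m) (h : R),
  H x -> 0 <= h -> H (x + h *: delta_mx 0 i).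

Definition rel_open H A := exists2 U, open U & A = U `&` H.

Lemma rel_openI H A U : rel_open H A -> open U -> rel_open H (A `&` U).
Proof.
move=> [U' oU' ->] oU; exists (U' `&` U); first exact: openI.
by rewrite setIAC.
Qed.

Lemma cvg_shift0 (x v : 'rV[R]_m) : x + h *: v @[h --> (0 : R)] --> x.
Proof.
suff : x + h *: v @[h --> (0 : R)] --> x + 0 *: v by rewrite scale0r addr0.
by apply: cvgD; [exact: cvg_cst|apply: cvgZr_tmp; exact: cvg_id].
Qed.

(** This is what makes the right-hand difference quotients of [pderiv] meaningful at every point of
    a relatively open set, boundary points included. *)
Lemma near_forward H A x i : forward_closed H -> rel_open H A -> A x ->
  \forall h \near (0 : R)^'+, A (x + h *: delta_mx 0 i).
Proof.
move=> fH [U oU ->] [Ux Hx]; near=> h; split; last first.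
  by apply: fH => //; near: h; exact: nbhs_right_ge.
near: h; apply: cvg_within.
have := @cvg_shift0 x (delta_mx 0 i) U; rewrite /nbhs /=; apply.
exact: open_near.
Unshelve. all: by end_near. Qed.

End RelativelyOpen.

Section RightPartial.
Context {R : realType} {m : nat} {V : normedModType R}.
Variable H : set 'rV[R]_m.
Hypothesis fH : forward_closed H.
Implicit Types (A U : set 'rV[R]_m) (f g : 'rV[R]_m -> V).

Lemma eq_pderiv A f g x i : rel_open H A -> A x ->
  (forall y, A y -> f y = g y) -> pderiv f x i = pderiv g x i.
Proof.
move=> oA Ax fg; rewrite /pderiv.
have E : {near (0 : R)^'+, (fun h => h^-1 *: (f (x + h *: delta_mx 0 i) - f x))
    =1 (fun h => h^-1 *: (g (x + h *: delta_mx 0 i) - g x))}.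
  have := near_forward i fH oA Ax; apply: filterS => h Ah /=.
  by rewrite !fg.
congr lim; rewrite eqEsubset; split; apply: near_eq_cvg => //.
by apply: filterS E => h ->.
Qed.

Lemma pderiv_differentiable g x i : differentiable g x ->
  pderiv g x i = 'D_(delta_mx 0 i) g x.
Proof.
move=> dg; apply/cvg_lim => //.
have dv : derivable g x (delta_mx 0 i) by exact: diff_derivable.
under eq_fun do rewrite (addrC x).
by apply: cvg_dnbhs_at_right; exact: dv.
Qed.

Lemma pderivE A U f g x i : rel_open H A -> A x -> open U -> U x ->
  differentiable g x -> (forall y, (A `&` U) y -> g y = f y) ->
  pderiv f x i = 'D_(delta_mx 0 i) g x.
Proof.
move=> oA Ax oU Ux dg gf; rewrite -pderiv_differentiable //.
apply: (@eq_pderiv (A `&` U)) => [||y /gf //]; first exact: rel_openI.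
by split.
Qed.

Lemma smooth_on_sub A B f : B `<=` A -> smooth_on A f -> smooth_on B f.
Proof.
move=> BA sf x /BA /sf [U [g [oU Ux Cg gf]]]; exists U, g; split => //.
by move=> y [/BA Ay Uy]; exact: gf.
Qed.

Lemma smooth_on_eq A f g : (forall x, A x -> f x = g x) -> smooth_on A f ->
  smooth_on A g.
Proof.
move=> fg sf x /sf [U [h [oU Ux Ch hf]]]; exists U, h; split => //.
by move=> y [Ay Uy]; rewrite -fg //; exact: hf.
Qed.

Lemma smooth_on_ext A f x : rel_open H A -> smooth_on A f -> A x ->
  exists U g, [/\ open U, U x, (forall k, Ck k U g),
    (forall y, (A `&` U) y -> g y = f y) &
    (forall y i, (A `&` U) y -> pderiv f y i = 'D_(delta_mx 0 i) g y)].
Proof.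
move=> oA sf /sf [U [g [oU Ux Cg gf]]]; exists U, g; split => // y i [Ay Uy].
by apply: (pderivE i oA Ay oU Uy) => //; have [dg _] := Cg 1; exact: dg.
Qed.

Lemma smooth_on_pderiv A f i : rel_open H A -> smooth_on A f ->
  smooth_on A (fun x => pderiv f x i).
Proof.
move=> oA sf x Ax; have [U [g [oU Ux Cg gf pg]]] := smooth_on_ext oA sf Ax.
exists U, (fun x => 'D_(delta_mx 0 i) g x); split => //.
  by move=> k; have [_] := Cg k.+1; exact.
by move=> y Ay; rewrite pg.
Qed.

Lemma smooth_on_cvg A f x : smooth_on A f -> A x ->
  f y @[y --> within A (nbhs x)] --> f x.
Proof.
move=> sf Ax; have [U [g [oU Ux Cg gf]]] := sf x Ax.
rewrite -gf; last by split.
have cg : g y @[y --> within A (nbhs x)] --> g x.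
  by apply: cvg_within_filter; exact: (Cg 0 x Ux).
apply: cvg_trans cg; apply: near_eq_cvg; rewrite near_withinE.
by apply: filterS (open_near oU Ux) => y Uy Ay; exact: gf.
Qed.

End RightPartial.

Section Jacobians.
Context {R : realType} {m : nat}.
Variable H : set 'rV[R]_m.
Hypothesis fH : forward_closed H.
Implicit Types (A U : set 'rV[R]_m).

Lemma near_pderivE {V : normedModType R} A (f g : 'rV[R]_m -> V) x i :
  rel_open H A -> A x -> differentiable g x ->
  (\forall y \near x, A y -> g y = f y) ->
  pderiv f x i = 'D_(delta_mx 0 i) g x.
Proof.
move=> oA Ax dg gf.
(* The open set demanded by [pderivE] is the interior of the set where [g] and [f] agree along [A];
   it contains [x] by the nearness hypothesis. *)
apply: (pderivE fH i oA Ax (@open_interior _ [set y | A y -> g y = f y])) => //.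
by move=> y [Ay /interior_subset/(_ Ay)].
Qed.

Lemma diff_row {V : normedModType R} (g : 'rV[R]_m -> V) x v :
  differentiable g x ->
  'd g x v = \sum_i v 0 i *: 'D_(delta_mx 0 i) g x.
Proof.
move=> dg; rewrite [in LHS](row_sum_delta v) linear_sum; apply: eq_bigr => i _.
by rewrite [LHS]linearZ /= -deriveE.
Qed.

Lemma near_diff_jac n A (f g : 'rV[R]_m -> 'rV[R]_n) x v :
  rel_open H A -> A x -> differentiable g x ->
  (\forall y \near x, A y -> g y = f y) -> 'd g x v = v *m jac f x.
Proof.
move=> oA Ax dg gf; rewrite diff_row //; apply/rowP => j.
rewrite summxE mxE; apply: eq_bigr => i _.
by rewrite !mxE (near_pderivE i oA Ax dg gf).
Qed.

Lemma near_diff_grad A (f g : 'rV[R]_m -> R^o) x v :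
  rel_open H A -> A x -> differentiable g x ->
  (\forall y \near x, A y -> g y = f y) ->
  'd g x v = (v *m (grad f x)^T) 0 0.
Proof.
move=> oA Ax dg gf; rewrite diff_row // mxE; apply: eq_bigr => i _.
by rewrite !mxE (near_pderivE i oA Ax dg gf).
Qed.

Lemma smooth_on_diff {V : normedModType R} A (f : 'rV[R]_m -> V) x :
  smooth_on A f -> A x -> exists2 g, differentiable g x &
    g x = f x /\ \forall y \near x, A y -> g y = f y.
Proof.
move=> sf Ax; have [U [g [oU Ux Cg gf]]] := sf x Ax; exists g.
  by have [dg _] := Cg 1; exact: dg.
split; first exact: gf.
by apply: filterS (open_near oU Ux) => y Uy Ay; exact: gf.
Qed.

Lemma eq_jac n A (f g : 'rV[R]_m -> 'rV[R]_n) x : rel_open H A -> A x ->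
  (forall y, A y -> f y = g y) -> jac f x = jac g x.
Proof.
by move=> oA Ax fg; apply/matrixP => i j;
  rewrite !mxE (eq_pderiv fH i oA Ax fg).
Qed.

Lemma eq_grad A (f g : 'rV[R]_m -> R^o) x : rel_open H A -> A x ->
  (forall y, A y -> f y = g y) -> grad f x = grad g x.
Proof.
by move=> oA Ax fg; apply/rowP => i; rewrite !mxE (eq_pderiv fH i oA Ax fg).
Qed.

Lemma jac_id A x : rel_open H A -> A x -> jac (@id 'rV[R]_m) x = 1%:M.
Proof.
move=> oA Ax; apply/row_matrixP => i; rewrite !rowE.
have [did idE] := (@is_diff_id R 'rV[R]_m x).
rewrite -(near_diff_jac _ oA Ax did); last first.
  by near=> y.
by rewrite mulmx1; exact: (congr1 (fun F => F (delta_mx 0 i)) idE).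
Unshelve. all: by end_near.
Qed.

Lemma smooth_on_taylor1 n A (f : 'rV[R]_m -> 'rV[R]_n) x (e : R) :
  rel_open H A -> smooth_on A f -> A x -> 0 < e ->
  \forall y \near x, A y ->
    `|f y - f x - (y - x) *m jac f x| <= e * `|y - x|.
Proof.
move=> oA sf Ax e0; have [g dg [gfx gf]] := smooth_on_diff sf Ax.
have [_ /eqaddoP/(_ e e0)] := (diff_locallyP x g).1 dg.
move=> dE0.
have dE : \forall y \near x, `|g y - (g x + 'd g x (y - x))| <= e * `|y - x|.
  rewrite (near_shift 0 x) subr0; apply: filterS dE0 => z.
  by rewrite !fctE /= addrK.
have jE := near_diff_jac _ oA Ax dg gf.
apply: filterS2 gf dE => y gfy + Ay.
by rewrite gfy // gfx opprD addrA jE.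
Qed.

End Jacobians.

Section JacobianChainRule.
Context {R : realType} {m n : nat}.
Variables (H : set 'rV[R]_m) (H' : set 'rV[R]_n).
Hypotheses (fH : forward_closed H) (fH' : forward_closed H').
Variables (A : set 'rV[R]_m) (B : set 'rV[R]_n) (f : 'rV[R]_m -> 'rV[R]_n).
Hypotheses (oA : rel_open H A) (oB : rel_open H' B) (sf : smooth_on A f)
  (fAB : forall x, A x -> B (f x)).

Lemma near_comp_ext (V : normedModType R) (g g0 : 'rV[R]_n -> V)
    (f0 : 'rV[R]_m -> 'rV[R]_n) x : A x -> differentiable f0 x ->
  f0 x = f x -> (\forall y \near x, A y -> f0 y = f y) ->
  (\forall y \near f x, B y -> g0 y = g y) ->
  \forall y \near x, A y -> (g0 \o f0) y = (g \o f) y.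
Proof.
move=> Ax df0 f0x f0f g0g.
have cf0 : f0 @ x --> f x.
  by rewrite -f0x; exact: differentiable_continuous.
apply: filterS2 f0f (cf0 _ g0g) => y f0fy g0gy Ay /=.
by rewrite -(f0fy Ay); apply: g0gy; rewrite f0fy //; exact: fAB.
Qed.

Lemma jac_comp k (g : 'rV[R]_n -> 'rV[R]_k) x : smooth_on B g -> A x ->
  jac (g \o f) x = jac f x *m jac g (f x).
Proof.
move=> sg Ax; have [f0 df0 [f0x f0f]] := smooth_on_diff sf Ax.
have [g0 dg0 [_ g0g]] := smooth_on_diff sg (fAB Ax).
have dgf : differentiable (g0 \o f0) x.
  by apply: differentiable_comp => //; rewrite f0x.
apply/row_matrixP => i; rewrite !rowE mulmxA.
rewrite -(near_diff_jac fH _ oA Ax dgf (near_comp_ext Ax df0 f0x f0f g0g)).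
rewrite diff_comp //=; last by rewrite f0x.
rewrite (near_diff_jac fH _ oA Ax df0 f0f) f0x.
by rewrite (near_diff_jac fH' _ oB (fAB Ax) dg0 g0g).
Qed.

Lemma grad_comp (g : 'rV[R]_n -> R^o) x : smooth_on B g -> A x ->
  grad (g \o f) x = grad g (f x) *m (jac f x)^T.
Proof.
move=> sg Ax; have [f0 df0 [f0x f0f]] := smooth_on_diff sf Ax.
have [g0 dg0 [_ g0g]] := smooth_on_diff sg (fAB Ax).
have dgf : differentiable (g0 \o f0) x.
  by apply: differentiable_comp => //; rewrite f0x.
apply/rowP => i.
rewrite [LHS]mxE.
rewrite (near_pderivE fH i oA Ax dgf (near_comp_ext Ax df0 f0x f0f g0g)).
rewrite deriveE // diff_comp //=; last by rewrite f0x.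
rewrite (near_diff_jac fH _ oA Ax df0 f0f) f0x.
rewrite (near_diff_grad fH' _ oB (fAB Ax) dg0 g0g).
rewrite -mulmxA -rowE mxE -[in RHS](trmxK (grad g _)) -trmx_mul.
by rewrite [RHS]mxE mxE.
Qed.

Lemma smooth_on_comp (g : 'rV[R]_n -> R^o) : smooth_on B g ->
  smooth_on A (g \o f).
Proof.
move=> sg x Ax; have [U [f0 [oU Ux Cf f0f]]] := sf Ax.
have [W [g0 [oW Wfx Cg g0g]]] := sg _ (fAB Ax).
(* [f0] is continuous on [U] only, so the preimage of [W] may fail to be open; its interior still
   contains [x]. *)
exists (U `&` f0 @^-1` W)°, (g0 \o f0); split.
- exact: open_interior.
- have cf : f0 @ x --> f0 x by exact: (Cf 0).
  apply: filterI; first exact: open_near.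
  by apply: (cf W); apply: open_near => //; rewrite f0f.
- move=> k; apply: (@Ck_comp _ _ _ _ _ W) => //; first exact: open_interior.
    by move=> y /interior_subset[].
  by apply: (Ck_sub _ (Cf k)) => y /interior_subset[].
- move=> y [Ay /interior_subset[Uy Wy]] /=.
  rewrite g0g; first by rewrite f0f.
  by split => //; rewrite f0f //; exact: fAB.
Qed.

End JacobianChainRule.

Section SmoothScalar.
Context {R : realType} {m : nat}.
Variable H : set 'rV[R]_m.
Hypothesis fH : forward_closed H.
Implicit Types (A U : set 'rV[R]_m) (f g : 'rV[R]_m -> R^o).

Lemma smooth_onM A f g : smooth_on A f -> smooth_on A g ->
  smooth_on A (fun x => f x * g x : R^o).
Proof.
move=> sf sg x Ax; have [U [f0 [oU Ux Cf f0f]]] := sf x Ax.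
have [U' [g0 [oU' Ux' Cg g0g]]] := sg x Ax.
exists (U `&` U'), (fun x => f0 x * g0 x); split => //; first exact: openI.
  move=> k; apply: CkM; first exact: openI.
    by apply: Ck_sub (Cf k) => y [].
  by apply: Ck_sub (Cg k) => y [].
by move=> y [Ay [Uy Uy']]; rewrite f0f // g0g.
Qed.

Lemma smooth_on_coord n A (f : 'rV[R]_m -> 'rV[R]_n) j :
  smooth_on A f -> smooth_on A (fun x => f x 0 j : R^o).
Proof.
move=> sf x Ax; have [U [g [oU Ux Cg gf]]] := sf x Ax.
exists U, (fun x => g x 0 j); split => // [k|y Ay]; first exact: Ck_coord.
by rewrite gf.
Qed.

Lemma smooth_on_jac n A (f : 'rV[R]_m -> 'rV[R]_n) i j : rel_open H A ->
  smooth_on A f -> smooth_on A (fun x => jac f x i j : R^o).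
Proof.
move=> oA /(smooth_on_pderiv fH i oA)/(smooth_on_coord j).
by apply: smooth_on_eq => x _; rewrite mxE.
Qed.

Lemma pderivM A f g x i : rel_open H A -> smooth_on A f -> smooth_on A g ->
  A x -> pderiv (V := R^o) (fun x => f x * g x) x i =
    f x * pderiv (V := R^o) g x i + g x * pderiv (V := R^o) f x i.
Proof.
move=> oA sf sg Ax.
have [f0 df [fx f0f]] := smooth_on_diff sf Ax.
have [g0 dg [gx g0g]] := smooth_on_diff sg Ax.
have fg : \forall y \near x, A y -> f0 y * g0 y = f y * g y.
  by apply: filterS2 f0f g0g => y + + Ay => -> // ->.
rewrite (near_pderivE fH i oA Ax _ fg); last exact: differentiableM.
rewrite (near_pderivE fH i oA Ax df f0f) (near_pderivE fH i oA Ax dg g0g).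
by rewrite [LHS]deriveM ?fx ?gx //; exact: diff_derivable.
Qed.

Lemma pderiv_sum n A (f : 'I_n -> 'rV[R]_m -> R^o) x i : rel_open H A ->
  (forall j, smooth_on A (f j)) -> A x ->
  pderiv (V := R^o) (fun x => \sum_j f j x) x i =
  \sum_j pderiv (V := R^o) (f j) x i.
Proof.
move=> oA sf Ax.
have /choice[f0 f0P] : forall j, exists g : 'rV[R]_m -> R^o,
    differentiable g x /\ \forall y \near x, A y -> g y = f j y.
  by move=> j; have [g dg [_ gf]] := smooth_on_diff (sf j) Ax; exists g.
have E : \forall y \near x, A y -> (\sum_j f0 j) y = \sum_j f j y.
  have : \forall y \near x, forall j, A y -> f0 j y = f j y.
    exact: (@filter_forall _ _ (fun j y => A y -> f0 j y = f j y) (nbhs x) _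
      (fun j => (f0P j).2)).
  apply: filterS => y f0f Ay; rewrite fct_sumE; apply: eq_bigr => j _.
  exact: f0f.
rewrite (near_pderivE fH i oA Ax _ E); last first.
  by apply: differentiable_sum => j; have [] := f0P j.
rewrite derive_sum; last by move=> j; apply: diff_derivable; have [] := f0P j.
by apply: eq_bigr => j _; have [df f0f] := f0P j;
  rewrite (near_pderivE fH i oA Ax df f0f).
Qed.

End SmoothScalar.

(** * Symmetry of second derivatives *)

Section Slices.
Context {R : realType} {m : nat}.

Lemma is_derive_line (f : 'rV[R]_m -> R^o) (x u : 'rV[R]_m) (t : R) :
  differentiable f (x + t *: u) ->
  is_derive t (1 : R) (fun s : R => f (x + s *: u) : R) ('D_u f (x + t *: u)).
Proof.
move=> df; pose L := fun s : R => x + s *: u.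
have dL : is_diff t L (0 + ( *:%R ^~ u)).
  have -> : L = cst x + ( *:%R ^~ u) by [].
  exact: is_diffD.
have dLt : differentiable L t by [].
have dfL : differentiable (f \o L) t by apply: differentiable_comp.
apply: DeriveDef; first exact: diff_derivable.
rewrite deriveE // diff_comp //= [in RHS]deriveE //.
by rewrite diff_val /= !fctE /= add0r scale1r.
Qed.

(** The mean value theorem is applied twice: in the direction [u] to the difference of [f] along two
    parallel sides of the parallelogram, then in the direction [v] to the derivative so obtained. *)
Lemma schwarz_diff (U : set 'rV[R]_m) (f : 'rV[R]_m -> R^o) x (u v : 'rV[R]_m)
    (h : R) : 0 < h -> Ck 2 U f ->
  (forall s t, 0 <= s <= h -> 0 <= t <= h -> U (x + s *: u + t *: v)) ->
  exists s t, [/\ 0 <= s <= h, 0 <= t <= h &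
    f (x + h *: u + h *: v) - f (x + h *: u) - f (x + h *: v) + f x =
    h ^+ 2 * 'D_v (fun y => 'D_u f y) (x + s *: u + t *: v)].
Proof.
move=> h0 [df Cf] Usq; have [ddf _] := Cf u.
have h0h : 0 <= h <= h by rewrite lexx ltW.
have h00 : 0 <= (0 : R) <= h by rewrite lexx ltW.
have dA s : 0 <= s <= h -> is_derive s (1 : R)
    (fun s => f (x + h *: v + s *: u) - f (x + s *: u) : R)
    ('D_u f (x + h *: v + s *: u) - 'D_u f (x + s *: u)).
  move=> sh; apply: is_deriveB; apply: is_derive_line; apply: df.
    by rewrite addrAC; exact: Usq.
  by rewrite -[_ + _]addr0 -(scale0r v); exact: Usq.
have [||s /andP[s0 sh]] := @MVT R
    (fun s => f (x + h *: v + s *: u) - f (x + s *: u))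
    (fun s => 'D_u f (x + h *: v + s *: u) - 'D_u f (x + s *: u)) 0 h h0.
- by move=> s; rewrite in_itv /= => /andP[s0 sh]; apply: dA; rewrite !ltW.
- apply: derivable_within_continuous => s; rewrite in_itv /= => sh.
  by have [] := dA s sh.
rewrite !scale0r !addr0 subr0 => AE.
have s0h : 0 <= s <= h by rewrite !ltW.
have dB t : 0 <= t <= h -> is_derive t (1 : R)
    (fun t => 'D_u f (x + s *: u + t *: v) : R)
    ('D_v (fun y => 'D_u f y) (x + s *: u + t *: v)).
  by move=> th; apply: is_derive_line; apply: ddf; exact: Usq.
have [||t /andP[t0 th]] := @MVT R
    (fun t => 'D_u f (x + s *: u + t *: v))
    (fun t => 'D_v (fun y => 'D_u f y) (x + s *: u + t *: v)) 0 h h0.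
- by move=> t; rewrite in_itv /= => /andP[t0 th]; apply: dB; rewrite !ltW.
- apply: derivable_within_continuous => t; rewrite in_itv /= => th.
  by have [] := dB t th.
rewrite scale0r addr0 subr0 => BE.
exists s, t; split => //; first by rewrite !ltW.
rewrite [x + h *: u + h *: v]addrAC.
move: AE; rewrite (addrAC x (h *: v) (s *: u)) BE => AE.
by rewrite expr2 mulrAC -mulrA mulrC; lra.
Qed.

End Slices.

Section Schwarz.
Context {R : realType} {m : nat}.

Lemma nbhs_parallelogram (x u v : 'rV[R]_m) (P : set 'rV[R]_m) : nbhs x P ->
  exists2 h : R, 0 < h &
    forall s t, 0 <= s <= h -> 0 <= t <= h -> P (x + s *: u + t *: v).
Proof.
move=> /nbhs_ballP[e /= e0 eP].
(* The [+ 1] keeps the denominator positive when [u] and [v] vanish; the halving makes the final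
   inequality strict. *)
pose h := e / (`|u| + `|v| + 1) / 2.
have d0 : 0 < `|u| + `|v| + 1 by rewrite ltr_wpDl // addr_ge0.
have h0 : 0 < h by rewrite !divr_gt0.
exists h => // s t /andP[s0 sh] /andP[t0 th]; apply: eP.
rewrite -ball_normE /= -addrA opprD addrA subrr sub0r normrN.
apply: le_lt_trans (ler_normD _ _) _; rewrite !normrZ !ger0_norm //.
apply: (@le_lt_trans _ _ (h * (`|u| + `|v| + 1))).
  rewrite -addrA !mulrDr lerD ?ler_wpM2r //.
  by rewrite (le_trans (ler_wpM2r _ th)) // lerDl mulr1 ltW.
by rewrite /h mulrAC divfK ?gt_eqF // ltr_pdivrMr // ltr_pMr // ltr1n.
Qed.

(** The two orders of differentiation give the same second difference, but at different intermediate
    points [y] and [z]. Continuity at [x], with an error [e / 2] for each, closes the gap. *)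
Lemma eq_at_limit (a b : 'rV[R]_m -> R) x :
  {for x, continuous a} -> {for x, continuous b} ->
  (forall P, nbhs x P -> exists y z, [/\ P y, P z & a y = b z]) -> a x = b x.
Proof.
move=> ca cb ab.
apply/eqP; rewrite -subr_eq0 -normr_le0; apply/ler_addgt0Pl => e e0.
have /cvgrPdist_lt/(_ _ (divr_gt0 e0 (ltr0n R 2))) c1 := ca.
have /cvgrPdist_lt/(_ _ (divr_gt0 e0 (ltr0n R 2))) c2 := cb.
have [y [z [[/= P1 _] [_ /= P2] E]]] := ab _ (filterI c1 c2).
rewrite -E in P2; rewrite addr0 -(subrKA (a y)) (le_trans (ler_normD _ _)) //.
by rewrite [e]splitr lerD //; [exact: ltW|rewrite distrC ltW].
Qed.

Lemma schwarz (U : set 'rV[R]_m) (f : 'rV[R]_m -> R^o) x (u v : 'rV[R]_m) :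
  open U -> Ck 2 U f -> U x ->
  'D_v (fun y => 'D_u f y) x = 'D_u (fun y => 'D_v f y) x.
Proof.
move=> oU Cf Ux; have [df Cf'] := Cf.
have [_ Cuv] := Cf' u; have [_ Cvu] := Cf' v.
apply: (@eq_at_limit (fun z => 'D_v (fun y => 'D_u f y) z)
                     (fun z => 'D_u (fun y => 'D_v f y) z)) => [||P xP].
- exact: (Cuv v x Ux).
- exact: (Cvu u x Ux).
have [h h0 hP] := nbhs_parallelogram u v (filterI (open_near oU Ux) xP).
have [|s [t [sh th E1]]] := @schwarz_diff R m U f x u v h h0 Cf.
  by move=> s t sh th; have [] := hP s t sh th.
have [|s' [t' [sh' th' E2]]] := @schwarz_diff R m U f x v u h h0 Cf.
  by move=> t' s' th' sh'; rewrite addrAC; have [] := hP s' t' sh' th'.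
exists (x + s *: u + t *: v), (x + s' *: v + t' *: u); split.
- by have [] := hP s t sh th.
- by rewrite addrAC; have [] := hP t' s' th' sh'.
have h2 : h ^+ 2 != 0 by rewrite expf_neq0 // gt_eqF.
apply: (mulfI h2); apply: etrans (esym E1) _; apply: etrans _ E2.
rewrite (addrAC x (h *: u) (h *: v)) -!addrA.
by congr (_ + _); rewrite addrCA.
Qed.

Variable H : set 'rV[R]_m.
Hypothesis fH : forward_closed H.

Lemma pderivC A (f : 'rV[R]_m -> R^o) x i j : rel_open H A -> smooth_on A f ->
  A x -> pderiv (V := R^o) (fun y => pderiv (V := R^o) f y i) x j =
         pderiv (V := R^o) (fun y => pderiv (V := R^o) f y j) x i.
Proof.
move=> oA sf Ax; have [U [g [oU Ux Cg gf pg]]] := smooth_on_ext fH oA sf Ax.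
have dg k : differentiable (fun y => 'D_(delta_mx 0 k) g y) x.
  by have [_ /(_ (delta_mx 0 k))[dg _]] := Cg 2; exact: dg.
rewrite (pderivE fH j oA Ax oU Ux (dg i)); last by move=> y Ay; rewrite pg.
rewrite (pderivE fH i oA Ax oU Ux (dg j)); last by move=> y Ay; rewrite pg.
exact: schwarz oU (Cg 2) Ux.
Qed.

Lemma is_derive_smooth_on A (f : 'rV[R]_m -> R^o) x i (t : R) :
  rel_open H A -> smooth_on A f -> A (x + t *: delta_mx 0 i) ->
  (\forall s \near t, A (x + s *: delta_mx 0 i)) ->
  is_derive t (1 : R) (fun s : R => f (x + s *: delta_mx 0 i) : R)
    (pderiv (V := R^o) f (x + t *: delta_mx 0 i) i).
Proof.
move=> oA sf At nA; have [g dg [_ gf]] := smooth_on_diff sf At.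
rewrite (near_pderivE fH i oA At dg gf).
apply: near_eq_is_derive (is_derive_line dg).
have cL : x + s *: delta_mx 0 i @[s --> t] --> x + t *: delta_mx 0 i.
  by apply: cvgD; [exact: cvg_cst|apply: cvgZr_tmp; exact: cvg_id].
by apply: filterS2 nA (cL _ gf) => s As /(_ As).
Qed.

End Schwarz.

(** * Integration over the quadrant *)

Section Matrices.
Context {R : realType}.

Lemma cvg_mx {T : Type} {F : set_system T} {FF : Filter F} m n
    (f : T -> 'M[R]_(m, n)) (l : 'M[R]_(m, n)) :
  (forall i j, f x i j @[x --> F] --> l i j) -> f @ F --> l.
Proof.
move=> fl; apply/cvgrPdist_le => e e0.
have : \forall x \near F, forall ij : 'I_m * 'I_n,
    `|l ij.1 ij.2 - f x ij.1 ij.2| <= e.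
  by apply: filter_forall => -[i j]; have /cvgrPdist_le := fl i j; exact.
apply: filterS => x xe.
rewrite /Num.Def.normr /= mx_normrE (bigmax_le _ (ltW e0)) //= => i _.
by rewrite !mxE.
Qed.

Lemma le_mx_norm m n (A : 'M[R]_(m, n)) i j : `|A i j| <= `|A|.
Proof.
rewrite [leRHS]/Num.Def.normr /= mx_normrE.
exact: (le_bigmax _ (fun ij : 'I_m * 'I_n => `|A ij.1 ij.2|) (i, j)).
Qed.

Lemma mx_norm_le m n (A : 'M[R]_(m, n)) (e : R) : 0 <= e ->
  (forall i j, `|A i j| <= e) -> `|A| <= e.
Proof.
move=> e0 Ae; rewrite /Num.Def.normr /= mx_normrE (bigmax_le _ e0) //=.
Qed.

Lemma ord2P (i : 'I_2) : i = ord0 \/ i = ord_max.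
Proof. by case: i => -[|[|//]] p; [left|right]; exact: val_inj. Qed.

Lemma ord2_lift : lift (ord0 : 'I_2) ord0 = ord_max.
Proof. exact: val_inj. Qed.

Lemma mulmx2E m n (A : 'M[R]_(m, 2)) (B : 'M[R]_(2, n)) i j :
  (A *m B) i j = A i ord0 * B ord0 j + A i ord_max * B ord_max j.
Proof. by rewrite mxE big_ord_recl big_ord1 ord2_lift. Qed.

Lemma det2E (M : 'M[R]_2) :
  \det M = M ord0 ord0 * M ord_max ord_max - M ord_max ord0 * M ord0 ord_max.
Proof.
rewrite (expand_det_col M ord0) big_ord_recl big_ord1 ord2_lift.
rewrite /cofactor !det_mx11 !mxE /= ord2_lift.
have -> : lift (ord_max : 'I_2) ord0 = ord0 by exact: val_inj.
by rewrite /= expr0 mul1r expr1 mulN1r mulrN.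
Qed.

Lemma pt0E (x y : R) : pt x y 0 ord0 = x. Proof. by rewrite mxE eqxx. Qed.

Lemma pt1E (x y : R) : pt x y 0 ord_max = y. Proof. by rewrite mxE. Qed.

Lemma cvg_pt {T : Type} {F : set_system T} {FF : Filter F} (f g : T -> R) a b :
  f @ F --> a -> g @ F --> b -> pt (f x) (g x) @[x --> F] --> pt a b.
Proof.
move=> fa gb; apply: cvg_mx => i j; rewrite (ord1 i).
have [->|->] := ord2P j.
  by rewrite pt0E; under eq_fun do rewrite pt0E.
by rewrite pt1E; under eq_fun do rewrite pt1E.
Qed.

Lemma quadrant_pt (x y : R) : quadrant (pt x y) <-> 0 <= x /\ 0 <= y.
Proof.
split=> [q|[x0 y0] i]; last by have [->|->] := ord2P i; rewrite ?pt0E ?pt1E.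
by have := q ord0; have := q ord_max; rewrite pt0E pt1E.
Qed.

Lemma pt_forward0 (x y h : R) : pt x y + h *: delta_mx 0 ord0 = pt (x + h) y.
Proof.
apply/rowP => i; rewrite !mxE /=.
by have [->|->] := ord2P i; rewrite /= ?mulr1 ?mulr0 ?addr0.
Qed.

Lemma pt_forward1 (x y h : R) : pt x y + h *: delta_mx 0 ord_max = pt x (y + h).
Proof.
apply/rowP => i; rewrite !mxE /=.
by have [->|->] := ord2P i; rewrite /= ?mulr1 ?mulr0 ?addr0.
Qed.

Lemma forward_closed_quadrant : forward_closed (@quadrant R).
Proof.
move=> x i h qx h0 j; by rewrite !mxE addr_ge0 // mulr_ge0.
Qed.

Lemma forward_closed_setT m : forward_closed [set: 'rV[R]_m].
Proof. by []. Qed.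

End Matrices.

Section PlaneMeasure.
Context {R : realType}.
Notation T := (measurableTypeR R).
Notation mu := (@lebesgue_measure R).
Notation mu2 := (mu \x mu)%E.

(** An open set is the union of the rational squares that it contains; there are countably many of
    them, and each is measurable as a product of intervals. *)
Lemma open_measurable_plane (U : set (T * T)) : open U -> measurable U.
Proof.
move=> oU.
pose B (q : rat * rat * rat) : set (T * T) :=
  `](ratr q.1.1 - ratr q.2 : R), (ratr q.1.1 + ratr q.2)[ `*`
  `](ratr q.1.2 - ratr q.2 : R), (ratr q.1.2 + ratr q.2)[.
have -> : U = \bigcup_(q in [set q | B q `<=` U]) B q.
  rewrite eqEsubset; split; last by move=> z [q /= qU]; exact: qU.
  move=> z Uz; have /nbhs_ballP[e /= e0 eU] : nbhs z U by exact: open_nbhs_nbhs.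
  have /rat_in_itvoo[q] : 0 < e / 2 by rewrite divr_gt0.
  rewrite in_itv /= => /andP[q0 qe].
  have /rat_in_itvoo[a] : z.1 - ratr q < z.1 + ratr q by rewrite ltrD2l gtrN.
  rewrite in_itv /= => /andP[a1 a2].
  have /rat_in_itvoo[b] : z.2 - ratr q < z.2 + ratr q by rewrite ltrD2l gtrN.
  rewrite in_itv /= => /andP[b1 b2].
  exists (a, b, q) => /=; last first.
    by split; rewrite /= in_itv /=; apply/andP; split; lra.
  move=> [x y] []; rewrite /= !in_itv /=.
  move=> /andP[x1 x2] /andP[y1 y2]; apply: eU.
  by split; rewrite -ball_normE /= ltr_distl; apply/andP; split; lra.
rewrite bigcup_mkcond; apply: countable_bigcupT_measurable => // q.
by case: ifPn => // _; apply: measurableX; exact: measurable_itv.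
Qed.

Lemma continuous_measurable_plane (f : T * T -> R) : continuous f ->
  measurable_fun setT f.
Proof.
move=> /continuousP cf; apply: (measurability _ (RGenOpens.measurableE R)).
move=> _ [_ [a [b ->] <-]]; rewrite setTI.
by apply: open_measurable_plane; exact: cf.
Qed.

End PlaneMeasure.

Section QuadrantIntegral.
Context {R : realType}.
Notation T := (measurableTypeR R).
Notation mu := (@lebesgue_measure R).
Notation mu2 := (mu \x mu)%E.
Implicit Types F G : 'rV[R]_2 -> R.

Definition quadrant_integral F : R :=
  Rintegral mu2 setT (fun xy => F (pt xy.1 xy.2)).

(** Continuity is only required along the quadrant: an extension by zero jumps across the edges
    wherever the function does not vanish there. *)
Definition quadrant_cc F : Prop :=
  [/\ forall x, ~ quadrant x -> F x = 0,
      exists2 N : R, 0 < N & forall x, N < `|x| -> F x = 0 &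
      forall x, quadrant x ->
        F y @[y --> within (@quadrant R) (nbhs x)] --> F x].

(** A retraction of the plane onto the quadrant. Composition with it turns continuity along the
    quadrant into continuity on the whole plane, from which measurability follows. *)
Definition clamp (xy : T * T) : 'rV[R]_2 :=
  pt (Num.max xy.1 0) (Num.max xy.2 0).

Lemma continuous_clamp : continuous clamp.
Proof.
move=> xy; apply: cvg_pt.
  have := @continuous_max R (R * R)%type fst (cst 0) xy.
  by apply; [exact: cvg_fst|exact: cst_continuous].
have := @continuous_max R (R * R)%type snd (cst 0) xy.
by apply; [exact: cvg_snd|exact: cst_continuous].
Qed.

Lemma quadrant_clamp xy : quadrant (clamp xy).
Proof. by apply/quadrant_pt; rewrite !le_max !lexx !orbT. Qed.

Lemma quadrant_cc_comp {X : topologicalType} F (k : X -> 'rV[R]_2) :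
  quadrant_cc F -> continuous k -> (forall x, quadrant (k x)) ->
  continuous (F \o k).
Proof.
move=> [_ _ cF] ck qk x; apply: cvg_comp (cF _ (qk x)) => P /= nP.
have cP : \forall z \near x, quadrant (k z) -> P (k z) by exact: (ck x _ nP).
change (\forall z \near x, P (k z)).
by apply: filterS cP => z; apply; exact: qk.
Qed.

Lemma quadrant_cc_clamp F : quadrant_cc F -> continuous (F \o clamp).
Proof.
move=> ccF; apply: quadrant_cc_comp => //; first exact: continuous_clamp.
exact: quadrant_clamp.
Qed.

Lemma quadrant_cc_box F : quadrant_cc F -> exists2 N : R, 0 < N &
  (fun xy : T * T => F (pt xy.1 xy.2)) =
  (F \o clamp) \_ (`[0, N] `*` `[0, N]).
Proof.
move=> [F0 [N N0 FN] _]; exists N => //; apply/funext => -[x y].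
rewrite patchE; case: ifPn => [|xyN].
  rewrite inE /= !in_itv /= => -[/andP[x0 _] /andP[y0 _]].
  by rewrite /clamp /= !max_l.
have [[x0 y0]|nq] := pselect (0 <= x /\ 0 <= y); last first.
  by rewrite F0 // => /quadrant_pt.
apply: FN; apply: contraNT xyN; rewrite -leNgt => xyN;
  rewrite inE /= !in_itv /=.
rewrite x0 y0 /=; split.
  apply: le_trans xyN; apply: le_trans (le_mx_norm _ 0 ord0).
  by rewrite pt0E ler_norm.
apply: le_trans xyN; apply: le_trans (le_mx_norm _ 0 ord_max).
by rewrite pt1E ler_norm.
Qed.

Lemma box_lty (N : R) : (mu2 (`[0%R, N] `*` `[0%R, N]) < +oo)%E.
Proof.
rewrite product_measure1E; [|exact: measurable_itv|exact: measurable_itv].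
rewrite /= !lebesgue_measure_itv /= lte_fin.
by case: (0 < N); rewrite ?mule0 // -EFinM ltry.
Qed.

Lemma quadrant_cc_integrable F : quadrant_cc F ->
  mu2.-integrable setT (EFin \o (fun xy => F (pt xy.1 xy.2))).
Proof.
move=> ccF; have [N N0 ->] := quadrant_cc_box ccF.
have cF := quadrant_cc_clamp ccF.
have mB : measurable (`[0, N] `*` `[0, N] : set (T * T)).
  by apply: measurableX; exact: measurable_itv.
rewrite -restrict_EFin; apply/integrable_restrict => //=; rewrite ?setTI ?setIT.
apply: measurable_bounded_integrable => //; first exact: box_lty.
  by apply: measurable_funTS; exact: continuous_measurable_plane.
have cB : compact (`[0, N] `*` `[0, N] : set (R * R)).
  by apply: compact_setX; exact: segment_compact.
have [M [Mr MF]] :=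
  compact_bounded (continuous_compact (continuous_subspaceT cF) cB).
by exists M; split => // K MK z Bz; apply: MF => //; exists z.
Qed.

End QuadrantIntegral.

(** * Area of parallelograms by shearing *)

Section Parallelograms.
Context {R : realType}.
Notation T := (measurableTypeR R).
Notation mu := (@lebesgue_measure R).
Notation mu2 := (mu \x mu)%E.

Lemma measurable_translation (t : R) :
  measurable_fun setT ((fun x => x + t) : T -> T).
Proof.
apply: continuous_measurable_fun => x.
by apply: cvgD; [exact: cvg_id|exact: cvg_cst].
Qed.

(** By uniqueness of the Lebesgue measure it is enough to compare the two measures on half-open
    intervals. *)
Lemma lebesgue_measure_translation (t : R) (A : set T) : measurable A ->
  mu [set x | A (x + t)] = mu A.
Proof.
move=> mA; pose f : T -> T := fun x => x + t.
have mf : measurable_fun setT f := measurable_translation t.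
pose mf_mixin := isMeasurableFun.Build _ _ _ _ _ mf.
pose F : {mfun T >-> T} := HB.pack f mf_mixin.
apply/esym; apply: (@lebesgue_measure_unique R (pushforward mu F)) => // X.
move=> [[a b] _ <-] /=; rewrite /pushforward.
have -> : f @^-1` `]a, b]%classic = `]a - t, b - t]%classic.
  by apply/seteqP; split => x /=; rewrite !in_itv /= /f => /andP[? ?];
    apply/andP; split; lra.
rewrite !lebesgue_measure_itv /= !lte_fin ltrD2r.
by case: ifPn => // _; rewrite -!EFinB; congr EFin; lra.
Qed.

(** The product measure integrates vertical sections, while [shear] moves points horizontally;
    uniqueness of the product measure gives access to horizontal sections. *)
Lemma product_lebesgueE (A : set (T * T)) : measurable A ->
  mu2 A = (\int[mu]_y mu (ysection A y))%E.
Proof.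
move=> mA; rewrite [LHS](@product_measure_unique _ _ _ _ _ mu mu (mu \x^ mu)%E)
  //.
by move=> X Y mX mY; exact: product_measure2E.
Qed.

Definition shear (t : R) (z : T * T) : T * T := (z.1 + t * z.2, z.2).

Lemma shear_measurable t A : measurable A -> measurable (shear t @^-1` A).
Proof.
move=> mA; rewrite -[X in measurable X]setTI.
have : measurable_fun setT (shear t); last by apply.
apply: measurable_fun_pair => //; apply: continuous_measurable_plane => z.
apply: cvgD; first exact: cvg_fst.
by apply: cvgM; [exact: cvg_cst|exact: cvg_snd].
Qed.

(** On the horizontal line at height [y] the shear is the translation by [t * y]. *)
Lemma shear_preserving t A : measurable A -> mu2 (shear t @^-1` A) = mu2 A.
Proof.
move=> mA; rewrite !product_lebesgueE //; last exact: shear_measurable.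
apply: eq_integral => y _.
rewrite -[RHS](lebesgue_measure_translation (t * y)); last first.
  exact: measurable_ysection.
by congr (mu _); apply/seteqP; split => x /=; rewrite /ysection /= !inE.
Qed.

Lemma lebesgue_measure_strip (k c s : R) : k != 0 -> 0 <= s ->
  mu [set y | `|k * y - c| <= s] = (2 * s / `|k|)%:E.
Proof.
move=> k0 s0; have ak0 : 0 < `|k| by rewrite normr_gt0.
have -> : [set y | `|k * y - c| <= s] =
    `[c / k - s / `|k|, c / k + s / `|k|]%classic.
  have E y : (`|k * y - c| <= s) = (c / k - s / `|k| <= y <= c / k + s / `|k|).
    rewrite -ler_distl ler_pdivlMr // [X in _ = (X <= _)]mulrC -normrM mulrBr.
    by rewrite mulrCA divff // mulr1.
  by apply/seteqP; split => y /=; rewrite in_itv /= E.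
rewrite lebesgue_measure_itv /= lte_fin.
have [->|sn0] := eqVneq s 0; first by rewrite !mul0r mulr0 mul0r subr0 addr0
  ltxx.
have sk0 : 0 < s / `|k| by rewrite divr_gt0 // lt0r sn0.
by case: ifPn => [_|/negP[]]; [rewrite -EFinB; congr EFin|]; lra.
Qed.

(** A parallelogram is encoded as the preimage of a square of half-side [s] under a linear map, so
    that membership is a pair of linear inequalities. The determinant therefore divides in the
    area. *)
Definition parallelogram (a b c d p q s : R) : set (T * T) :=
  [set z | `|a * z.1 + b * z.2 - p| <= s /\ `|c * z.1 + d * z.2 - q| <= s].

Let eq_norm_le (x y s : R) : `|x| <= s -> x = y -> `|y| <= s.
Proof. by move=> + <-. Qed.

Lemma measurable_affine_strip (a b p s : R) :
  measurable ([set z | `|a * z.1 + b * z.2 - p| <= s] : set (T * T)).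
Proof.
rewrite -[X in measurable X]setTI.
have mf : measurable_fun [set: T * T] (fun z => `|a * z.1 + b * z.2 - p|).
  apply: continuous_measurable_plane => z; apply: cvg_norm; apply: cvgB.
    apply: cvgD; apply: cvgM; [exact: cvg_cst|exact: cvg_fst|exact: cvg_cst|].
    exact: cvg_snd.
  exact: cvg_cst.
rewrite (_ : [set z | _] = (fun z : T * T => `|a * z.1 + b * z.2 - p|) @^-1`
    `]-oo, s]); first exact: mf measurableT _ (@measurable_itv R `]-oo, s]).
by apply/seteqP; split => z /=; rewrite in_itv.
Qed.

Lemma measurable_parallelogram a b c d p q s :
  measurable (parallelogram a b c d p q s).
Proof. by apply: measurableI; exact: measurable_affine_strip. Qed.

(** With [b = 0] the first inequality bounds the abscissa alone, and all nonempty vertical sections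
    have the same length [2 * s / |d|]. *)
Lemma parallelogram_measure0 (a c d p q s : R) : a != 0 -> d != 0 -> 0 <= s ->
  mu2 (parallelogram a 0 c d p q s) = (4 * s ^+ 2 / `|a * d|)%:E.
Proof.
move=> a0 d0 s0.
transitivity (\int[mu]_x ((2 * s / `|d|) *
    \1_[set x | `|a * x - p| <= s] x)%:E)%E.
  apply: eq_integral => x _ /=; rewrite indicE; have [xs|xs] := boolP (x \in _).
    rewrite mulr1 -(lebesgue_measure_strip (q - c * x) d0 s0); congr (mu _).
    move: xs; rewrite inE /= => xs.
    apply/seteqP; split => y /=; rewrite /xsection /= inE /parallelogram /=.
      by move=> [_ H]; apply: eq_norm_le H _; ring.
    by move=> H; split; [apply: eq_norm_le xs _|apply: eq_norm_le H _]; ring.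
  rewrite mulr0; transitivity (mu set0); last by rewrite measure0.
  congr (mu _).
  apply/seteqP; split => y //=; rewrite /xsection /= inE /parallelogram /= =>
    -[H _].
  by move: xs; rewrite notin_setE /=; apply; apply: eq_norm_le H _; ring.
have mS : measurable ([set x | `|a * x - p| <= s] : set T).
  have mf : measurable_fun [set: T] (fun x : T => `|a * x - p|).
    apply: continuous_measurable_fun => z; apply: cvg_norm; apply: cvgB.
      by apply: cvgM; [exact: cvg_cst|exact: cvg_id].
    exact: cvg_cst.
  rewrite -[X in measurable X]setTI.
  rewrite (_ : [set z | _] = (fun x : T => `|a * x - p|) @^-1` `]-oo, s]).
    exact: mf measurableT _ (@measurable_itv R `]-oo, s]).
  by apply/seteqP; split => z /=; rewrite in_itv.
under eq_integral do rewrite EFinM.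
rewrite ge0_integralZl //; last first.
- by rewrite lee_fin divr_ge0 // mulr_ge0.
- by apply/measurable_EFinP; exact: measurable_indic.
rewrite integral_indic // setIT.
rewrite [X in (_ * X)%E](lebesgue_measure_strip p a0 s0) -EFinM; congr EFin.
by rewrite normrM; field; rewrite !normr_eq0 a0 d0.
Qed.

Lemma parallelogram_measure (a b c d p q s : R) :
  a * d - b * c != 0 -> 0 <= s ->
  mu2 (parallelogram a b c d p q s) = (4 * s ^+ 2 / `|a * d - b * c|)%:E.
Proof.
move=> D0 s0.
(* If [a] vanishes, exchanging the two inequalities puts [c] in its place; [c] is nonzero because
   the determinant is. *)
wlog a0 : a b c d p q D0 / a != 0.
  move=> H; have [a0|a0] := eqVneq a 0; last exact: H.
  have -> : parallelogram a b c d p q s = parallelogram c d a b q p s.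
    by apply/seteqP; split => z [].
  have E : c * b - d * a = - (a * d - b * c) by ring.
  have c0 : c != 0 by apply: contraNneq D0 => ->; rewrite a0 mul0r mulr0 subr0.
  by rewrite (H c d a b q p _ c0) E ?normrN // oppr_eq0.
have -> : parallelogram a b c d p q s =
    shear (b / a) @^-1` parallelogram a 0 c ((a * d - b * c) / a) p q s.
  apply/seteqP; rewrite /parallelogram /shear.
  by split => -[x y] /= [H1 H2]; split;
    [apply: eq_norm_le H1 _|apply: eq_norm_le H2 _
    |apply: eq_norm_le H1 _|apply: eq_norm_le H2 _]; field.
rewrite shear_preserving; last exact: measurable_parallelogram.
rewrite parallelogram_measure0 //; last by rewrite mulf_neq0 ?invr_eq0.
by congr (_ / `| _ |)%:E; field.
Qed.

End Parallelograms.

(** * Change of variables in the quadrant *)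

Section Bisection.
Context {R : realType}.
Variables (D : R -> R -> R -> R) (N : R).
Hypotheses (N0 : 0 < N)
  (D_split : forall a b r, 0 <= r ->
    D a b r = D a b (r / 2) + D (a + r / 2) b (r / 2)
     + (D a (b + r / 2) (r / 2) + D (a + r / 2) (b + r / 2) (r / 2)))
  (D_local : forall x y e, 0 <= x -> 0 <= y -> 0 < e -> exists2 d, 0 < d &
     forall a b r, 0 <= a -> 0 <= b -> a <= x <= a + r -> b <= y <= b + r ->
       0 < r < d -> D a b r <= e * r ^+ 2).

Let bad c (z : R * R) r := c * r ^+ 2 < D z.1 z.2 r.

(** If all four quarters had density at most [c], so would the whole square, by additivity. The
    alternative [r < 0] covers the sizes for which [D_split] says nothing. *)
Let bad_split c z r : bad c z r -> exists z', bad c z' (r / 2) /\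
  [/\ z.1 <= z'.1, z.2 <= z'.2, z'.1 + r / 2 <= z.1 + r &
      z'.2 + r / 2 <= z.2 + r] \/ r < 0.
Proof.
case: (ltP r 0) => [r0 _|r0]; first by exists z; right.
case: z => a b; rewrite /bad /= => H.
have [[z' Hz']|H'] := pselect (exists z', bad c z' (r / 2) /\
  [/\ a <= z'.1, b <= z'.2, z'.1 + r / 2 <= a + r & z'.2 + r / 2 <= b + r]).
  by exists z'; left.
exfalso; move: H; apply/negP; rewrite -leNgt.
have H2 z' : a <= z'.1 -> b <= z'.2 -> z'.1 + r / 2 <= a + r ->
    z'.2 + r / 2 <= b + r -> D z'.1 z'.2 (r / 2) <= c * (r / 2) ^+ 2.
  by move=> *; rewrite leNgt; apply/negP => ?; apply: H'; exists z'.
have r2 : 0 <= r / 2 by rewrite divr_ge0.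
have {}H2 x y : (x = a) \/ (x = a + r / 2) -> (y = b) \/ (y = b + r / 2) ->
    D x y (r / 2) <= c * (r / 2) ^+ 2.
  move=> xE yE; apply: (H2 (x, y)) => /=; first [case: xE => ->|case: yE => ->];
  by lra.
rewrite D_split //.
have := H2 a b (or_introl erefl) (or_introl erefl).
have := H2 (a + r / 2) b (or_intror erefl) (or_introl erefl).
have := H2 a (b + r / 2) (or_introl erefl) (or_intror erefl).
have := H2 (a + r / 2) (b + r / 2) (or_intror erefl) (or_intror erefl).
move: (D _ _ _) (D _ _ _) (D _ _ _) (D _ _ _) => d1 d2 d3 d4.
have -> : c * r ^+ 2 = 4 * (c * (r / 2) ^+ 2) by field.
by move: (c * _) => u; lra.
Qed.

Lemma exists_half_lt (d : R) : 0 < d -> exists n, N / 2 ^+ n < d.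
Proof.
move=> d0; exists (Num.bound (N / d)); rewrite ltr_pdivrMr ?exprn_gt0 //.
rewrite -ltr_pdivrMl // mulrC.
have Nd : 0 <= N / d by rewrite divr_ge0 // ltW.
apply: lt_trans (archi_boundP Nd) _.
by rewrite -natrX ltr_nat ltn_expl.
Qed.

(* Otherwise some nested sequence of subsquares keeps the excess density of D,
   against the local estimate at their common point. *)
Lemma bisection_le0 : D 0 0 N <= 0.
Proof.
rewrite leNgt; apply/negP => D0.
(* Half of the mean density of [D] on the initial square, which is therefore bad with a strict
   inequality. *)
pose c := D 0 0 N / N ^+ 2 / 2.
have c0 : 0 < c by rewrite !divr_gt0 // exprn_gt0.
have bad0 : bad c (0, 0) N.
  rewrite /bad /c /= mulrAC divfK ?expf_neq0 ?gt_eqF //.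
  by rewrite ltr_pdivrMr // ltr_pMr // ltr1n.
pose next_ok (z : R * R) r (z' : R * R) := bad c z r -> bad c z' (r / 2) /\
  [/\ z.1 <= z'.1, z.2 <= z'.2, z'.1 + r / 2 <= z.1 + r &
      z'.2 + r / 2 <= z.2 + r].
have nextP n z : exists z', next_ok z (N / 2 ^+ n) z'.
  have rn : 0 < N / 2 ^+ n by rewrite divr_gt0 // exprn_gt0.
  have [B|nB] := pselect (bad c z (N / 2 ^+ n)); last by exists z.
  have [z' [H|]] := bad_split B; first by exists z'.
  by rewrite ltNge ltW.
have /choice[next nextE] : forall nz : nat * (R * R), exists z',
    next_ok nz.2 (N / 2 ^+ nz.1) z'.
  by move=> [n z]; exact: nextP.
pose fix sq n : R * R := if n is n'.+1 then next (n', sq n') else (0, 0).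
pose r n := N / 2 ^+ n.
have rS n : r n.+1 = r n / 2 by rewrite /r exprSr invfM mulrA.
have r0 n : 0 < r n by rewrite divr_gt0 // exprn_gt0.
have bads n : bad c (sq n) (r n).
  elim: n => [|n IH]; first by rewrite /r expr0 divr1.
  by rewrite rS /=; have [] := nextE (n, sq n) IH.
have mon n : [/\ (sq n).1 <= (sq n.+1).1, (sq n).2 <= (sq n.+1).2,
    (sq n.+1).1 + r n.+1 <= (sq n).1 + r n &
    (sq n.+1).2 + r n.+1 <= (sq n).2 + r n].
  by rewrite rS; have [] := nextE (n, sq n) (bads n).
(* Each coordinate is treated as a sequence of nested intervals, and the supremum of the left ends
   is a common point. It may be a right end, which is why [D_local] allows closed inequalities. *)
have nested (f : nat -> R) : (forall n, f n <= f n.+1) ->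
    (forall n, f n.+1 + r n.+1 <= f n + r n) -> f 0%N = 0 ->
    exists x, forall n, f n <= x <= f n + r n.
  move=> fi fd f0.
  have fm n m : f n <= f m + r m.
    have h1 : f n <= f (maxn n m).
      have : {homo f : i j / (i <= j)%N >-> i <= j} by exact/nondecreasing_seqP.
      by apply; exact: leq_maxl.
    have h2 : f (maxn n m) + r (maxn n m) <= f m + r m.
      have : {homo (fun n => f n + r n) : i j / (i <= j)%N >-> j <= i}.
        by apply/nonincreasing_seqP.
      by apply; exact: leq_maxr.
    apply: le_trans h1 (le_trans _ h2); by rewrite lerDl ltW.
  exists (sup [set f n | n in setT]) => n; apply/andP; split.
    apply: sup_ubound; last by exists n.
    by exists (f 0%N + r 0%N) => _ [m _ <-].
  apply: ge_sup; first by exists (f 0%N), 0%N.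
  by move=> _ [m _ <-].
have [||//|x xP] := nested (fun n => (sq n).1).
- by move=> n; have [] := mon n.
- by move=> n; have [] := mon n.
have [||//|y yP] := nested (fun n => (sq n).2).
- by move=> n; have [] := mon n.
- by move=> n; have [] := mon n.
have sq0 n : 0 <= (sq n).1 /\ 0 <= (sq n).2.
  elim: n => [|n [h1 h2]]; first by rewrite lexx.
  by have [m1 m2 _ _] := mon n; split; [exact: le_trans m1|exact: le_trans m2].
have x0 : 0 <= x by have /andP[] := xP 0%N.
have y0 : 0 <= y by have /andP[] := yP 0%N.
have [d d0 dP] := D_local x0 y0 c0.
have [n nd] := exists_half_lt d0.
have [a0 b0] := sq0 n.
have := dP _ _ (r n) a0 b0 (xP n) (yP n); rewrite r0 nd => /(_ isT).
by rewrite leNgt => /negP[]; exact: bads.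
Qed.

End Bisection.

Section RectangleIntegrals.
Context {R : realType}.
Notation T := (measurableTypeR R).
Notation mu := (@lebesgue_measure R).
Notation mu2 := (mu \x mu)%E.

(** Half-open, so that the four quarters of a square are disjoint and their integrals add up
    exactly. *)
Definition rect (a b r : R) : set 'rV[R]_2 :=
  [set x | (a <= x 0 ord0 < a + r) /\ (b <= x 0 ord_max < b + r)].

Lemma rect_split (a b r : R) : 0 <= r -> let h := r / 2 in
  rect a b r = (rect a b h `|` rect (a + h) b h) `|`
               (rect a (b + h) h `|` rect (a + h) (b + h) h).
Proof.
move=> r0 h; rewrite /rect; apply/seteqP; split=> x /=.
  move=> [/andP[x0 x1] /andP[y0 y1]].
  case: (ltP (x 0 ord0) (a + h)) => xh; case: (ltP (x 0 ord_max) (b + h)) => yh.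
  - by left; left; rewrite x0 y0.
  - right; left; split; apply/andP; split => //; rewrite /h in yh *; lra.
  - left; right; split; apply/andP; split => //; rewrite /h in xh *; lra.
  - by right; right; split; apply/andP; split => //; rewrite /h in xh yh *; lra.
by rewrite /h; move=> [[|]|[|]] [/andP[? ?] /andP[? ?]]; split; apply/andP;
  split; lra.
Qed.

Variables (S : set (T * T)) (k : T * T -> 'rV[R]_2) (f : T * T -> R).
Hypothesis mk : forall a b r, measurable (S `&` k @^-1` rect a b r).
Hypothesis intf : mu2.-integrable setT (EFin \o f).

Lemma integrable_sub (X : set (T * T)) : measurable X ->
  mu2.-integrable X (EFin \o f).
Proof. by move=> mX; apply: integrableS intf. Qed.

(** Stated for preimages of squares under a map [k], in order to serve both sides of the change of
    variables: [k] is [psi] for the integral of [F] and the identity for that of [G]. *)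
Lemma Rintegral_rect_split (a b r : R) : 0 <= r ->
  let I a b r := Rintegral mu2 (S `&` k @^-1` rect a b r) f in
  I a b r = I a b (r / 2) + I (a + r / 2) b (r / 2)
    + (I a (b + r / 2) (r / 2) + I (a + r / 2) (b + r / 2) (r / 2)).
Proof.
move=> r0 /=; rewrite (rect_split a b r0) !preimage_setU !setIUr.
rewrite !Rintegral_setU //; try exact: measurableU.
- by apply: integrable_sub; exact: measurableU.
- apply/disj_setPS => z [[_ /= [/andP[? ?] /andP[? ?]]]].
  by move=> [_ /= [/andP[? ?] /andP[? ?]]]; exfalso; lra.
- by apply: integrable_sub; exact: measurableU.
- apply/disj_setPS => z [[_ /= [/andP[? ?] /andP[? ?]]]].
  by move=> [_ /= [/andP[? ?] /andP[? ?]]]; exfalso; lra.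
- by apply: integrable_sub; apply: measurableU; exact: measurableU.
- apply/disj_setPS => z [[[_ /= h1]|[_ /= h1]] [[_ /= h2]|[_ /= h2]]];
  by case: h1 => /andP[? ?] /andP[? ?]; case: h2 => /andP[? ?] /andP[? ?];
    exfalso; lra.
Qed.

End RectangleIntegrals.

Section PlaneSets.
Context {R : realType}.
Notation T := (measurableTypeR R).

Definition unpt (A : set 'rV[R]_2) : set (T * T) := [set z | A (pt z.1 z.2)].

Lemma continuous_pt : continuous (fun z : T * T => pt z.1 z.2 : 'rV[R]_2).
Proof. by move=> z; apply: cvg_pt; [exact: cvg_fst|exact: cvg_snd]. Qed.

Lemma measurable_unpt_open U : open U -> measurable (unpt U).
Proof.
move=> oU; apply: open_measurable_plane.
by have /continuousP := continuous_pt; exact.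
Qed.

Lemma measurable_unpt_quadrant : measurable (unpt (@quadrant R)).
Proof.
have -> : unpt (@quadrant R) = `[0, +oo[ `*` `[0, +oo[.
  apply/seteqP; split => z /=; rewrite !in_itv /= !andbT;
    first by move/quadrant_pt.
  by move=> ?; apply/quadrant_pt.
by apply: measurableX; exact: measurable_itv.
Qed.

Lemma measurable_unpt_rel_open B : rel_open (@quadrant R) B ->
  measurable (unpt B).
Proof.
move=> [U oU ->]; apply: measurableI; first exact: measurable_unpt_open.
exact: measurable_unpt_quadrant.
Qed.

Lemma rel_open_lt B (g : 'rV[R]_2 -> R) c : rel_open (@quadrant R) B ->
  (forall x, B x -> g y @[y --> within B (nbhs x)] --> g x) ->
  rel_open (@quadrant R) (B `&` [set x | g x < c]).
Proof.
move=> oB cg; have -> : B `&` [set x | g x < c] =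
    B `&` [set x | B x -> g x < c]°.
  apply/seteqP; split => x [Bx].
    move=> gx; split => //.
    have := cvgr_lt _ (cg x Bx) _ gx; rewrite near_withinE; exact.
  by move=> gx; split => //; exact: interior_subset gx Bx.
by apply: rel_openI => //; exact: open_interior.
Qed.

(** Since [k] is controlled along [B] only, the half-open conditions are written as differences of
    strict sublevel sets, which are relatively open by [rel_open_lt]. *)
Lemma measurable_unpt_rect B (k : 'rV[R]_2 -> 'rV[R]_2) a b r :
  rel_open (@quadrant R) B ->
  (forall x, B x -> k y @[y --> within B (nbhs x)] --> k x) ->
  measurable (unpt B `&` (fun z => k (pt z.1 z.2)) @^-1` rect a b r).
Proof.
move=> oB ck.
have m j c : measurable (unpt (B `&` [set x | k x 0 j < c])).
  apply: measurable_unpt_rel_open.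
  apply: (rel_open_lt (g := fun x => k x 0 j) c oB) => x Bx.
  exact: (cvg_comp _ _ (ck x Bx) (@coord_continuous R 1 2 0 j (k x))).
have -> : unpt B `&` (fun z => k (pt z.1 z.2)) @^-1` rect a b r =
    ((unpt (B `&` [set x | k x 0 ord0 < a + r]) `\`
      unpt (B `&` [set x | k x 0 ord0 < a])) `&`
    (unpt (B `&` [set x | k x 0 ord_max < b + r]) `\`
      unpt (B `&` [set x | k x 0 ord_max < b]))).
  apply/seteqP; split => z; rewrite /unpt /rect /=.
    move=> [Bz [/andP[h1 h2] /andP[h3 h4]]].
    by do !split => //; move=> [_]; rewrite ltNge ?h1 ?h3.
  move=> [[[Bz h2] h1] [[_ h4] h3]]; split => //; split; apply/andP;
    split => //.
    by rewrite leNgt; apply/negP => h; apply: h1.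
  by rewrite leNgt; apply/negP => h; apply: h3.
by apply: measurableI; apply: measurableD.
Qed.

End PlaneSets.

Section SquareArithmetic.
Context {R : realType}.

Lemma square_dist (a r x z : R) : a <= x <= a + r -> a <= z < a + r ->
  - r <= z - x <= r.
Proof. by move=> /andP[? ?] /andP[? ?]; apply/andP; split; lra. Qed.

(** A point of the interval is within [r / 2] of its midpoint; an error [k] in the linear
    approximation enlarges this to [r / 2 + k]. *)
Lemma strip_dist (a r x z q v k : R) : - k <= v - q - (z - x) <= k ->
  a <= z < a + r -> - (r / 2 + k) <= v - (q + (a + r / 2 - x)) <= r / 2 + k.
Proof. by move=> /andP[? ?] /andP[? ?]; apply/andP; split; lra. Qed.

End SquareArithmetic.

Section ChangeOfVariables.
Context {R : realType}.
Notation T := (measurableTypeR R).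
Notation mu := (@lebesgue_measure R).
Notation mu2 := (mu \x mu)%E.
Notation quad := (@quadrant R).
Variables (A B : set 'rV[R]_2) (phi psi : 'rV[R]_2 -> 'rV[R]_2).
Variables F G : 'rV[R]_2 -> R.
Hypotheses (oA : rel_open quad A) (oB : rel_open quad B).
Hypotheses (phi_smooth : smooth_on A phi)
  (psi_cont : forall y, B y -> psi z @[z --> within B (nbhs y)] --> psi y).
Hypotheses (phiAB : forall x, A x -> B (phi x))
  (psiBA : forall y, B y -> A (psi y))
  (psiK : forall y, B y -> phi (psi y) = y).
Hypothesis det_gt0 : forall x, A x -> 0 < \det (jac phi x).
Hypotheses (ccF : quadrant_cc F) (ccG : quadrant_cc G).
Hypotheses (F_ge0 : forall y, 0 <= F y) (F_supp : forall y, ~ B y -> F y = 0)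
  (GE : forall x, A x -> G x = F (phi x) * \det (jac phi x)).
Hypothesis G_away : forall x, quad x -> ~ A x -> \forall y \near x, G y = 0.

Let Fh (z : T * T) := F (pt z.1 z.2).
Let Gh (z : T * T) := G (pt z.1 z.2).
Let E a b r := unpt B `&` (fun z => psi (pt z.1 z.2)) @^-1` rect a b r.
Let Q a b r := unpt quad `&` (fun z => pt z.1 z.2) @^-1` rect a b r.
(** The additive function of squares to be bisected: the integral of [F] over the points of [B] that
    [psi] sends into the square, minus the integral of [G] over the part of the square in the
    quadrant. *)
Let D a b r := Rintegral mu2 (E a b r) Fh - Rintegral mu2 (Q a b r) Gh.

Let oquad : rel_open quad quad.
Proof. by exists setT; [exact: openT|rewrite setTI]. Qed.

Let Aquad x : A x -> quad x.
Proof. by case: oA => U _ -> []. Qed.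

Let mE a b r : measurable (E a b r).
Proof. exact: measurable_unpt_rect. Qed.

Let mQ a b r : measurable (Q a b r).
Proof.
apply: (@measurable_unpt_rect R quad id) => // x _.
exact: cvg_within_filter cvg_id.
Qed.

Let intF : mu2.-integrable setT (EFin \o Fh).
Proof. exact: quadrant_cc_integrable. Qed.

Let intG : mu2.-integrable setT (EFin \o Gh).
Proof. exact: quadrant_cc_integrable. Qed.

Let G_eq0 x y : A x -> phi x = y -> G x = 0 -> F y = 0.
Proof.
move=> Ax <-; rewrite GE // => /eqP; rewrite mulf_eq0 => /orP[/eqP //|].
by rewrite gt_eqF // det_gt0.
Qed.

Let D_split a b r : 0 <= r -> D a b r = D a b (r / 2) + D (a + r / 2) b (r / 2)
  + (D a (b + r / 2) (r / 2) + D (a + r / 2) (b + r / 2) (r / 2)).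
Proof.
move=> r0; rewrite /D /E /Q !(Rintegral_rect_split _ _ a b r0) //.
by rewrite opprD addrACA !opprD; congr (_ + _); exact: addrACA.
Qed.

(** Near a point outside [A] the density [G] vanishes; since the determinant is nonzero, [F]
    vanishes wherever [psi] takes values there, and both integrals are zero. *)
Let D_local_out x y e : 0 <= x -> 0 <= y -> ~ A (pt x y) -> 0 < e ->
  exists2 d, 0 < d & forall a b r, 0 <= a -> 0 <= b ->
    a <= x <= a + r -> b <= y <= b + r -> 0 < r < d -> D a b r <= e * r ^+ 2.
Proof.
move=> x0 y0 nA e0.
have qp : quad (pt x y) by apply/quadrant_pt.
have /nbhs_ballP[d /= d0 dG] := G_away qp nA.
exists d => // a b r a0 b0 /andP[x1 x2] /andP[y1 y2] /andP[r0 rd].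
have G0 z : rect a b r z -> G z = 0.
  move=> [/andP[z1 z2] /andP[z3 z4]]; apply: dG.
  rewrite -ball_normE /=; apply: le_lt_trans rd; apply: mx_norm_le;
    first exact: ltW.
  move=> i j; rewrite (ord1 i) !mxE /= ler_norml.
  by have [->|->] := ord2P j; rewrite /=; apply/andP; split; lra.
rewrite /D (@eq_Rintegral _ _ _ mu2 _ (cst 0)) => [|z]; last first.
  rewrite inE => -[Bz rz]; apply: (G_eq0 (psiBA Bz) (psiK Bz)); exact: G0.
rewrite (@eq_Rintegral _ _ _ mu2 (Q a b r) (cst 0)) => [|z]; last first.
  by rewrite inE => -[_ rz]; exact: G0.
by rewrite !Rintegral_cst // !mul0r subrr mulr_ge0 ?sqr_ge0 // ltW.
Qed.

Let rect_lebesgue a b r : 0 <= r -> mu2 (`[a, a + r[ `*` `[b, b + r[) =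
  (r ^+ 2)%:E.
Proof.
move=> r0; rewrite product_measure1E; [|exact: measurable_itv..].
rewrite /= !lebesgue_measure_itv /= !lte_fin.
have [->|rn0] := eqVneq r 0; first by rewrite !addr0 ltxx mul0e expr0n.
have r1 : 0 < r by rewrite lt0r rn0.
by rewrite !ltrDl r1 -!EFinB -EFinM; congr EFin; ring.
Qed.

Let integrable_cst_on (X : set (T * T)) (c : R) : measurable X ->
  (mu2 X < +oo)%E -> mu2.-integrable X (EFin \o cst c).
Proof.
move=> mX Xfin; apply: measurable_bounded_integrable => //.
exists `|c|; split; first exact: normr_real.
by move=> y cy z _; exact: ltW.
Qed.

Let Rintegral_le_cst (X : set (T * T)) f c m : measurable X ->
  mu2.-integrable setT (EFin \o f) -> 0 <= c -> (mu2 X <= m%:E)%E ->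
  (forall z, X z -> f z <= c) -> Rintegral mu2 X f <= c * m.
Proof.
move=> mX intf c0 Xm fc.
have Xfin : mu2 X \is a fin_num.
  by rewrite ge0_fin_numE // (le_lt_trans Xm) // ltry.
apply: (@le_trans _ _ (Rintegral mu2 X (cst c))).
  apply: le_Rintegral => //; first exact: integrable_sub intf _ mX.
  by apply: integrable_cst_on; rewrite // -ge0_fin_numE.
rewrite Rintegral_cst // ler_wpM2l //.
by rewrite -lee_fin fineK.
Qed.

Let Rintegral_ge_cst (X : set (T * T)) f c m : measurable X ->
  mu2.-integrable setT (EFin \o f) -> mu2 X = m%:E ->
  (forall z, X z -> c <= f z) -> c * m <= Rintegral mu2 X f.
Proof.
move=> mX intf Xm fc.
apply: (@le_trans _ _ (Rintegral mu2 X (cst c))).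
  rewrite Rintegral_cst // [fine _](_ : _ = m) //.
  exact: (congr1 fine Xm).
apply: le_Rintegral => //; last exact: integrable_sub intf _ mX.
by apply: integrable_cst_on; rewrite // Xm ltry.
Qed.

Let mulmx_row2_le (v : 'rV[R]_2) (M : 'M[R]_2) j :
  `|(v *m M) 0 j| <= 2 * `|M| * `|v|.
Proof.
rewrite mulmx2E; apply: le_trans (ler_normD _ _) _.
rewrite !normrM -mulrA [2 * _]mulrDl !mul1r.
by rewrite lerD // mulrC ler_pM // le_mx_norm.
Qed.

(** For [n <= 1] one has [(1 + 2 * n) ^+ 2 <= 1 + 8 * n], and [n ^+ 2 <= n] makes every error term a
    multiple of [n]. This is the origin of the constant [8 * f * d + 9 * d + 1]. *)
Let excess_bound (f d n e : R) : 0 <= f -> 0 <= d -> 0 <= n -> n <= 1 ->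
  n * (8 * f * d + 9 * d + 1) <= e ->
  (f + n) * ((1 + 2 * n) ^+ 2 * d) - (f * d - n) <= e.
Proof.
move=> f0 d0 n0 n1; apply: le_trans.
have nn : n ^+ 2 <= n by rewrite expr2 ler_piMr.
have h1 : (1 + 2 * n) ^+ 2 <= 1 + 8 * n by lra.
have fn : 0 <= (f + n) * d by rewrite mulr_ge0 // addr_ge0.
have h2 : (f + n) * ((1 + 2 * n) ^+ 2 * d) <= (f + n) * d * (1 + 8 * n).
  by rewrite (mulrC (_ ^+ 2)) mulrA ler_wpM2l.
have h3 : n ^+ 2 * d <= n * d by rewrite ler_wpM2r.
apply: le_trans (lerB h2 (lexx _)) _; rewrite -subr_ge0.
rewrite [X in 0 <= X](_ : _ = 8 * (n * d - n ^+ 2 * d)); last by ring.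
by rewrite mulr_ge0 // subr_ge0.
Qed.

(* Near p the map phi sends a square of side r into a parallelogram of area
   (1 + 2 n)^2 det L r^2, n being as small as desired. *)
Let D_local_in x y e : 0 <= x -> 0 <= y -> A (pt x y) -> 0 < e ->
  exists2 d, 0 < d & forall a b r, 0 <= a -> 0 <= b ->
    a <= x <= a + r -> b <= y <= b + r -> 0 < r < d -> D a b r <= e * r ^+ 2.
Proof.
move=> x0 y0 Ap e0; set p := pt x y in Ap.
pose L := jac phi p; pose N := invmx L; pose f := F (phi p).
have L0 : 0 < \det L by exact: det_gt0.
have Lu : L \in unitmx by rewrite unitmxE unitfE gt_eqF.
have f0 : 0 <= f by exact: F_ge0.
have qp : quad p by exact: Aquad.
pose k := 8 * f * \det L + 9 * \det L + 1.
have k0 : 0 < k.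
  by rewrite ltr_wpDl // addr_ge0 // ?mulr_ge0 // ltW.
pose n := Num.min 1 (e / k).
have n0 : 0 < n by rewrite lt_min ltr01 divr_gt0.
have n1 : n <= 1 by rewrite ge_min lexx.
have nk : n * k <= e by rewrite -ler_pdivlMr // ge_min lexx orbT.
(* [2 * |N|] bounds the effect of multiplication by [N] in the maximum norm, so a Taylor error
   [n / c * r] stays below [n * r] after it; the [+ 1] makes [c] positive. *)
pose c := 2 * `|N| + 1.
have c0 : 0 < c by rewrite ltr_wpDl // mulr_ge0.
have nc0 : 0 < n / c by rewrite divr_gt0.
have near1 := smooth_on_taylor1 (@forward_closed_quadrant R) oA phi_smooth Ap
  nc0.
have near2 : \forall z \near p, A z -> F (phi z) <= f + n.
  have [_ _ cF] := ccF.
  have qphi : quad (phi p) by case: oB (phiAB Ap) => U _ -> [].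
  have fn : f < f + n by rewrite ltrDl.
  have nF : nbhs (phi p) (fun w => quad w -> F w <= f + n).
    by have := cvgr_le _ (cF _ qphi) _ fn; rewrite near_withinE; exact.
  have nA : \forall z \near p, A z -> quad (phi z) -> F (phi z) <= f + n.
    exact: (smooth_on_cvg phi_smooth Ap nF).
  apply: filterS nA => z nz Az; apply: nz => //.
  by case: oB (phiAB Az) => U _ -> [].
have near3 : \forall z \near p, quad z -> G p - n <= G z.
  have [_ _ cG] := ccG.
  have gn : G p - n < G p by rewrite gtrBl.
  by have := cvgr_ge _ (cG _ qp) _ gn; rewrite near_withinE; exact.
have near4 : \forall z \near p, quad z -> A z.
  case: oA Ap => U oU AE; rewrite {1}AE => -[Up _].
  by apply: filterS (open_near oU Up) => z Uz qz; rewrite AE.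
have /nbhs_ballP[d /= d0 dP] : nbhs p [set z |
    [/\ A z -> `|phi z - phi p - (z - p) *m L| <= n / c * `|z - p|,
        A z -> F (phi z) <= f + n, quad z -> G p - n <= G z & quad z -> A z]].
  by apply: filterS2 (filterI near1 near2) (filterI near3 near4) =>
    z [? ?] [? ?].
exists d => // a b r a0 b0 /andP[x1 x2] /andP[y1 y2] /andP[r0 rd].
have rect_near z : rect a b r z -> `|z - p| <= r /\ quad z.
  move=> [/andP[z1 z2] /andP[z3 z4]]; split.
    apply: mx_norm_le; first exact: ltW.
    move=> i j; rewrite (ord1 i) !mxE /= ler_norml.
    have [->|->] := ord2P j; rewrite /=.
      by apply: (@square_dist _ a); rewrite ?x1 ?z1.
    by apply: (@square_dist _ b); rewrite ?y1 ?z3.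
  move=> j; have [->|->] := ord2P j; first exact: le_trans a0 z1.
  exact: le_trans b0 z3.
have rect_ball z : rect a b r z -> ball p d z.
  move=> /rect_near[zr _]; rewrite -ball_normE /= distrC.
  exact: le_lt_trans zr rd.
have EF : Rintegral mu2 (E a b r) Fh <=
    (f + n) * (r ^+ 2 * ((1 + 2 * n) ^+ 2 * \det L)).
  pose q := phi p.
  pose s := r / 2 + n * r.
  (* The condition on a point is that its image under [N], after subtracting that of [q], be within
     [s] of the centre of the square relative to [p]. The entries of [N] appear transposed because
     it acts on row vectors. Since [4 * s ^+ 2 = r ^+ 2 * (1 + 2 * n) ^+ 2], the area is as claimed
     in [EF]. *)
  pose P := parallelogram (N ord0 ord0) (N ord_max ord0) (N ord0 ord_max)
    (N ord_max ord_max)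
    (q 0 ord0 * N ord0 ord0 + q 0 ord_max * N ord_max ord0 + (a + r / 2 - x))
    (q 0 ord0 * N ord0 ord_max + q 0 ord_max * N ord_max ord_max
       + (b + r / 2 - y)) s.
  have s0 : 0 <= s by rewrite addr_ge0 // ?mulr_ge0 // ltW // divr_gt0.
  have detN : N ord0 ord0 * N ord_max ord_max - N ord_max ord0 * N ord0 ord_max
    =
      (\det L)^-1 by rewrite -det2E det_inv.
  have PE : mu2 P = (r ^+ 2 * ((1 + 2 * n) ^+ 2 * \det L))%:E.
    rewrite parallelogram_measure // detN ?invr_eq0 ?gt_eqF //.
    rewrite gtr0_norm ?invr_gt0 // invrK; congr EFin.
    by rewrite /s; field.
  have fn0 : 0 <= f + n by rewrite addr_ge0 // ltW.
  apply: (Rintegral_le_cst (mE a b r) intF fn0).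
    rewrite -PE; apply: le_measure; rewrite ?inE //.
      exact: measurable_parallelogram.
    move=> w [Bw rw]; set z := psi (pt w.1 w.2) in rw.
    have [zr qz] := rect_near _ rw.
    have [t1 _ _ /(_ qz) Az] := dP _ (rect_ball _ rw).
    have {}t1 := t1 Az; rewrite (psiK Bw) in t1.
    set v := _ - _ - _ in t1.
    have vj j : `|(v *m N) 0 j| <= n * r.
      apply: le_trans (mulmx_row2_le _ _ _) _.
      have h1 : `|v| <= n / c * r.
        by apply: le_trans t1 _; rewrite ler_wpM2l // ltW.
      apply: le_trans (ler_wpM2l _ h1) _; first by rewrite mulr_ge0.
      rewrite mulrA ler_wpM2r //; first exact: ltW.
      rewrite mulrCA ler_piMr //; first exact: ltW.
      by rewrite ler_pdivrMr // mul1r lerDl.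
    (* Multiplying the Taylor remainder by the inverse of [L] compares [(w - q) *m N] with [z - p];
       the two differ by at most [n * r] in each coordinate, which yields the inequalities of
       [P]. *)
    have vN : v *m N = (pt w.1 w.2 - q) *m N - (z - p).
      by rewrite /v mulmxBl -mulmxA mulmxV // mulmx1.
    have vNj j : (v *m N) 0 j = w.1 * N ord0 j + w.2 * N ord_max j
       - (q 0 ord0 * N ord0 j + q 0 ord_max * N ord_max j) - (z 0 j - p 0 j).
      by rewrite vN mxE mulmx2E !mxE /=; ring.
    case: rw => /andP[z1 z2] /andP[z3 z4].
    have := vj ord0; have := vj ord_max; rewrite !vNj !ler_norml.
    rewrite /p pt0E pt1E => h1 h0.
    rewrite /P /s; split; rewrite ler_norml /=.
      by rewrite !(mulrC (N _ _)); apply: strip_dist h0 _; rewrite z1.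
    by rewrite !(mulrC (N _ _)); apply: strip_dist h1 _; rewrite z3.
  move=> w [Bw rw]; have [_ qz] := rect_near _ rw.
  have [_ t2 _ /(_ qz) Az] := dP _ (rect_ball _ rw).
  by have := t2 Az; rewrite (psiK Bw).
have QG : (f * \det L - n) * r ^+ 2 <= Rintegral mu2 (Q a b r) Gh.
  apply: (Rintegral_ge_cst (mQ a b r) intG).
    have -> : Q a b r = `[a, a + r[ `*` `[b, b + r[.
      apply/seteqP; rewrite /Q /unpt /rect.
      split => z /=; rewrite pt0E pt1E !in_itv /=; first by move=> [].
      move=> [za zb]; split => //; apply/quadrant_pt.
      by split; [case/andP: za|case/andP: zb] => + _; apply: le_trans.
    by rewrite rect_lebesgue // ltW.
  move=> z [qz rz]; have [_ _ t3 _] := dP _ (rect_ball _ rz).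
  by have := t3 qz; rewrite (GE Ap).
rewrite /D; apply: le_trans (lerB EF QG) _.
rewrite mulrCA mulrC -mulrBl ler_wpM2r ?sqr_ge0 //.
by apply: excess_bound => //; exact: ltW.
Qed.

Theorem change_of_variables_le : quadrant_integral F <= quadrant_integral G.
Proof.
have [_ [K K0 GK] _] := ccG.
(* The squares are half-open, so the side must exceed the bound [K] on the support of [G]. The
   single square of side [N] at the origin then carries both full integrals. *)
pose N := K + 1; have N0 : 0 < N by rewrite addr_gt0.
have D0 : D 0 0 N <= 0.
  apply: bisection_le0 N0 D_split _ => x y e x0 y0 e0.
  have [Ap|nAp] := pselect (A (pt x y)); first exact: D_local_in.
  exact: D_local_out.
have far z : quad z -> ~ rect 0 0 N z -> G z = 0.
  move=> qz nz; apply: GK; rewrite ltNge; apply/negP => zK; apply: nz.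
  have zj j : 0 <= z 0 j < 0 + N.
    rewrite qz add0r /=; apply: le_lt_trans (_ : K < N); last by rewrite ltrDl.
    by apply: le_trans zK; apply: le_trans (le_mx_norm _ 0 j); exact: ler_norm.
  by split.
suff DE : D 0 0 N = quadrant_integral F - quadrant_integral G.
  by rewrite -subr_le0 -DE.
rewrite /D /quadrant_integral; congr (_ - _); rewrite Rintegral_mkcond;
  congr (Rintegral _ _ _); apply/funext => z; rewrite patchE; case: ifPn => //.
  rewrite notin_setE => nE; apply/esym.
  have [Bz|nB] := pselect (B (pt z.1 z.2)); last exact: F_supp.
  apply: (G_eq0 (psiBA Bz) (psiK Bz)); apply: far; first exact/Aquad/psiBA.
  by move=> rz; apply: nE; split.
rewrite notin_setE => nQ; apply/esym.
have [qz|nq] := pselect (quad (pt z.1 z.2)); last by have [h _ _] := ccG;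
  exact: h.
by apply: far => // rz; apply: nQ; split.
Qed.

End ChangeOfVariables.

(** * Stokes' formula in the quadrant *)

Section QuadrantStokes.
Context {R : realType}.
Notation T := (measurableTypeR R).
Notation mu := (@lebesgue_measure R).
Notation mu2 := (mu \x mu)%E.
Notation quad := (@quadrant R).
Variable A : set 'rV[R]_2.
Hypothesis oA : rel_open quad A.
Implicit Types P : 'rV[R]_2 -> R^o.

(* P vanishes on A outside a compact subset of A. *)
Definition compactly_supported_in P : Prop :=
  (forall x, quad x -> ~ A x -> \forall y \near x, A y -> P y = 0) /\
  exists2 N : R, 0 < N & forall x, A x -> N < `|x| -> P x = 0.

Let Aquad x : A x -> quad x.
Proof. by case: oA => U _ -> []. Qed.

Let fquad := @forward_closed_quadrant R.

(** At a point of [A], nearby points of the quadrant are again in [A]; at a point of the quadrant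
    outside [A], the support condition makes the extension by zero vanish nearby. *)
Lemma quadrant_cc_patch P : compactly_supported_in P ->
  (forall x, A x -> P y @[y --> within A (nbhs x)] --> P x) ->
  quadrant_cc (P \_ A).
Proof.
move=> [Pout [N N0 PN]] cP; split.
- by move=> x nq; rewrite patchE memNset // => /Aquad.
- exists N => // x Nx; rewrite patchE; case: ifPn => // /set_mem Ax.
  exact: PN.
- move=> x qx; rewrite patchE; have [Ax|nA] := pselect (A x).
    rewrite mem_set //; move: (cP x Ax) => cPx.
    have nA : \forall y \near x, quad y -> A y.
      case: oA Ax => U oU AE; rewrite {1}AE => -[Ux _].
      by apply: filterS (open_near oU Ux) => y Uy qy; rewrite AE.
    move=> V /= nV; have cV : \forall y \near x, A y -> V (P y) by exact: cPx.
    change (\forall y \near x, quad y -> V ((P \_ A) y)).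
    by apply: filterS2 nA cV => y Ay Vy qy; rewrite patchE mem_set; auto.
  rewrite memNset // => V /= nV.
  change (\forall y \near x, quad y -> V ((P \_ A) y)).
  apply: filterS (Pout x qx nA) => y Py qy; rewrite patchE.
  case: ifPn => [/set_mem /Py ->|_]; exact: nbhs_singleton.
Qed.

(** Vanishing along [A] passes to right partial derivatives on open sets, so each neighbourhood
    where [P] vanishes is first shrunk to an open one. *)
Lemma compactly_supported_pderiv P i : compactly_supported_in P ->
  compactly_supported_in (fun x => pderiv (V := R^o) P x i).
Proof.
move=> [Pout [N N0 PN]].
have zero (U : set 'rV[R]_2) y : open U -> U y -> A y ->
    (forall z, A z -> U z -> P z = 0) -> pderiv (V := R^o) P y i = 0.
  move=> oU Uy Ay P0.
  have E0 : \forall z \near y, A z -> (cst 0 : 'rV[R]_2 -> R^o) z = P z.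
    by apply: filterS (open_near oU Uy) => z Uz Az; rewrite P0.
  rewrite (near_pderivE fquad i oA Ay _ E0); last exact: differentiable_cst.
  exact: derive_cst.
split=> [x qx nA|].
  rewrite -nbhs_nearE nbhsE /=; have := Pout x qx nA.
  rewrite -nbhs_nearE nbhsE /= => -[U [oU Ux] UP]; exists U => // y Uy Ay.
  by apply: (zero U) => // z Az Uz; exact: UP.
exists N => // x Ax Nx.
have oN : open [set z : 'rV[R]_2 | N < `|z|].
  rewrite -[X in open X]/((fun z : 'rV[R]_2 => `|z|) @^-1` [set t | N < t]).
  by apply: open_comp; [move=> z _; exact: norm_continuous|exact: open_gt].
apply: (zero _ _ oN) => // z Az; exact: PN.
 Qed.

Lemma compactly_supportedM P Q : compactly_supported_in P ->
  compactly_supported_in (fun x => P x * Q x).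
Proof.
move=> [Pout [N N0 PN]]; split=> [x qx nA|].
  by apply: filterS (Pout x qx nA) => y Py Ay; rewrite Py // mul0r.
by exists N => // x Ax Nx; rewrite PN // mul0r.
Qed.

Section Ray.
Variables (P : 'rV[R]_2 -> R^o) (i : 'I_2) (x : 'rV[R]_2).
Hypotheses (sP : smooth_on A P) (csP : compactly_supported_in P)
  (xi : x 0 i = 0).

Let dP := (fun x => pderiv (V := R^o) P x i) \_ A.
Let e : 'rV[R]_2 := delta_mx 0 i.

Let line_coord t : (x + t *: e) 0 i = t.
Proof. by rewrite !mxE xi !eqxx mulr1 add0r. Qed.

Let line_quad t : quad (x + t *: e) -> quad x /\ 0 <= t.
Proof.
move=> q; split; last by have := q i; rewrite line_coord.
move=> j; have [->|ji] := eqVneq j i; first by rewrite xi.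
by have := q j; rewrite !mxE eqxx (negPf ji) mulr0 addr0.
Qed.

Let ccP : quadrant_cc (P \_ A).
Proof. by apply: quadrant_cc_patch => // y; exact: smooth_on_cvg. Qed.

Let ccdP : quadrant_cc dP.
Proof.
apply: quadrant_cc_patch; first exact: compactly_supported_pderiv.
have sdP := smooth_on_pderiv fquad i oA sP.
by move=> y; exact: smooth_on_cvg sdP.
Qed.

Let ray (t : R) : 'rV[R]_2 := x + Num.max t 0 *: e.

Let continuous_ray : continuous ray.
Proof.
move=> t; apply: cvgD; first exact: cvg_cst.
apply: cvgZr_tmp.
by have := @continuous_max R R id (cst 0) t; apply;
  [exact: cvg_id|exact: cst_continuous].
Qed.

(** The fundamental theorem of calculus along a ray issuing from the edge: its far end is beyond the
    support, so only the value at the edge remains. *)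
Lemma ray_integral :
  (\int[mu]_t (dP (x + t *: e))%:E = (- (P \_ A) x)%:E)%E.
Proof.
(* Fubini's theorem will use every line parallel to the axis, including those that miss the
   quadrant; both sides are zero on these. *)
have [qx|nq] := pselect (quad x); last first.
  have P0 : (P \_ A) x = 0 by have [h _ _] := ccP; exact: h.
  rewrite P0 oppr0 integral0_eq // => t _.
  by have [h _ _] := ccdP; rewrite h // => /line_quad[/nq].
have quad_ray t : quad (ray t) by apply: fquad => //; rewrite le_max lexx orbT.
have [_ [N N0 PN] _] := ccP; have [_ [N' N'0 dPN] _] := ccdP.
pose K := Num.max N N' + 1.
have K0 : 0 < K by rewrite addr_gt0 // lt_max N0.
have big t : K <= t -> N < `|x + t *: e| /\ N' < `|x + t *: e|.
  move=> Kt; suff tx : Num.max N N' < `|x + t *: e|.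
    by split; apply: le_lt_trans tx; rewrite le_max lexx ?orbT.
  apply: lt_le_trans (le_mx_norm _ 0 i); rewrite line_coord.
  by apply: lt_le_trans (ler_norm _); apply: lt_le_trans Kt; rewrite ltrDl.
have rayE t : 0 <= t -> ray t = x + t *: e by move=> t0; rewrite /ray max_l.
pose f (t : R) : R := (P \_ A) (ray t); pose f' (t : R) : R := dP (ray t).
have cf : continuous f by exact: quadrant_cc_comp.
have cf' : continuous f' by exact: quadrant_cc_comp.
have -> : (\int[mu]_t (dP (x + t *: e))%:E =
           \int[mu]_(t in `[0%R, K]) (f' t)%:E)%E.
  rewrite [RHS]integral_mkcond; apply: eq_integral => t _; rewrite patchE.
  rewrite /f'; case: ifPn => [|tK].
    by rewrite inE /= in_itv /= => /andP[t0 _]; rewrite rayE.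
  have [t0|t0] := ltP t 0.
    by have [h _ _] := ccdP; rewrite h // => /line_quad[_]; rewrite leNgt t0.
  rewrite dPN //; apply: (big t _).2; move: tK.
  by rewrite notin_setE /= in_itv /= t0 /= => /negP; rewrite -ltNge => /ltW.
have derf (t : R) : 0 < t -> is_derive t (1 : R) (f : R -> R^o) (f' t).
  move=> t0; have t00 := ltW t0.
  have cL : x + s *: e @[s --> t] --> x + t *: e.
    by apply: cvgD; [exact: cvg_cst|apply: cvgZr_tmp; exact: cvg_id].
  have s0 : \forall s \near t, 0 < s by exact: lt_nbhsr.
  have [At|nA] := pselect (A (x + t *: e)).
    rewrite /f' rayE // /dP patchE mem_set //.
    have nA : \forall s \near t, A (x + s *: e).
      case: oA (At) => U oU AE; rewrite {1}AE => -[Ut _].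
      apply: filterS2 s0 (cL _ (open_near oU Ut)) => s s0 Us.
      by rewrite AE; split => //; apply: fquad => //; exact: ltW.
    apply: near_eq_is_derive (is_derive_smooth_on fquad oA sP At nA).
    apply: filterS2 s0 nA => s s0 As; rewrite /f rayE; last exact: ltW.
    by rewrite patchE mem_set.
  (* Outside [A] the support condition makes the patched function zero near the point, so its
     derivative is the value zero of [dP]. *)
  have qt : quad (x + t *: e) by exact: fquad.
  rewrite /f' rayE // /dP patchE memNset //.
  have fE : \forall s \near t, cst 0 s = f s.
    have := cL _ (csP.1 _ qt nA); apply: filterS2 s0 => s s0 Ps.
    rewrite /f rayE; last exact: ltW.
    by rewrite patchE; case: ifPn => // /set_mem /Ps ->.
  exact: near_eq_is_derive fE (is_derive_cst _ _ _).
rewrite (continuous_FTC2 (F := f) K0).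
- rewrite /f rayE ?(ltW K0) // rayE // scale0r addr0.
  by rewrite PN ?sub0e ?EFinN //; exact: (big K _).1.
- exact: continuous_subspaceT.
- split.
  + by move=> t; rewrite in_itv /= => /andP[/derf[]].
  + by apply: cvg_at_right_filter; exact: cf.
  + by apply: cvg_at_left_filter; exact: cf.
- move=> t; rewrite in_itv /= => /andP[/derf[_ <-] _].
  by rewrite derive1E.
Qed.

End Ray.
End QuadrantStokes.

Section QuadrantIntegralLinear.
Context {R : realType}.
Implicit Types F G : 'rV[R]_2 -> R.

Lemma quadrant_integralB F G : quadrant_cc F -> quadrant_cc G ->
  quadrant_integral (fun x => F x - G x) =
  quadrant_integral F - quadrant_integral G.
Proof.
by move=> ccF ccG; rewrite /quadrant_integral RintegralB //;
  exact: quadrant_cc_integrable.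
Qed.

Lemma quadrant_ccD F G : quadrant_cc F -> quadrant_cc G ->
  quadrant_cc (fun x => F x + G x).
Proof.
move=> [F0 [N N0 FN] cF] [G0 [N' N'0 GN] cG]; split.
- by move=> x nq; rewrite F0 // G0 // addr0.
- exists (Num.max N N'); first by rewrite lt_max N0.
  by move=> x; rewrite gt_max => /andP[/FN-> /GN->]; rewrite addr0.
- by move=> x qx; apply: cvgD; [exact: cF|exact: cG].
Qed.

Lemma quadrant_cc0 : quadrant_cc (fun=> 0 : R).
Proof. by split => //; [exists 1|move=> x _; exact: cvg_cst]. Qed.

Lemma quadrant_ccZ c F : quadrant_cc F -> quadrant_cc (fun x => c * F x).
Proof.
move=> [F0 [N N0 FN] cF]; split.
- by move=> x nq; rewrite F0 // mulr0.
- by exists N => // x Nx; rewrite FN // mulr0.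
- by move=> x qx; apply: cvgM; [exact: cvg_cst|exact: cF].
Qed.

Lemma quadrant_integralZ c F : quadrant_cc F ->
  quadrant_integral (fun x => c * F x) = c * quadrant_integral F.
Proof.
by move=> ccF; rewrite /quadrant_integral RintegralZl //;
  exact: quadrant_cc_integrable.
Qed.

Lemma quadrant_integralD F G : quadrant_cc F -> quadrant_cc G ->
  quadrant_integral (fun x => F x + G x) =
  quadrant_integral F + quadrant_integral G.
Proof.
by move=> ccF ccG; rewrite /quadrant_integral RintegralD //;
  exact: quadrant_cc_integrable.
Qed.

Lemma quadrant_cc_sum n (F : 'I_n -> 'rV[R]_2 -> R) :
  (forall i, quadrant_cc (F i)) -> quadrant_cc (fun x => \sum_i F i x).
Proof.
elim: n F => [|n IH] F ccF.
  by under eq_fun do rewrite big_ord0; exact: quadrant_cc0.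
under eq_fun do rewrite big_ord_recl.
by apply: quadrant_ccD => //; apply: IH.
Qed.

Lemma quadrant_integral_sum n (F : 'I_n -> 'rV[R]_2 -> R) :
  (forall i, quadrant_cc (F i)) ->
  quadrant_integral (fun x => \sum_i F i x) = \sum_i quadrant_integral (F i).
Proof.
elim: n F => [|n IH] F ccF.
  rewrite big_ord0 /quadrant_integral.
  under eq_Rintegral do rewrite big_ord0.
  by rewrite Rintegral_cst // mul0r.
rewrite big_ord_recl -IH // -quadrant_integralD //; last exact: quadrant_cc_sum.
by congr quadrant_integral; apply/funext => x; rewrite big_ord_recl.
Qed.

Lemma quadrant_cc_edge_integrable F i : quadrant_cc F ->
  (@lebesgue_measure R).-integrable setT
    (EFin \o (fun t : measurableTypeR R => F (t *: delta_mx 0 i))).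
Proof.
move=> ccF; have [F0 [N N0 FN] _] := ccF.
pose k (t : R) : 'rV[R]_2 := Num.max t 0 *: delta_mx 0 i.
have qk t : quadrant (k t).
  have := @forward_closed_quadrant R 0 i (Num.max t 0); rewrite add0r; apply.
    by move=> j; rewrite mxE.
  by rewrite le_max lexx orbT.
have ck : continuous k.
  move=> t; apply: cvgZr_tmp.
  by have := @continuous_max R R id (cst 0) t; apply;
    [exact: cvg_id|exact: cst_continuous].
have coord (t : R) : (t *: delta_mx 0 i : 'rV[R]_2) 0 i = t.
  by rewrite !mxE !eqxx mulr1.
have -> : (fun t : measurableTypeR R => F (t *: delta_mx 0 i)) =
    (F \o k) \_ `[0, N].
  apply/funext => t; rewrite patchE; case: ifPn => [|tN].
    by rewrite inE /= in_itv /= /k => /andP[t0 _]; rewrite max_l.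
  have [t0|t0] := ltP t 0.
    by apply: F0 => /(_ i); rewrite coord leNgt t0.
  apply: FN; move: tN; rewrite notin_setE /= in_itv /= t0 /= => /negP.
  rewrite -ltNge => Nt; apply: lt_le_trans (le_mx_norm _ 0 i).
  by rewrite coord (lt_le_trans Nt) // ler_norm.
rewrite -restrict_EFin; apply/integrable_restrict => //=; rewrite ?setTI.
apply: continuous_compact_integrable; first exact: segment_compact.
by apply: continuous_subspaceT; exact: quadrant_cc_comp.
Qed.

Lemma quadrant_integral_ge0 F : (forall x, 0 <= F x) ->
  0 <= quadrant_integral F.
Proof. by move=> F0; apply: Rintegral_ge0. Qed.

End QuadrantIntegralLinear.

Section Stokes.
Context {R : realType}.
Notation T := (measurableTypeR R).
Notation mu := (@lebesgue_measure R).
Notation mu2 := (mu \x mu)%E.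
Notation quad := (@quadrant R).
Variable A : set 'rV[R]_2.
Hypothesis oA : rel_open quad A.
Notation "'d_ i P" := (fun x => pderiv (V := R^o) P x i)
  (at level 10, i at level 8, P at level 9).

Let fquad := @forward_closed_quadrant R.

Let Rintegral_opp (p : T -> R) :
  mu.-integrable setT (EFin \o (fun y => - p y)) ->
  Rintegral mu setT (fun y => - p y) = - Rintegral mu setT p.
Proof.
move=> ip; rewrite -[LHS]opprK -[X in - X = _]mulN1r -RintegralZl //.
by congr (- _); apply: eq_Rintegral => y _; rewrite mulN1r opprK.
Qed.

Let scale_delta0 (x : R) : x *: delta_mx 0 ord0 = pt x 0.
Proof.
rewrite -[x in pt x _]add0r -pt_forward0 -[LHS]add0r; congr (_ + _).
by apply/rowP => i; have [->|->] := ord2P i; rewrite mxE ?pt0E ?pt1E.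
Qed.

Let scale_delta1 (y : R) : y *: delta_mx 0 ord_max = pt 0 y.
Proof.
rewrite -[y in pt _ y]add0r -pt_forward1 -[LHS]add0r; congr (_ + _).
by apply/rowP => i; have [->|->] := ord2P i; rewrite mxE ?pt0E ?pt1E.
Qed.

Lemma quadrant_cc_pderiv (P : 'rV[R]_2 -> R^o) i : smooth_on A P ->
  compactly_supported_in A P -> quadrant_cc (('d_i P) \_ A).
Proof.
move=> sP csP; apply: quadrant_cc_patch => //.
  exact: compactly_supported_pderiv.
by have sdP := smooth_on_pderiv fquad i oA sP; move=> y;
  exact: smooth_on_cvg sdP.
Qed.

(** Fubini's theorem with the integral in [x] inside: [ray_integral] evaluates it and leaves an
    integral over the edge [x = 0]. *)
Lemma flux_x (P : 'rV[R]_2 -> R^o) : smooth_on A P ->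
  compactly_supported_in A P ->
  quadrant_integral (('d_ord0 P) \_ A) =
  - Rintegral mu [set y | A (pt 0 y)] (fun y => P (pt 0 y)).
Proof.
move=> sP csP; have := quadrant_cc_integrable (quadrant_cc_pderiv ord0 sP csP).
rewrite Rintegral_mkcond /quadrant_integral /Rintegral.
set f := EFin \o _ => intf.
have GE y : fubini_G mu f y = (- (P \_ A) (pt 0 y))%:E.
  rewrite -(ray_integral oA sP csP (pt0E 0 y)).
  by apply: eq_integral => x _; rewrite pt_forward0 add0r.
have ccP : quadrant_cc (P \_ A).
  by apply: quadrant_cc_patch => // y; exact: smooth_on_cvg.
have := quadrant_ccZ (-1) ccP => /(quadrant_cc_edge_integrable ord_max).
have -> : (\int[mu2]_z f z = \int[mu]_y (- (P \_ A) (pt 0 y))%:E)%E.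
  by rewrite -integral21_prod_meas1 //; apply: eq_integral => y _; exact: GE.
by under eq_fun do rewrite mulN1r scale_delta1; move=> /Rintegral_opp.
Qed.

Lemma flux_y (P : 'rV[R]_2 -> R^o) : smooth_on A P ->
  compactly_supported_in A P ->
  quadrant_integral (('d_ord_max P) \_ A) =
  - Rintegral mu [set x | A (pt x 0)] (fun x => P (pt x 0)).
Proof.
move=> sP csP; have := quadrant_cc_integrable (quadrant_cc_pderiv ord_max sP
  csP).
rewrite Rintegral_mkcond /quadrant_integral /Rintegral.
set f := EFin \o _ => intf.
have FE x : fubini_F mu f x = (- (P \_ A) (pt x 0))%:E.
  rewrite -(ray_integral oA sP csP (pt1E x 0)).
  by apply: eq_integral => y _; rewrite pt_forward1 add0r.
have ccP : quadrant_cc (P \_ A).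
  by apply: quadrant_cc_patch => // y; exact: smooth_on_cvg.
have := quadrant_ccZ (-1) ccP => /(quadrant_cc_edge_integrable ord0).
have -> : (\int[mu2]_z f z = \int[mu]_x (- (P \_ A) (pt x 0))%:E)%E.
  by rewrite -integral12_prod_meas1 //; apply: eq_integral => x _; exact: FE.
by under eq_fun do rewrite mulN1r scale_delta0; move=> /Rintegral_opp.
Qed.

(* The coefficient of dh /\ dg. *)
Definition wedge_coef (h g : 'rV[R]_2 -> R^o) (x : 'rV[R]_2) : R :=
  pderiv h x ord0 * pderiv g x ord_max - pderiv h x ord_max * pderiv g x ord0.

(** The form [dh /\ dg] is the differential of [h dg]: its coefficient is the [x]-derivative of [P]
    minus the [y]-derivative of [Q], the second derivatives of [g] cancelling by [pderivC]. The two
    flux lemmas evaluate the terms. *)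
Lemma quadrant_stokes (h g : 'rV[R]_2 -> R^o) :
  smooth_on A h -> smooth_on A g ->
  compactly_supported_in A h ->
  quadrant_integral (wedge_coef h g \_ A) =
  Rintegral mu [set x | A (pt x 0)] (fun x =>
    h (pt x 0) * pderiv g (pt x 0) ord0)
  - Rintegral mu [set y | A (pt 0 y)]
      (fun y => h (pt 0 y) * pderiv g (pt 0 y) ord_max).
Proof.
move=> sh sg csh.
pose P x : R^o := h x * pderiv g x ord_max.
pose Q x : R^o := h x * pderiv g x ord0.
have sd i : smooth_on A (fun x => pderiv g x i) :=
  smooth_on_pderiv fquad i oA sg.
have sP : smooth_on A P by apply: smooth_onM => //; exact: sd.
have sQ : smooth_on A Q by apply: smooth_onM => //; exact: sd.
have csP : compactly_supported_in A P by exact: compactly_supportedM.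
have csQ : compactly_supported_in A Q by exact: compactly_supportedM.
have -> : wedge_coef h g \_ A =
    (fun x => (('d_ord0 P) \_ A) x - (('d_ord_max Q) \_ A) x).
  apply/funext => x; rewrite /restrict /patch.
  case: (boolP (x \in A)) => [/set_mem Ax|_]; last by rewrite subr0.
  rewrite (pderivM fquad ord0 oA sh (sd ord_max) Ax).
  rewrite (pderivM fquad ord_max oA sh (sd ord0) Ax).
  rewrite (pderivC fquad ord0 ord_max oA sg Ax).
  rewrite [RHS](_ : _ = pderiv g x ord_max * pderiv h x ord0 -
    pderiv g x ord0 * pderiv h x ord_max).
    by congr (_ - _); exact: mulrC.
  by rewrite opprD addrACA subrr add0r.
rewrite quadrant_integralB; [|exact: quadrant_cc_pderiv..].
apply: etrans (congr2 (fun a b => a - b) (flux_x sP csP) (flux_y sQ csQ)) _.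
by rewrite opprK addrC.
Qed.

End Stokes.

(** * Manifolds in coordinates *)

Local Notation coord := Defs.coord.

Section Charts.
Context {R : realType} {m : nat} {H : set 'rV[R]_m} (X : manifold H).
Hypothesis fH : forward_closed H.
Implicit Types (c : chart R X m) (p : X) (W : set X).

Definition chart_image c W : set 'rV[R]_m := coord c @` (dom c `&` W).

Lemma dom_open c : atlas c -> open (dom c).
Proof. by move=> /atlas_chart[]. Qed.

Lemma coordK c p : atlas c -> dom c p -> param c (coord c p) = p.
Proof. by move=> /atlas_chart[_ _ + _ _]; exact. Qed.

Lemma image_of_coord c p : dom c p -> image_of c (coord c p).
Proof. by move=> cp; exists p. Qed.

Lemma paramK c x : atlas c -> image_of c x ->
  dom c (param c x) /\ coord c (param c x) = x.
Proof. by move=> ac [p cp <-]; rewrite coordK. Qed.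

Lemma chart_imageP c W x : atlas c ->
  chart_image c W x <-> image_of c x /\ W (param c x).
Proof.
move=> ac; split=> [[p [cp Wp] <-]|[ix Wx]].
  by rewrite coordK //; split => //; exact: image_of_coord.
by have [cx xE] := paramK ac ix; exists (param c x).
Qed.

Lemma param_cvg c x : atlas c -> image_of c x ->
  param c y @[y --> within (image_of c) (nbhs x)] --> param c x.
Proof. by move=> /atlas_chart[_ _ _ _ /subspace_continuousP]; apply. Qed.

Lemma coord_cvg c p : atlas c -> dom c p -> coord c q @[q --> p] --> coord c p.
Proof.
move=> ac cp; have [oc _ _ /subspace_continuousP cc _] := atlas_chart ac.
by have := cc p cp; rewrite within_interior //; exact: open_nbhs_nbhs.
Qed.

Lemma rel_open_image c : atlas c -> rel_open H (image_of c).
Proof. by move=> /atlas_chart[]. Qed.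

Lemma rel_open_chart_image c W :
  atlas c -> open W -> rel_open H (chart_image c W).
Proof.
move=> ac oW; have -> : chart_image c W =
    image_of c `&` [set x | image_of c x -> W (param c x)]°.
  apply/seteqP; split => x.
    move=> /(chart_imageP _ _ ac)[ix Wx]; split => //.
    have : nbhs (param c x) W by exact: open_nbhs_nbhs.
    exact: (param_cvg ac ix).
  by move=> [ix /interior_subset Wx]; apply/chart_imageP => //; split; auto.
by apply: rel_openI; [exact: rel_open_image|exact: open_interior].
Qed.

Lemma chart_image_coord c W p : dom c p -> W p -> chart_image c W (coord c p).
Proof. by move=> cp Wp; exists p. Qed.

Definition trans c c' p : 'M[R]_m := jac (coord c' \o param c) (coord c p).

Lemma frameE c p : frame c p = trans c (chart_at p) p. Proof. by []. Qed.

Lemma trans_id c p : atlas c -> dom c p -> trans c c p = 1%:M.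
Proof.
move=> ac cp.
rewrite /trans (eq_jac (g := id) fH (rel_open_image ac) (image_of_coord cp)).
  exact: jac_id (rel_open_image ac) (image_of_coord cp).
by move=> x /(paramK ac)[].
Qed.

(** The cocycle rule: on the image of the triple overlap the direct coordinate change is the
    composite of the two others, and the chain rule applies. *)
Lemma trans_comp c1 c2 c3 p : atlas c1 -> atlas c2 -> atlas c3 ->
  dom c1 p -> dom c2 p -> dom c3 p ->
  trans c1 c3 p = trans c1 c2 p *m trans c2 c3 p.
Proof.
move=> a1 a2 a3 d1 d2 d3.
pose W := dom c2 `&` dom c3.
have oW : open W by apply: openI; exact: dom_open.
have oA := rel_open_chart_image a1 oW.
have oB := rel_open_chart_image a2 (dom_open a3).
have Ap : chart_image c1 W (coord c1 p) by exact: chart_image_coord.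
have sf : smooth_on (chart_image c1 W) (coord c2 \o param c1).
  by apply: smooth_on_sub (atlas_smooth a1 a2) => _ [q [cq [? ?]] <-]; exists q.
have fAB x : chart_image c1 W x ->
    chart_image c2 (dom c3) ((coord c2 \o param c1) x).
  by move=> [q [c1q [c2q c3q]] <-] /=; rewrite coordK //; exists q.
have := jac_comp fH fH oA oB sf fAB (atlas_smooth a2 a3) Ap.
rewrite /= coordK // -/(trans c1 c2 p) -/(trans c2 c3 p) => <-.
apply: (eq_jac fH oA Ap) => x [q [c1q [c2q c3q]] <-] /=.
by rewrite coordK // coordK.
Qed.

Lemma transK c c' p : atlas c -> atlas c' -> dom c p -> dom c' p ->
  trans c c' p *m trans c' c p = 1%:M.
Proof. by move=> ac ac' cp cp'; rewrite -trans_comp // trans_id. Qed.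

Lemma trans_unit c c' p : atlas c -> atlas c' -> dom c p -> dom c' p ->
  trans c c' p \in unitmx.
Proof.
by move=> ac ac' cp cp'; have [] := mulmx1_unit (transK ac ac' cp cp').
Qed.

Lemma frame_unit c p : atlas c -> dom c p -> frame c p \in unitmx.
Proof.
move=> ac cp; apply: trans_unit => //; first exact: atlas_chart_at.
exact: dom_chart_at.
Qed.

Lemma frame_trans c c' p : atlas c -> atlas c' -> dom c p -> dom c' p ->
  frame c p = trans c c' p *m frame c' p.
Proof.
move=> ac ac' cp cp'; apply: trans_comp => //; first exact: atlas_chart_at.
exact: dom_chart_at.
Qed.

Definition grad_in c (F : X -> R) p : 'rV[R]_m :=
  grad (F \o param c) (coord c p).

Lemma grad_in_trans c c' (F : X -> R) p : smooth_fun F -> atlas c -> atlas c' ->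
  dom c p -> dom c' p -> grad_in c F p = grad_in c' F p *m (trans c c' p)^T.
Proof.
move=> sF ac ac' cp cp'.
have oA := rel_open_chart_image ac (dom_open ac').
have Ap : chart_image c (dom c') (coord c p) by exact: chart_image_coord.
have fAB x : chart_image c (dom c') x ->
    image_of c' ((coord c' \o param c) x).
  by move=> [q [cq c'q] <-] /=; rewrite coordK //; exact: image_of_coord.
have := grad_comp fH fH oA (rel_open_image ac') (atlas_smooth ac ac') fAB
  (sF _ ac') Ap.
rewrite /= coordK // -/(trans c c' p) -/(grad_in c' F p) => <-.
apply: (eq_grad fH oA Ap) => x [q [cq c'q] <-] /=.
by rewrite coordK // coordK.
Qed.

(** Although [dfun] uses a different preferred chart at each point, its components in a fixed chart
    are the partial derivatives there. *)
Lemma covector_in_dfun c (F : X -> R) p : smooth_fun F -> atlas c -> dom c p ->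
  covector_in c (dfun F) p = grad_in c F p.
Proof.
move=> sF ac cp; rewrite (grad_in_trans sF ac (atlas_chart_at p) cp) //.
exact: dom_chart_at.
Qed.

End Charts.

(** * Smooth maps between manifolds in coordinates *)

Section MapsInCharts.
Context {R : realType} {m m' : nat} {H : set 'rV[R]_m} {H' : set 'rV[R]_m'}.
Variables (X : manifold H) (Y : manifold H').
Hypotheses (fH : forward_closed H) (fH' : forward_closed H').
Variable u : X -> Y.
Hypothesis su : smooth_map u.

Definition map_jac (c : chart R X m) (c' : chart R Y m') (p : X) :
  'M[R]_(m, m') := jac (coord c' \o u \o param c) (coord c p).

Let open_preim (c' : chart R Y m') : atlas c' -> open (u @^-1` dom c').
Proof.
by move=> ac'; apply: open_comp (dom_open ac') => p _; exact: su.1.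
Qed.

Lemma map_jac_transl c1 c2 c' p : atlas c1 -> atlas c2 -> atlas c' ->
  dom c1 p -> dom c2 p -> dom c' (u p) ->
  map_jac c1 c' p = trans c1 c2 p *m map_jac c2 c' p.
Proof.
move=> a1 a2 a' d1 d2 d'.
pose W := dom c2 `&` u @^-1` dom c'.
have oW : open W by apply: openI; [exact: dom_open|exact: open_preim].
have oA := rel_open_chart_image a1 oW.
have oB := rel_open_chart_image a2 (open_preim a').
have Ap : chart_image c1 W (coord c1 p) by exact: chart_image_coord.
have sf : smooth_on (chart_image c1 W) (coord c2 \o param c1).
  by apply: smooth_on_sub (atlas_smooth a1 a2) => _ [q [cq [? ?]] <-]; exists q.
have fAB x : chart_image c1 W x ->
    chart_image c2 (u @^-1` dom c') ((coord c2 \o param c1) x).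
  by move=> [q [c1q [c2q c3q]] <-] /=; rewrite coordK //; exists q.
have := jac_comp fH fH oA oB sf fAB (su.2 _ _ a2 a') Ap.
rewrite /= coordK // -/(trans c1 c2 p) -/(map_jac c2 c' p) => <-.
apply: (eq_jac fH oA Ap) => x [q [c1q [c2q c3q]] <-] /=.
by rewrite coordK // coordK.
Qed.

Lemma map_jac_transr c c1 c2 p : atlas c -> atlas c1 -> atlas c2 ->
  dom c p -> dom c1 (u p) -> dom c2 (u p) ->
  map_jac c c2 p = map_jac c c1 p *m trans c1 c2 (u p).
Proof.
move=> a a1 a2 d d1 d2.
pose W := u @^-1` (dom c1) `&` u @^-1` (dom c2).
have oW : open W by apply: openI; exact: open_preim.
have oA := rel_open_chart_image a oW.
have oB := rel_open_chart_image a1 (dom_open a2).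
have Ap : chart_image c W (coord c p) by exact: chart_image_coord.
have sf : smooth_on (chart_image c W) (coord c1 \o u \o param c).
  by apply: smooth_on_sub (su.2 _ _ a a1) => _ [q [cq [? ?]] <-]; exists q.
have fAB x : chart_image c W x ->
    chart_image c1 (dom c2) ((coord c1 \o u \o param c) x).
  by move=> [q [cq [c1q c2q]] <-] /=; rewrite coordK //; exists (u q).
have := jac_comp fH fH' oA oB sf fAB (atlas_smooth a1 a2) Ap.
rewrite /= coordK // -/(map_jac c c1 p) -/(trans c1 c2 (u p)) => <-.
apply: (eq_jac fH oA Ap) => x [q [cq [c1q c2q]] <-] /=.
by rewrite coordK // coordK.
Qed.

(** The matrix [dmap u p] refers to the preferred charts at [p] and [u p], which vary without any
    regularity. This trades them for fixed charts, in which the Jacobian matrix is smooth. *)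
Lemma frame_dmap c c' p : atlas c -> atlas c' -> dom c p -> dom c' (u p) ->
  frame c p *m dmap u p = map_jac c c' p *m frame c' (u p).
Proof.
move=> a a' d d'.
have ap := atlas_chart_at p; have au := atlas_chart_at (u p).
have dp := dom_chart_at p; have du := dom_chart_at (u p).
by rewrite frameE -(map_jac_transl a ap au) // frameE -map_jac_transr.
Qed.

Lemma grad_in_comp c c' (F : Y -> R) p : smooth_fun F -> atlas c -> atlas c' ->
  dom c p -> dom c' (u p) ->
  grad_in c (F \o u) p = grad_in c' F (u p) *m (map_jac c c' p)^T.
Proof.
move=> sF a a' d d'.
have oA := rel_open_chart_image a (open_preim a').
have Ap : chart_image c (u @^-1` dom c') (coord c p) by exact:
  chart_image_coord.
have fAB x : chart_image c (u @^-1` dom c') x ->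
    image_of c' ((coord c' \o u \o param c) x).
  by move=> [q [cq c'q] <-] /=; rewrite coordK //; exact: image_of_coord.
have := grad_comp fH fH' oA (rel_open_image a') (su.2 _ _ a a') fAB
  (sF _ a') Ap.
rewrite /= coordK // -/(map_jac c c' p) -/(grad_in c' F (u p)) => <-.
apply: (eq_grad fH oA Ap) => x [q [cq c'q] <-] /=.
by rewrite coordK // coordK.
Qed.

Lemma smooth_fun_comp (F : Y -> R) : smooth_fun F -> smooth_fun (F \o u).
Proof.
move=> sF c ac x [p cp xE].
pose c' := chart_at (u p).
have a' : atlas c' by exact: atlas_chart_at.
have d' : dom c' (u p) by exact: dom_chart_at.
have oA := rel_open_chart_image ac (open_preim a').
have Ap : chart_image c (u @^-1` dom c') x.
  by rewrite -xE; exact: chart_image_coord.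
have fAB y : chart_image c (u @^-1` dom c') y ->
    image_of c' ((coord c' \o u \o param c) y).
  by move=> [q [cq c'q] <-] /=; rewrite coordK //; exact: image_of_coord.
have sFu := smooth_on_comp (su.2 _ _ ac a') fAB (sF _ a').
have [U [g [oU Ux Cg gf]]] := sFu x Ap.
(* [g] is an extension only along the part of [image_of c] that [u] sends into [c']; intersecting
   with [V] confines the points to that part. *)
have [V oV AE] := oA.
have Vx : V x by move: Ap; rewrite AE => -[].
have [W oW IE] := rel_open_image ac.
exists (U `&` V), g; split; [exact: openI|by []| |].
  by move=> k; apply: Ck_sub (Cg k) => y [].
move=> y [iy [Uy Vy]].
have Ay : chart_image c (u @^-1` dom c') y.
  by rewrite AE; split => //; move: iy; rewrite IE => -[].
rewrite gf //=; case: Ay => q [cq uq] <-.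
by rewrite !coordK.
Qed.

End MapsInCharts.

(** * Boundedness of the Poisson bracket *)

Section MatrixLimits.
Context {R : realType} {T : Type} {F : set_system T} {FF : Filter F}.

Lemma cvg_coord m n (f : T -> 'M[R]_(m, n)) (A : 'M[R]_(m, n)) i j :
  f @ F --> A ->
  f x i j @[x --> F] --> A i j.
Proof.
by move=> fA; exact: (cvg_comp _ _ fA (@coord_continuous R m n i j A)).
Qed.

Lemma cvg_mulmx m n k (f : T -> 'M[R]_(m, n)) (g : T -> 'M[R]_(n, k))
    (A : 'M[R]_(m, n)) (B : 'M[R]_(n, k)) :
  f @ F --> A -> g @ F --> B -> f x *m g x @[x --> F] --> A *m B.
Proof.
move=> fA gB; apply: cvg_mx => i j; rewrite mxE; under eq_fun do rewrite mxE.
by apply: (cvg_big add_continuous) => l _; apply: cvgM; exact: cvg_coord.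
Qed.

Lemma cvg_trmx m n (f : T -> 'M[R]_(m, n)) (A : 'M[R]_(m, n)) :
  f @ F --> A -> (f x)^T @[x --> F] --> A^T.
Proof.
move=> fA; apply: cvg_mx => i j; rewrite mxE; under eq_fun do rewrite mxE.
exact: cvg_coord.
Qed.

Lemma cvg_det n (f : T -> 'M[R]_n) (A : 'M[R]_n) : f @ F --> A ->
  \det (f x) @[x --> F] --> \det A.
Proof.
move=> fA; apply: (cvg_big add_continuous) => s _.
apply: cvgM; first exact: cvg_cst.
have mul_continuous : continuous (fun z : R * R => z.1 * z.2).
  by move=> z; apply: cvgM; [exact: cvg_fst|exact: cvg_snd].
by apply: (cvg_big mul_continuous) => i _; exact: cvg_coord.
Qed.

Lemma cvg_invmx n (f : T -> 'M[R]_n) (A : 'M[R]_n) :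
  f @ F --> A -> A \in unitmx ->
  invmx (f x) @[x --> F] --> invmx A.
Proof.
move=> fA Au; have dA := cvg_det fA.
have dA0 : \det A != 0 by rewrite -unitfE -unitmxE.
(* [invmx] follows Cramer's formula on invertible matrices only and returns its argument otherwise,
   so the formula is used where the determinant has become nonzero. *)
have fu : \forall x \near F, invmx (f x) = (\det (f x))^-1 *: \adj (f x).
  have : \forall x \near F, \det (f x) != 0 by exact: cvgr_neq0 dA dA0.
  by apply: filterS => x d0; rewrite /invmx unitmxE unitfE d0.
have aA : (\det (f x))^-1 *: \adj (f x) @[x --> F] --> invmx A.
  rewrite /invmx Au; apply: cvg_mx => i j; rewrite !mxE.
  under eq_fun do rewrite !mxE.
  apply: cvgM; first exact: cvgV.
  apply: cvgM; first exact: cvg_cst.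
  apply: cvg_det; apply: cvg_mx => k l; rewrite !mxE.
  by under eq_fun do rewrite !mxE; exact: cvg_coord.
by apply: cvg_trans aA; apply: near_eq_cvg; apply: filterS fu => x ->.
Qed.

End MatrixLimits.

Section PoissonBracket.
Context {R : realType} {m : nat} {H : set 'rV[R]_m} (X : manifold H).
Hypothesis fH : forward_closed H.

Lemma grad_in_cvg c (F : X -> R) x : smooth_fun F -> atlas c -> image_of c x ->
  grad_in c F (param c y) @[y --> within (image_of c) (nbhs x)] -->
  grad_in c F (param c x).
Proof.
move=> sF ac ix.
have E y : image_of c y -> grad_in c F (param c y) = grad (F \o param c) y.
  by move=> /(paramK ac)[_ yE]; rewrite /grad_in yE.
rewrite E //; have : grad (F \o param c) y @[y --> within (image_of c) (nbhs x)]
    --> grad (F \o param c) x.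
  apply: cvg_mx => i j; rewrite mxE; under eq_fun do rewrite mxE.
  have sd := smooth_on_pderiv fH j (rel_open_image ac) (sF c ac).
  exact: smooth_on_cvg sd ix.
apply: cvg_trans; apply: near_eq_cvg; rewrite near_withinE.
by near=> y => iy; rewrite E.
Unshelve. all: by end_near. Qed.

(** The frame of [c] cancels between the covectors and the inverse of the form. The bracket is thus
    expressed in a fixed chart, where its continuity can be seen. *)
Lemma poisson_in c (w : X -> 'M[R]_m) (F G : X -> R) p :
  smooth_fun F -> smooth_fun G -> w p \in unitmx -> atlas c -> dom c p ->
  poisson w F G p = (grad_in c G p *m (invmx (bilinear_in c w p))^T *m
    (grad_in c F p)^T) 0 0.
Proof.
move=> sF sG wu ac cp; have fu := frame_unit fH ac cp.
rewrite -!covector_in_dfun // /covector_in /bilinear_in /poisson /sgrad.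
rewrite mulmxKV // !mulNmx linearN /= mulmxN opprK trmx_mul trmx_inv.
have ftu : (frame c p)^T \in unitmx by rewrite unitmx_tr.
have -> : invmx (frame c p *m w p *m (frame c p)^T) =
    invmx (frame c p)^T *m invmx (w p) *m invmx (frame c p).
  apply: (can_inj (mulmxK (_ : frame c p *m w p *m (frame c p)^T \in unitmx))).
    by rewrite !unitmx_mul fu wu.
  rewrite mulVmx ?unitmx_mul ?fu ?wu // -!mulmxA (mulKmx fu) (mulKmx wu).
  by rewrite mulVmx.
rewrite !trmx_mul !trmx_inv trmxK !mulmxA (mulmxK ftu).
by rewrite -!mulmxA (mulKmx fu).
Qed.

Lemma poisson_continuous (w : X -> 'M[R]_m) (F G : X -> R) :
  smooth_bilinear w -> (forall p, w p \in unitmx) ->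
  smooth_fun F -> smooth_fun G -> continuous (poisson w F G).
Proof.
move=> sw wu sF sG p.
pose c := chart_at p.
have ac : atlas c by exact: atlas_chart_at.
have cp : dom c p by exact: dom_chart_at.
pose phi x := poisson w F G (param c x).
have phi_cvg : phi x @[x --> within (image_of c) (nbhs (coord c p))] -->
    poisson w F G p.
  have ix := image_of_coord cp.
  have E x : image_of c x -> phi x = (grad_in c G (param c x) *m
      (invmx (bilinear_in c w (param c x)))^T *m
      (grad_in c F (param c x))^T) 0 0.
    by move=> ix'; rewrite /phi (poisson_in sF sG _ ac) //;
      have [] := paramK ac ix'.
  rewrite -{2}(coordK ac cp) -/(phi (coord c p)) E //.
  have bu : bilinear_in c w (param c (coord c p)) \in unitmx.
    rewrite coordK // /bilinear_in !unitmx_mul unitmx_tr wu.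
    by rewrite (frame_unit fH ac cp).
  have lim : (grad_in c G (param c x) *m (invmx (bilinear_in c w (param c
    x)))^T *m
      (grad_in c F (param c x))^T) 0 0
      @[x --> within (image_of c) (nbhs (coord c p))] -->
      (grad_in c G (param c (coord c p)) *m
      (invmx (bilinear_in c w (param c (coord c p))))^T *m
      (grad_in c F (param c (coord c p)))^T) 0 0.
    apply: cvg_coord; apply: cvg_mulmx; last first.
      by apply: cvg_trmx; exact: grad_in_cvg.
    apply: cvg_mulmx; first exact: grad_in_cvg.
    apply: cvg_trmx; apply: cvg_invmx bu.
    exact: (smooth_on_cvg (sw c ac) ix).
  apply: cvg_trans lim; apply: near_eq_cvg; rewrite near_withinE.
  by near=> x => ix'; rewrite /= E.
have dc : \forall q \near p, dom c q.
  by apply: open_nbhs_nbhs; split => //; exact: dom_open.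
move=> V /phi_cvg nV.
have cV : \forall q \near p, image_of c (coord c q) -> V (phi (coord c q)).
  exact: (coord_cvg ac cp nV).
change (\forall q \near p, V (poisson w F G q)).
apply: filterS2 dc cV => q cq; rewrite /phi coordK //; apply.
exact: image_of_coord.
Unshelve. all: by end_near. Qed.

Lemma grad_in_supp c (F : X -> R) p : atlas c -> dom c p ->
  ~ closure [set q | F q != 0] p -> grad_in c F p = 0.
Proof.
move=> ac cp nFp.
pose W := ~` closure [set q | F q != 0].
have oW : open W by apply: closed_openC; exact: closed_closure.
have oA := rel_open_chart_image ac oW.
have Ap : chart_image c W (coord c p) by exact: chart_image_coord.
rewrite /grad_in (eq_grad (g := cst 0) fH oA Ap); last first.
  move=> x /(chart_imageP _ _ ac)[_ Wx] /=; apply/eqP/negPn/negP => Fx.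
  by apply: Wx; exact: subset_closure.
apply/rowP => i; rewrite !mxE pderiv_differentiable.
  by rewrite derive_cst.
exact: differentiable_cst.
Qed.

Lemma poisson_supp (w : X -> 'M[R]_m) (F G : X -> R) p :
  ~ closure [set q | F q != 0] p -> poisson w F G p = 0.
Proof.
move=> nFp; have dF0 : dfun F p = 0.
  by apply: grad_in_supp nFp; [exact: atlas_chart_at|exact: dom_chart_at].
by rewrite /poisson /sgrad dF0 oppr0 mul0mx trmx0 mulmx0 mxE.
Qed.

(** The bracket is continuous and vanishes off the compact support of [F]. Boundedness ensures that
    the [sup] in [max_norm] is a genuine supremum and not a default value. *)
Lemma poisson_bounded (w : X -> 'M[R]_m) (F G : X -> R) :
  smooth_bilinear w -> (forall p, w p \in unitmx) ->
  smooth_compact_support F -> smooth_fun G ->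
  exists K, forall p, `|poisson w F G p| <= K.
Proof.
move=> sw wu [sF cF] sG.
have cP := continuous_subspaceT (poisson_continuous sw wu sF sG).
have [M [_ MP]] := compact_bounded (continuous_compact (cP _) cF).
exists (Num.max 0 (M + 1)) => p; rewrite le_max.
have [Fp|nFp] := pselect (closure [set q | F q != 0] p).
  by apply/orP; right; apply: (MP (M + 1)); [rewrite ltrDl|exists p].
by rewrite poisson_supp // normr0 lexx.
Qed.

End PoissonBracket.

(** * Integration over surfaces *)

Section ChartIntegrals.
Context {R : realType}.
Notation quad := (@quadrant R).
Variable S : manifold quad.
Hypothesis S_compact : compact [set: S].
Implicit Types (c : chart R S 2) (q : S -> R) (K : set S).

Let fquad := @forward_closed_quadrant R.

Definition chart_ext c q : 'rV[R]_2 -> R := (q \o param c) \_ (image_of c).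

Definition chart_integral c q : R := quadrant_integral (chart_ext c q).

Definition chart_continuous c q : Prop := forall x, image_of c x ->
  q (param c y) @[y --> within (image_of c) (nbhs x)] --> q (param c x).

Lemma chart_ext_in c q x : image_of c x -> chart_ext c q x = q (param c x).
Proof. by move=> ix; rewrite /chart_ext /restrict /patch mem_set. Qed.

Lemma chart_ext_out c q x : ~ image_of c x -> chart_ext c q x = 0.
Proof. by move=> ix; rewrite /chart_ext /restrict /patch memNset. Qed.

Lemma compact_coord_image c K : atlas c -> closed K -> K `<=` dom c ->
  compact (coord c @` K).
Proof.
move=> ac cK Kc; apply: continuous_compact; last first.
  exact: (subclosed_compact cK S_compact).
apply: continuous_in_subspaceT => z /set_mem Kz.
by apply: coord_cvg => //; exact: Kc.
Qed.

Lemma near_not_coord_image c K x : atlas c -> closed K -> K `<=` dom c ->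
  ~ (coord c @` K) x -> \forall y \near x, ~ (coord c @` K) y.
Proof.
move=> ac cK Kc nx; apply: (@open_nbhs_nbhs _ x (~` (coord c @` K))).
split => //; apply: closed_openC; apply: compact_closed.
  exact: norm_hausdorff.
exact: compact_coord_image.
Qed.

Lemma chart_compactly_supported c q K : atlas c -> closed K -> K `<=` dom c ->
  (forall z, dom c z -> ~ K z -> q z = 0) ->
  compactly_supported_in (image_of c) (q \o param c).
Proof.
move=> ac cK Kc qK.
have q0 x : image_of c x -> ~ (coord c @` K) x -> q (param c x) = 0.
  move=> ix nx; have [cz xE] := paramK ac ix; apply: qK => // Kz.
  by apply: nx; exists (param c x).
split=> [x qx nix|].
  have nx : ~ (coord c @` K) x.
    by move=> [z Kz zx]; apply: nix; exists z => //; exact: Kc.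
  apply: filterS (near_not_coord_image ac cK Kc nx) => y ny iy.
  exact: q0.
have [M [_ MK]] := compact_bounded (compact_coord_image ac cK Kc).
exists (Num.max 1 (M + 1)); first by rewrite lt_max ltr01.
move=> x ix; rewrite gt_max => /andP[_ Mx]; apply: q0 => // Kx.
have M1 : M < M + 1 by rewrite ltrDl.
by have /= := MK _ M1 x Kx; rewrite leNgt Mx.
Qed.

Lemma chart_ext_cc c q K : atlas c -> chart_continuous c q ->
  closed K -> K `<=` dom c -> (forall z, dom c z -> ~ K z -> q z = 0) ->
  quadrant_cc (chart_ext c q).
Proof.
move=> ac cq cK Kc qK; apply: quadrant_cc_patch => //;
  first exact: rel_open_image.
exact: chart_compactly_supported cK Kc qK.
Qed.

Section Change.
Variables (c c' : chart R S 2) (K : set S).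
Hypotheses (ac : atlas c) (ac' : atlas c') (cK : closed K)
  (Kc : K `<=` dom c) (Kc' : K `<=` dom c').
Hypothesis det_gt0 : forall z, dom c z -> dom c' z -> 0 < \det (trans c c' z).

(** The closed set [K] lies in both charts and carries both densities; compactness of the surface
    then gives the support conditions of the planar inequality on the overlap. *)
Lemma chart_change_le (q q' : S -> R) :
  chart_continuous c q -> chart_continuous c' q' ->
  (forall z, dom c z -> ~ K z -> q z = 0) ->
  (forall z, dom c' z -> ~ K z -> q' z = 0) ->
  (forall z, 0 <= q' z) ->
  (forall z, dom c z -> dom c' z -> q z = q' z * \det (trans c c' z)) ->
  chart_integral c' q' <= chart_integral c q.
Proof.
move=> cq cq' qK q'K q'0 qE.
have oA := rel_open_chart_image ac (dom_open ac').
have oB := rel_open_chart_image ac' (dom_open ac).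
apply: (change_of_variables_le (A := chart_image c (dom c'))
  (B := chart_image c' (dom c)) (phi := coord c' \o param c)
  (psi := coord c \o param c')) => //.
- exact: atlas_smooth.
- by move=> y By; apply: smooth_on_cvg By; exact: atlas_smooth.
- by move=> _ [z [cz c'z] <-] /=; rewrite coordK //; exists z.
- by move=> _ [z [cz c'z] <-] /=; rewrite coordK //; exists z.
- by move=> _ [z [cz c'z] <-] /=; rewrite coordK // coordK.
- by move=> _ [z [cz c'z] <-] /=; exact: det_gt0.
- exact: chart_ext_cc cK Kc' q'K.
- exact: chart_ext_cc cK Kc qK.
- by move=> y; rewrite /chart_ext /restrict /patch; case: ifP => // _;
  exact: q'0.
- move=> y nB; have [iy|niy] := pselect (image_of c' y);
  last exact: chart_ext_out.
  rewrite chart_ext_in //; have [cz yE] := paramK ac' iy.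
  by apply: q'K => // Kz; apply: nB; exists (param c' y) => //; split => //;
    exact: Kc.
- move=> _ [z [cz c'z] <-] /=; rewrite chart_ext_in; last exact: image_of_coord.
  rewrite coordK // chart_ext_in; last exact: image_of_coord.
  by rewrite coordK // qE.
- move=> x qx nA.
  have nx : ~ (coord c @` K) x.
    by move=> [z Kz zx]; apply: nA; exists z => //; split;
      [exact: Kc|exact: Kc'].
  apply: filterS (near_not_coord_image ac cK Kc nx) => y ny.
  have [iy|niy] := pselect (image_of c y); last exact: chart_ext_out.
  rewrite chart_ext_in //; have [cz yE] := paramK ac iy.
  by apply: qK => // Kz; apply: ny; exists (param c y).
Qed.

End Change.

Lemma chart_integralD c q1 q2 : quadrant_cc (chart_ext c q1) ->
  quadrant_cc (chart_ext c q2) ->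
  chart_integral c (fun z => q1 z + q2 z) = chart_integral c q1 +
    chart_integral c q2.
Proof.
move=> cc1 cc2; rewrite /chart_integral -quadrant_integralD //.
congr quadrant_integral; apply/funext => x.
by rewrite /chart_ext /restrict /patch; case: ifP => // _; rewrite addr0.
Qed.

Lemma chart_integralZ c k q : quadrant_cc (chart_ext c q) ->
  chart_integral c (fun z => k * q z) = k * chart_integral c q.
Proof.
move=> ccq; rewrite /chart_integral -quadrant_integralZ //.
congr quadrant_integral; apply/funext => x.
by rewrite /chart_ext /restrict /patch; case: ifP => // _; rewrite mulr0.
Qed.

Lemma chart_integral_sum c n (q : 'I_n -> S -> R) :
  (forall i, quadrant_cc (chart_ext c (q i))) ->
  chart_integral c (fun z => \sum_i q i z) = \sum_i chart_integral c (q i).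
Proof.
move=> ccq; rewrite /chart_integral -quadrant_integral_sum //.
congr quadrant_integral; apply/funext => x.
by rewrite /chart_ext /restrict /patch; case: ifP => // _; rewrite big1.
Qed.

Lemma eq_chart_integral c q1 q2 :
  atlas c -> (forall z, dom c z -> q1 z = q2 z) ->
  chart_integral c q1 = chart_integral c q2.
Proof.
move=> ac q12; congr quadrant_integral; apply/funext => x.
have [ix|nix] := pselect (image_of c x); last by rewrite !chart_ext_out.
by rewrite !chart_ext_in // q12 //; have [] := paramK ac ix.
Qed.

Section SignedChange.
Variables (c c' : chart R S 2) (K : set S).
Hypotheses (ac : atlas c) (ac' : atlas c') (cK : closed K)
  (Kc : K `<=` dom c) (Kc' : K `<=` dom c').
Hypothesis det_gt0 : forall z, dom c z -> dom c' z -> 0 < \det (trans c c' z).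

Let det_trans_inv z : dom c z -> dom c' z ->
  \det (trans c c' z) * \det (trans c' c z) = 1.
Proof. by move=> cz c'z; rewrite -det_mulmx transK // det1. Qed.

(** The inequality is used for the coordinate change and for its inverse, whose determinant is the
    reciprocal. *)
Let chart_change_ge0 (q q' : S -> R) :
  chart_continuous c q -> chart_continuous c' q' ->
  (forall z, dom c z -> ~ K z -> q z = 0) ->
  (forall z, dom c' z -> ~ K z -> q' z = 0) ->
  (forall z, 0 <= q z) -> (forall z, 0 <= q' z) ->
  (forall z, dom c z -> dom c' z -> q z = q' z * \det (trans c c' z)) ->
  chart_integral c q = chart_integral c' q'.
Proof.
move=> cq cq' qK q'K q0 q'0 qE; apply/eqP; rewrite eq_le; apply/andP; split.
  apply: (chart_change_le ac' ac cK Kc' Kc) => // z c'z cz.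
    by rewrite -(pmulr_rgt0 _ (det_gt0 cz c'z)) det_trans_inv.
  by rewrite qE // -mulrA det_trans_inv // mulr1.
exact: (chart_change_le ac ac' cK Kc Kc').
Qed.

(* Split the densities into their positive and negative parts. *)
Lemma chart_change (q q' : S -> R) :
  chart_continuous c q -> chart_continuous c' q' ->
  (forall z, dom c z -> ~ K z -> q z = 0) ->
  (forall z, dom c' z -> ~ K z -> q' z = 0) ->
  (forall z, dom c z -> dom c' z -> q z = q' z * \det (trans c c' z)) ->
  chart_integral c q = chart_integral c' q'.
Proof.
move=> cq cq' qK q'K qE.
(* For [e = 1] and [e = -1] these are twice the positive and the negative part, hence the factor
   [2^-1] in [parts]; the norm makes their continuity immediate. *)
pose part (e : R) (p : S -> R) z := `|p z| + e * p z.
have part_cont e c0 p : chart_continuous c0 p -> chart_continuous c0 (part e p).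
  move=> cp x ix; apply: cvgD; first by apply: cvg_norm; exact: cp.
  by apply: cvgM; [exact: cvg_cst|exact: cp].
have part_supp e c0 p : (forall z, dom c0 z -> ~ K z -> p z = 0) ->
    forall z, dom c0 z -> ~ K z -> part e p z = 0.
  by move=> pK z cz nK; rewrite /part pK // normr0 mulr0 addr0.
have part_ge0 e p z : `|e| = 1 -> 0 <= part e p z.
  move=> e1; rewrite /part -[e * _]opprK subr_ge0 (le_trans (ler_norm _)) //.
  by rewrite normrN normrM e1 mul1r.
have partE e z : dom c z -> dom c' z ->
    part e q z = part e q' z * \det (trans c c' z).
  move=> cz c'z; rewrite /part qE // normrM (gtr0_norm (det_gt0 cz c'z)).
  by rewrite mulrDl mulrA.
have parts c0 p : atlas c0 -> K `<=` dom c0 -> chart_continuous c0 p ->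
    (forall z, dom c0 z -> ~ K z -> p z = 0) ->
    chart_integral c0 p =
    2^-1 * (chart_integral c0 (part 1 p) - chart_integral c0 (part (-1) p)).
  move=> a0 K0 cp pK.
  have cc e : quadrant_cc (chart_ext c0 (part e p)).
    by apply: chart_ext_cc (part_supp e c0 p pK) => //; exact: part_cont.
  rewrite -[X in _ - X]mul1r -mulNr -chart_integralZ // -chart_integralD //.
    rewrite -chart_integralZ.
      apply: eq_chart_integral => // z _; rewrite /part.
      by move: `|p z| (p z) => a b; field.
    apply: chart_ext_cc cK K0 _ => //.
      move=> x ix; apply: cvgD; first exact: part_cont.
      by apply: cvgM; [exact: cvg_cst|exact: part_cont].
    by move=> z cz nK; rewrite !(part_supp _ c0 p pK) // mulr0 addr0.
  apply: chart_ext_cc cK K0 _ => //.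
    by move=> x ix; apply: cvgM; [exact: cvg_cst|exact: part_cont].
  by move=> z cz nK; rewrite (part_supp _ c0 p pK) // mulr0.
rewrite (parts c q) // (parts c' q') //; congr (_ * (_ - _)).
  apply: chart_change_ge0 => //; try exact: part_cont; try exact: part_supp.
  - by move=> z; apply: part_ge0; rewrite normr1.
  - by move=> z; apply: part_ge0; rewrite normr1.
  - by move=> z; exact: partE.
apply: chart_change_ge0 => //; try exact: part_cont; try exact: part_supp.
- by move=> z; apply: part_ge0; rewrite normrN1.
- by move=> z; apply: part_ge0; rewrite normrN1.
- by move=> z; exact: partE.
Qed.

End SignedChange.
End ChartIntegrals.

(** * Orientation of surfaces *)

Section TwoByTwo.
Context {R : realType}.

(* The quadratic form v |-> det (v, v j) of a complex structure j is definite,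
   with the sign of its value at the first basis vector. *)
Lemma conj_complex_det_gt0 (j j' T : 'M[R]_2) : j' *m j' = - 1%:M ->
  j *m T = T *m j' -> T \in unitmx -> 0 < j ord0 ord_max ->
  0 < j' ord0 ord_max -> 0 < \det T.
Proof.
move=> jj jT; rewrite unitmxE unitfE => T0 b0 b'0.
have e00 : (j' *m j') ord0 ord0 = -1 by rewrite jj !mxE.
have e01 : (j' *m j') ord0 ord_max = 0 by rewrite jj !mxE /= oppr0.
have f0 := congr1 (fun M : 'M[R]_2 => M ord0 ord0) jT.
have f1 := congr1 (fun M : 'M[R]_2 => M ord0 ord_max) jT.
move: T0 b0 b'0 e00 e01 f0 f1; rewrite det2E /= !mulmx2E.
move: (j ord0 ord0) (j ord0 ord_max) (j' ord0 ord0) (j' ord0 ord_max)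
  (j' ord_max ord0) (j' ord_max ord_max) => al be al' be' ga' de'.
move: (T ord0 ord0) (T ord0 ord_max) (T ord_max ord0) (T ord_max ord_max).
move=> a b p q T0 b0 b'0 e00 e01 f0 f1.
have de : de' = - al'.
  have : be' * (al' + de') = 0 by rewrite mulrDr (mulrC be' al').
  move=> /eqP; rewrite mulf_eq0 (gt_eqF b'0) /= addrC addr_eq0 => /eqP; exact.
(* Let [v = (a, b)] be the first row of [T]. The first row of [j *m T = T *m j'] gives
   [be * det T = det (v, v j')]; after multiplication by [be'] this form is a sum of two squares,
   since [j'] squares to minus the identity. *)
have E : be * be' * (a * q - p * b) = (be' * a - al' * b) ^+ 2 + b ^+ 2.
  have -> : be * be' * (a * q - p * b) =
      be' * (a * (be * q) - b * (be * p)) by ring.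
  have -> : be * q = a * be' + b * de' - al * b by rewrite -f1; ring.
  have -> : be * p = a * al' + b * ga' - al * a by rewrite -f0; ring.
  rewrite de; have -> : b ^+ 2 = - (al' * al' + be' * ga') * b ^+ 2.
    by rewrite e00 opprK mul1r.
  ring.
rewrite -(pmulr_rgt0 _ (mulr_gt0 b0 b'0)) E lt0r addr_ge0 ?sqr_ge0 // andbT.
apply: contra T0; rewrite paddr_eq0 ?sqr_ge0 // !expf_eq0 /=.
move=> /andP[ab /eqP b00]; move: ab; rewrite b00 mulr0 subr0 mulf_eq0.
by rewrite (gt_eqF b'0) /= => /eqP ->; rewrite mul0r mulr0 subr0.
Qed.

End TwoByTwo.

Section Orientation.
Context {R : realType} (S : riemann_surface R).

Let fquad := @forward_closed_quadrant R.

(** The transition matrix intertwines the matrices of [j] in the two charts, and both of these have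
    a positive upper right entry by [surface_oriented]. *)
Lemma surface_trans_det_gt0 (c c' : chart R S 2) z : atlas c -> atlas c' ->
  dom c z -> dom c' z -> 0 < \det (trans c c' z).
Proof.
move=> ac ac' cz c'z.
have [_ jj] := @surface_complex _ S.
have fu := frame_unit fquad ac cz; have fu' := frame_unit fquad ac' c'z.
have Tu := trans_unit fquad ac ac' cz c'z.
apply: (@conj_complex_det_gt0 R (endo_in c (@surface_j _ S) z)
  (endo_in c' (@surface_j _ S) z)) => //; last 2 first.
- exact: surface_oriented.
- exact: surface_oriented.
- rewrite /endo_in !mulmxA mulmxKV // -(mulmxA (frame c' z)) jj.
  by rewrite mulmxN mulmx1 mulNmx mulmxV.
have FE := frame_trans fquad ac ac' cz c'z.
apply: (can_inj (mulmxK fu')); rewrite /endo_in -[LHS]mulmxA -FE mulmxKV //.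
by rewrite -[RHS]mulmxA mulmxKV // mulmxA -FE.
Qed.

End Orientation.

(** * The form dh /\ dg on a surface and Stokes' formula *)

Section WedgeInCharts.
Context {R : realType} {H : set 'rV[R]_2} (S : manifold H).
Hypothesis fH : forward_closed H.
Implicit Types (c : chart R S 2) (h g : S -> R).

Definition wedge_in c h g (z : S) : R :=
  grad_in c h z 0 ord0 * grad_in c g z 0 ord_max -
  grad_in c h z 0 ord_max * grad_in c g z 0 ord0.

Lemma wedge_in_trans c c' h g z : smooth_fun h -> smooth_fun g ->
  atlas c -> atlas c' -> dom c z -> dom c' z ->
  wedge_in c h g z = wedge_in c' h g z * \det (trans c c' z).
Proof.
move=> sh sg ac ac' cz c'z; rewrite /wedge_in.
rewrite (grad_in_trans fH sh ac ac' cz c'z) (grad_in_trans fH sg ac ac' cz c'z).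
move: (grad_in c' h z) (grad_in c' g z) (trans c c' z) => v w T.
by rewrite det2E !mulmx2E !mxE; ring.
Qed.

Lemma wedge_in_param c h g x : atlas c -> image_of c x ->
  wedge_in c h g (param c x) = wedge_coef (h \o param c) (g \o param c) x.
Proof.
by move=> ac ix; rewrite /wedge_in /grad_in !mxE (paramK ac ix).2.
Qed.

Lemma wedge_in_supp c h g z : atlas c -> dom c z ->
  ~ closure [set p | h p != 0] z -> wedge_in c h g z = 0.
Proof.
move=> ac cz nhz.
by rewrite /wedge_in (grad_in_supp fH ac cz nhz) !mxE !mul0r subr0.
Qed.

Lemma grad_in_sum c n (h : 'I_n -> S -> R) z : atlas c -> dom c z ->
  (forall i, smooth_fun (h i)) ->
  grad_in c (fun p => \sum_i h i p) z = \sum_i grad_in c (h i) z.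
Proof.
move=> ac cz sh; apply/rowP => j; rewrite summxE mxE.
rewrite (pderiv_sum fH j (rel_open_image ac) (fun i => sh i c ac)); last first.
  exact: image_of_coord.
by apply: eq_bigr => i _; rewrite mxE.
Qed.

Lemma wedge_in_sum c n (h : 'I_n -> S -> R) g z : atlas c -> dom c z ->
  (forall i, smooth_fun (h i)) ->
  wedge_in c (fun p => \sum_i h i p) g z = \sum_i wedge_in c (h i) g z.
Proof.
move=> ac cz sh; rewrite /wedge_in grad_in_sum // !summxE !mulr_suml -sumrB.
by [].
Qed.

Lemma wedge_in_continuous c h g x : smooth_fun h -> smooth_fun g ->
  atlas c -> image_of c x ->
  wedge_in c h g (param c y) @[y --> within (image_of c) (nbhs x)] -->
  wedge_in c h g (param c x).
Proof.
move=> sh sg ac ix; have gh := grad_in_cvg fH sh ac ix.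
have gg := grad_in_cvg fH sg ac ix.
by apply: cvgB; apply: cvgM; exact: cvg_coord.
Qed.

Lemma smooth_funM h g : smooth_fun h -> smooth_fun g ->
  smooth_fun (fun z => h z * g z).
Proof. by move=> sh sg c ac; apply: smooth_onM; [exact: sh|exact: sg]. Qed.

Lemma smooth_fun_cvg c h x : smooth_fun h -> atlas c -> image_of c x ->
  h (param c y) @[y --> within (image_of c) (nbhs x)] --> h (param c x).
Proof. by move=> sh ac ix; exact: smooth_on_cvg (sh c ac) ix. Qed.

End WedgeInCharts.

Section SurfaceStokes.
Context {R : realType} (S : riemann_surface R).
Variables (k k' : nat) (rho : 'I_k -> S -> R) (rho' : 'I_k' -> S -> R).
Variables (c : 'I_k -> chart R S 2) (c' : 'I_k' -> chart R S 2).
Hypotheses (pu : partition_of_unity rho c) (pu' : partition_of_unity rho' c').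
Variables f g : S -> R.
Hypotheses (sf : smooth_fun f) (sg : smooth_fun g).

Let fquad := @forward_closed_quadrant R.
Let S_cpt := @surface_compact _ S.
Let supp n (r : 'I_n -> S -> R) i := closure [set p | r i p != 0].

Let h i z : R := rho' i z * f z.

Let sh i : smooth_fun (h i).
Proof. by case: pu' => _ sr _ _ _; exact: smooth_funM. Qed.

Let h_supp i z : ~ supp rho' i z -> ~ closure [set p | h i p != 0] z.
Proof.
move=> nz hz; apply: nz; apply: closure_subset hz => p /=.
by apply: contra_neq => r0; rewrite /h r0 mul0r.
Qed.

Let rho0 n (r : 'I_n -> S -> R) i z : ~ supp r i z -> r i z = 0.
Proof.
by move=> nz; apply/eqP/negPn/negP => rz; apply: nz; exact: subset_closure.
Qed.

(** Stokes' formula in a single chart, for the form [h i dg]: the factor [rho' i] confines it to the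
    domain of [c' i]. *)
Let boundary_term i :
  Rintegral lebesgue_measure [set x : R | image_of (c' i) (pt x 0)]
    (fun x => let z := param (c' i) (pt x 0) in
              rho' i z * (f z * grad_in (c' i) g z 0 ord0))
  - Rintegral lebesgue_measure [set y : R | image_of (c' i) (pt 0 y)]
    (fun y => let z := param (c' i) (pt 0 y) in
              rho' i z * (f z * grad_in (c' i) g z 0 ord_max)) =
  chart_integral (c' i) (wedge_in (c' i) (h i) g).
Proof.
case: pu' => ac' sr r0 rc r1.
rewrite /chart_integral.
have -> : chart_ext (c' i) (wedge_in (c' i) (h i) g) =
    wedge_coef (h i \o param (c' i)) (g \o param (c' i)) \_ (image_of (c' i)).
  apply/funext => x; have [ix|nix] := pselect (image_of (c' i) x).
    by rewrite chart_ext_in // wedge_in_param // /restrict /patch mem_set.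
  by rewrite chart_ext_out // /restrict /patch memNset.
rewrite (quadrant_stokes (rel_open_image (ac' i)) (@sh i _ (ac' i))
  (@sg _ (ac' i))).
  congr (_ - _); apply: eq_Rintegral => x; rewrite inE /= => ix;
  by rewrite mulrA /grad_in mxE (paramK (ac' i) ix).2.
apply: (chart_compactly_supported S_cpt (ac' i) (K := supp rho' i)) => //.
- exact: closed_closure.
- exact: rc.
- by move=> z _ /rho0 r'0; rewrite /h r'0 mul0r.
Qed.

(** Localised by both partitions at once, this density is supported in [dom (c l)] and in
    [dom (c' i)], so its integral can be moved from one chart to the other. *)
Let term c0 l i z : R := rho l z * wedge_in c0 (h i) g z.

Let K l i := supp rho l `&` supp rho' i.

Let cK l i : closed (K l i).
Proof. by apply: closedI; exact: closed_closure. Qed.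

Let term_supp c0 l i z : atlas c0 -> dom c0 z -> ~ K l i z -> term c0 l i z = 0.
Proof.
move=> ac cz nK; rewrite /term.
have [rz|/rho0 ->] := pselect (supp rho l z); last by rewrite mul0r.
rewrite (wedge_in_supp fquad) ?mulr0 //; apply: h_supp => r'z.
by apply: nK; split.
Qed.

Let term_cont c0 l i : atlas c0 -> chart_continuous c0 (term c0 l i).
Proof.
case: pu => _ sr _ _ _ ac x ix; apply: cvgM; first exact: smooth_fun_cvg.
exact: wedge_in_continuous.
Qed.

Let Kc l i : K l i `<=` dom (c l).
Proof. by case: pu => _ _ _ rc _ z [/rc]. Qed.

Let Kc' l i : K l i `<=` dom (c' i).
Proof. by case: pu' => _ _ _ rc _ z [_ /rc]. Qed.

Let term_cc l i : quadrant_cc (chart_ext (c l) (term (c l) l i)).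
Proof.
case: pu => ac _ _ _ _; apply: (@chart_ext_cc _ _ S_cpt _ _ (K l i)) => //.
  exact: term_cont.
by move=> z; exact: term_supp.
Qed.

Let term_cc' l i : quadrant_cc (chart_ext (c' i) (term (c' i) l i)).
Proof.
case: pu' => ac' _ _ _ _; apply: (@chart_ext_cc _ _ S_cpt _ _ (K l i)) => //.
  exact: term_cont.
by move=> z; exact: term_supp.
Qed.

Let term_change l i : chart_integral (c' i) (term (c' i) l i) =
  chart_integral (c l) (term (c l) l i).
Proof.
case: pu => ac _ _ _ _; case: pu' => ac' _ _ _ _.
apply: (@chart_change _ _ S_cpt _ _ (K l i)) => //.
- by move=> z cz c'z; exact: surface_trans_det_gt0.
- exact: term_cont.
- exact: term_cont.
- by move=> z; exact: term_supp.
- by move=> z; exact: term_supp.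
- move=> z cz c'z; rewrite /term -mulrA; congr (_ * _).
  by apply: wedge_in_trans => //; exact: sh.
Qed.

(* Both partitions of unity are needed: the left-hand side is the boundary
   integral of f dg computed with rho', the right-hand side the surface integral
   of df /\ dg computed with rho. *)
Lemma surface_stokes :
  \sum_(i < k')
   (Rintegral lebesgue_measure [set x : R | image_of (c' i) (pt x 0)]
      (fun x => let z := param (c' i) (pt x 0) in
                rho' i z * (f z * grad_in (c' i) g z 0 ord0))
    - Rintegral lebesgue_measure [set y : R | image_of (c' i) (pt 0 y)]
      (fun y => let z := param (c' i) (pt 0 y) in
                rho' i z * (f z * grad_in (c' i) g z 0 ord_max))) =
  \sum_(l < k) chart_integral (c l) (fun z => rho l z * wedge_in (c l) f g z).
Proof.
case: pu => ac sr r0 rc r1; case: pu' => ac' sr' r'0 rc' r'1.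
under eq_bigr do rewrite boundary_term.
transitivity (\sum_(i < k') \sum_(l < k) chart_integral (c' i) (term (c' i) l
  i)).
  apply: eq_bigr => i _; rewrite -chart_integral_sum //.
  by apply: eq_chart_integral => // z cz; rewrite /term -mulr_suml r1 mul1r.
rewrite exchange_big /=; apply: eq_bigr => l _.
under eq_bigr do rewrite term_change.
rewrite -chart_integral_sum //; apply: eq_chart_integral => // z cz.
rewrite /term -mulr_sumr; congr (_ * _).
(* The [h i] are summed before differentiation; their sum is [f], so no derivative of the partition
   [rho'] remains. *)
transitivity (wedge_in (c l) (fun p => \sum_i h i p) g z).
  by apply/esym; apply: (wedge_in_sum fquad g (ac l) cz) => i; exact: sh.
congr wedge_in; apply/funext => p; rewrite /h -mulr_suml r'1.
exact: mul1r.
Qed.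

End SurfaceStokes.

(** * The area estimate *)

Section Pullbacks.
Context {R : realType} {m n : nat} {H : set 'rV[R]_m} {H' : set 'rV[R]_n}.
Variables (X : manifold H) (Y : manifold H').
Hypotheses (fH : forward_closed H) (fH' : forward_closed H').
Variable u : X -> Y.
Hypothesis su : smooth_map u.
Implicit Types (c : chart R X m) (F G : Y -> R).

Lemma bilinear_in_pullback c (c' : chart R Y n) (B : Y -> 'M[R]_n) z :
  atlas c -> atlas c' ->
  dom c z -> dom c' (u z) ->
  bilinear_in c (pullback2 u B) z =
  map_jac u c c' z *m bilinear_in c' B (u z) *m (map_jac u c c' z)^T.
Proof.
move=> ac ac' cz c'z; rewrite /bilinear_in /pullback2.
rewrite !mulmxA (frame_dmap fH fH' su ac ac' cz c'z).
rewrite -(mulmxA _ (dmap u z)^T) -trmx_mul (frame_dmap fH fH' su ac ac' cz c'z).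
by rewrite trmx_mul !mulmxA.
Qed.

Lemma dfun_pullback c F z : smooth_fun F -> atlas c -> dom c z ->
  dfun F (u z) *m (frame c z *m dmap u z)^T = grad_in c (F \o u) z.
Proof.
move=> sF ac cz; have ac' := atlas_chart_at (u z).
have c'z := dom_chart_at (u z).
rewrite (grad_in_comp fH fH' su sF ac ac' cz c'z) (frame_dmap fH fH' su ac ac'
  cz c'z).
by rewrite frameE trans_id // mulmx1.
Qed.

Lemma covector_in_pullback c F G z : smooth_fun G -> atlas c -> dom c z ->
  covector_in c (pullback1 u (fun_d F G)) z = F (u z) *: grad_in c (G \o u) z.
Proof.
move=> sG ac cz; rewrite /covector_in /pullback1 /fun_d -mulmxA -trmx_mul.
by rewrite -scalemxAl dfun_pullback.
Qed.

Lemma wedge_pullback c F G z : smooth_fun F -> smooth_fun G ->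
  atlas c -> dom c z -> bilinear_in c (pullback2 u (wedge_d F G)) z =
  (grad_in c (F \o u) z)^T *m grad_in c (G \o u) z -
  (grad_in c (G \o u) z)^T *m grad_in c (F \o u) z.
Proof.
move=> sF sG ac cz.
have dE E : smooth_fun E ->
    frame c z *m dmap u z *m (dfun E (u z))^T = (grad_in c (E \o u) z)^T.
  by move=> sE; rewrite -dfun_pullback // trmx_mul trmxK.
rewrite /bilinear_in /pullback2 /wedge_d !mulmxA.
rewrite -(mulmxA _ (dmap u z)^T) -trmx_mul mulmxBr mulmxBl !mulmxA !dE //.
by rewrite -!mulmxA !dfun_pullback.
Qed.

Lemma cvg_within_image c W (x : 'rV[R]_m) (T : topologicalType)
    (f : 'rV[R]_m -> T) (l : T) : atlas c -> open W -> chart_image c W x ->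
  f @ within (chart_image c W) (nbhs x) --> l ->
  f @ within (image_of c) (nbhs x) --> l.
Proof.
move=> ac oW Ax fl V /fl nV.
have cV : \forall y \near x, chart_image c W y -> V (f y) by exact: nV.
change (\forall y \near x, image_of c y -> V (f y)).
have [U oU AE] := rel_open_chart_image ac oW.
have [U' _ IE] := rel_open_image ac.
have Ux : U x by move: Ax; rewrite AE => -[].
apply: filterS2 (open_near oU Ux) cV => y Uy Vy iy; apply: Vy.
by rewrite AE; split => //; move: iy; rewrite IE => -[].
Qed.

(** Near [x] the preferred charts along [u] are replaced by the one at [u p], in which the pulled
    back form is a product of matrices depending continuously on the point. *)
Lemma bilinear_pullback_cvg c (B : Y -> 'M[R]_n) x : smooth_bilinear B ->
  atlas c -> image_of c x ->
  bilinear_in c (pullback2 u B) (param c y)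
    @[y --> within (image_of c) (nbhs x)] -->
  bilinear_in c (pullback2 u B) (param c x).
Proof.
move=> sB ac ix; have [cp xE] := paramK ac ix.
set p := param c x in cp xE *.
pose c' := chart_at (u p).
have ac' : atlas c' := atlas_chart_at (u p).
have c'p : dom c' (u p) := dom_chart_at (u p).
pose W := u @^-1` dom c'.
have oW : open W by apply: open_comp (dom_open ac') => q _; exact: su.1.
have Ax : chart_image c W x by apply/chart_imageP.
apply: (cvg_within_image ac oW Ax).
pose phi := coord c' \o u \o param c.
have sphi : smooth_on (chart_image c W) phi by exact: su.2.
pose J y := jac phi y *m bilinear_in c' B (param c' (phi y)) *m (jac phi y)^T.
have JE y : chart_image c W y ->
    bilinear_in c (pullback2 u B) (param c y) = J y.
  move=> /(chart_imageP _ _ ac)[iy Wy]; have [cy yE] := paramK ac iy.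
  rewrite (bilinear_in_pullback B ac ac' cy Wy) /map_jac yE /J.
  by rewrite /phi /= coordK.
rewrite JE //.
have Jcvg : J y @[y --> within (chart_image c W) (nbhs x)] --> J x.
  have jcvg : jac phi y @[y --> within (chart_image c W) (nbhs x)] --> jac phi
    x.
    apply: cvg_mx => i j.
    have sj := smooth_on_jac fH i j (rel_open_chart_image ac oW) sphi.
    exact: smooth_on_cvg sj Ax.
  apply: cvg_mulmx; last exact: cvg_trmx.
  apply: cvg_mulmx => //.
  have phi_in y : chart_image c W y -> image_of c' (phi y).
    by move=> [q [cq Wq] <-]; rewrite /phi /= coordK //; exact: image_of_coord.
  have bcvg := smooth_on_cvg (sB c' ac') (phi_in x Ax).
  move=> V /bcvg nV.
  have nV' : \forall w \near phi x, image_of c' w ->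
      V (bilinear_in c' B (param c' w)) by exact: nV.
  have nA : \forall y \near x, chart_image c W y -> image_of c' (phi y) ->
      V (bilinear_in c' B (param c' (phi y))).
    exact: (smooth_on_cvg sphi Ax nV').
  change (\forall y \near x, chart_image c W y ->
      V (bilinear_in c' B (param c' (phi y)))).
  by apply: filterS nA => y Vy Ay; apply: Vy => //; exact: phi_in.
apply: cvg_trans Jcvg; apply: near_eq_cvg; rewrite near_withinE.
by near=> y => Ay; rewrite JE.
Unshelve. all: by end_near. Qed.

End Pullbacks.

Section Positivity.
Context {R : realType} {m : nat} {H : set 'rV[R]_m} (M : manifold H).
Variables (S : riemann_surface R) (u : S -> M) (J w : M -> 'M[R]_m).
Hypotheses (hu : holomorphic J u) (Jw : compatible J w)
  (w_skew : forall p, (w p)^T = - w p).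

Let fquad := @forward_closed_quadrant R.

(* In the coordinates of c, j e1 = a e1 + b e2 with b > 0, so that
   b (u^*w)(e1, e2) = (u^*w)(e1, j e1) = w(u_* e1, J u_* e1) >= 0. *)
Lemma holomorphic_pullback_ge0 c z : atlas c -> dom c z ->
  0 <= bilinear_in c (pullback2 u w) z ord0 ord_max.
Proof.
move=> ac cz; have [_ _ wJ] := Jw.
have b0 := surface_oriented ac cz; have fu := frame_unit fquad ac cz.
pose B := frame c z *m dmap u z.
have jB : endo_in c (surface_j (r:=S)) z *m B = B *m J (u z).
  rewrite /endo_in /B !mulmxA mulmxKV // -!mulmxA; congr (_ *m _).
  by rewrite hu.2.
have bE : bilinear_in c (pullback2 u w) z = B *m w (u z) *m B^T.
  by rewrite /bilinear_in /pullback2 /B trmx_mul !mulmxA.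
rewrite -(pmulr_rge0 _ b0) bE.
move: (endo_in c _ z) b0 jB => j b0 jB.
set v := row ord0 B; set v' := row ord_max B.
have entry i k : (B *m w (u z) *m B^T) i k =
    (row i B *m w (u z) *m (row k B)^T) 0 0.
  by rewrite -row_mul tr_row !mxE; apply: eq_bigr => l _; rewrite !mxE.
have skew0 : (v *m w (u z) *m v^T) 0 0 = 0.
  have : (v *m w (u z) *m v^T)^T = - (v *m w (u z) *m v^T).
    by rewrite !trmx_mul trmxK w_skew !mulmxA mulmxN mulNmx.
  move=> /(congr1 (fun N : 'M[R]_1 => N 0 0)); rewrite !mxE => /eqP.
  by rewrite -addr_eq0 -mulr2n mulrn_eq0 /= => /eqP.
have vJ : v *m J (u z) = j ord0 ord0 *: v + j ord0 ord_max *: v'.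
  rewrite /v -row_mul -jB; apply/rowP => l.
  by rewrite mxE mulmx2E !mxE.
have -> : j ord0 ord_max * (B *m w (u z) *m B^T) ord0 ord_max =
    (v *m (w (u z) *m (J (u z))^T) *m v^T) 0 0.
  rewrite entry -/v -/v' mulmxA -(mulmxA _ (J (u z))^T) -trmx_mul vJ.
  rewrite linearD /= mulmxDr !linearZ /=.
  by rewrite [RHS]mxE [X in _ = X + _]mxE [X in _ = _ + X]mxE skew0 mulr0 add0r.
have [->|v0] := eqVneq v 0; first by rewrite !mul0mx mxE.
exact/ltW/wJ.
Qed.

End Positivity.

Section MaxNorm.
Context {R : realType} {m : nat} {H : set 'rV[R]_m} (X : manifold H).
Variable F : X -> R.
Hypothesis bF : exists K, forall p, `|F p| <= K.

Lemma le_max_norm p : `|F p| <= max_norm F.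
Proof.
case: bF => K FK; apply: sup_ubound; last by exists p.
by exists K => _ [q _ <-].
Qed.

Lemma max_norm_ge0 : 0 <= max_norm F.
Proof.
have [[p _]|nX] := pselect ([set: X] !=set0).
  exact: le_trans (le_max_norm p).
(* On an empty manifold the supremum is taken over the empty set and equals zero by convention. *)
rewrite /max_norm (_ : [set _ | _ in _] = set0) ?sup0 //.
by apply/seteqP; split => // x [p _ _]; apply: nX; exists p.
Qed.

Lemma max_norm_eq0 p : max_norm F = 0 -> F p = 0.
Proof.
by move=> F0; apply/eqP; rewrite -normr_le0 -F0; exact: le_max_norm.
Qed.

End MaxNorm.

Section AreaEstimate.
Context {R : realType} {m : nat} {H : set 'rV[R]_m} (M : manifold H).
Hypothesis fH : forward_closed H.
Variables (w : M -> 'M[R]_m) (F G : M -> R) (J : M -> 'M[R]_m) (s : R).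
Hypotheses (sw : smooth_bilinear w) (w_skew : forall p, (w p)^T = - w p)
  (sF : smooth_fun F) (sG : smooth_fun G)
  (Jw : compatible J (perturbed_form w F G s)).
Variables (S : riemann_surface R) (u : S -> M).
Hypothesis hu : holomorphic J u.

Let fquad := @forward_closed_quadrant R.

Let perturbed_skew p : (perturbed_form w F G s p)^T = - perturbed_form w F G s
  p.
Proof.
rewrite /perturbed_form /wedge_d linearB /= linearZ /= linearB /= !trmx_mul.
by rewrite !trmxK w_skew [RHS]opprB addrC -scalerN opprB.
Qed.

Let f := F \o u.
Let g := G \o u.
Let b (c : chart R S 2) z := bilinear_in c (pullback2 u w) z ord0 ord_max.

(** The pullback is linear in the form, so this is the nonnegativity of the pulled back perturbed
    form, written with [f] and [g]. *)
Let area_density_ge0 c z : atlas c -> dom c z ->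
  0 <= b c z - s * wedge_in c f g z.
Proof.
move=> ac cz; have su := hu.1.
have := holomorphic_pullback_ge0 hu Jw perturbed_skew ac cz.
have -> : bilinear_in c (pullback2 u (perturbed_form w F G s)) z =
    bilinear_in c (pullback2 u w) z -
    s *: bilinear_in c (pullback2 u (wedge_d F G)) z.
  rewrite /perturbed_form; move: (wedge_d F G) => B;
    rewrite /bilinear_in /pullback2.
  by rewrite !(mulmxBl, mulmxBr) -!(scalemxAl, scalemxAr).
rewrite (wedge_pullback fquad fH su sF sG ac cz) /b /wedge_in -/f -/g.
move: (bilinear_in _ _ _) (grad_in c f z) (grad_in c g z) => B v v'.
by rewrite !mxE !big_ord1 !mxE (mulrC (v' 0 ord0)).
Qed.

(** Stokes' formula rewrites the flux with the partition that computes the area. The difference is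
    then a sum of integrals of [rho l] times the nonnegative density of [area_density_ge0]. *)
Lemma area_ge_boundary (area flux : R) :
  is_surface_integral (pullback2 u w) area ->
  is_boundary_integral (pullback1 u (fun_d F G)) flux -> s * flux <= area.
Proof.
have su := hu.1.
move=> [k [rho [c [pu ->]]]] [k' [rho' [c' [pu' ->]]]].
have sf : smooth_fun f := smooth_fun_comp su sF.
have sg : smooth_fun g := smooth_fun_comp su sG.
have := surface_stokes pu pu' sf sg.
case: (pu) => ac sr r0 rc r1; case: (pu') => ac' _ _ _ _ stokes.
pose K l := closure [set p | rho l p != 0].
have cc l q : chart_continuous (c l) q ->
    quadrant_cc (chart_ext (c l) (fun z => rho l z * q z)).
  move=> cq; apply: (@chart_ext_cc _ _ (@surface_compact _ S) _ _ (K l)) => //.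
  - by move=> x ix; apply: cvgM; [exact: smooth_fun_cvg|exact: cq].
  - exact: closed_closure.
  - exact: rc.
  - move=> z _ nz; suff -> : rho l z = 0 by rewrite mul0r.
    by apply/eqP/negPn/negP => rz; apply: nz; exact: subset_closure.
have cb l : chart_continuous (c l) (b (c l)).
  move=> x ix; apply: cvg_coord.
  exact: (bilinear_pullback_cvg fquad fH su sw).
have cW l : chart_continuous (c l) (wedge_in (c l) f g).
  by move=> x ix; exact: wedge_in_continuous.
have -> : \sum_(i < k') (Rintegral lebesgue_measure
      [set x : R | image_of (c' i) (pt x 0)]
      (fun x => let z := param (c' i) (pt x 0) in rho' i z *
        covector_in (c' i) (pullback1 u (fun_d F G)) z 0 ord0)
    - Rintegral lebesgue_measure [set y : R | image_of (c' i) (pt 0 y)]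
      (fun y => let z := param (c' i) (pt 0 y) in rho' i z *
        covector_in (c' i) (pullback1 u (fun_d F G)) z 0 ord_max)) =
    \sum_(l < k) chart_integral (c l) (fun z => rho l z * wedge_in (c l) f g z).
  rewrite -stokes; apply: eq_bigr => i _.
  have cov z j : dom (c' i) z ->
      covector_in (c' i) (pullback1 u (fun_d F G)) z 0 j =
      f z * grad_in (c' i) g z 0 j.
    by move=> cz; rewrite (covector_in_pullback fquad fH su) // mxE.
  by congr (_ - _); apply: eq_Rintegral => x; rewrite inE /= => ix;
    rewrite cov //; have [] := paramK (ac' i) ix.
have -> : \sum_(i < k) Rintegral (lebesgue_measure \x lebesgue_measure)%E
      [set xy : R * R | image_of (c i) (pt xy.1 xy.2)]
      (fun xy => let z := param (c i) (pt xy.1 xy.2) in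
        rho i z * bilinear_in (c i) (pullback2 u w) z ord0 ord_max) =
    \sum_(i < k) chart_integral (c i) (fun z => rho i z * b (c i) z).
  apply: eq_bigr => i _; rewrite Rintegral_mkcond; apply: eq_Rintegral => z _.
  rewrite /chart_ext /restrict /patch.
  by congr (if _ then _ else _); apply/idP/idP; rewrite !inE.
rewrite -subr_ge0 mulr_sumr -sumrB; apply: sumr_ge0 => l _.
have ccW e : quadrant_cc (chart_ext (c l)
    (fun z => e * (rho l z * wedge_in (c l) f g z))).
  have -> : (fun z => e * (rho l z * wedge_in (c l) f g z)) =
      (fun z => rho l z * (e * wedge_in (c l) f g z)).
    by apply/funext => z; rewrite mulrCA.
  by apply: cc => x ix; apply: cvgM; [exact: cvg_cst|exact: cW].
rewrite -mulNr -chart_integralZ; last exact: cc.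
rewrite -chart_integralD; [|exact: cc|exact: ccW].
apply: quadrant_integral_ge0 => x.
have [ix|nix] := pselect (image_of (c l) x); last by rewrite chart_ext_out.
rewrite chart_ext_in //; have [cz _] := paramK (ac l) ix.
have := area_density_ge0 (ac l) cz; move: (wedge_in _ _ _ _) (b _ _) => W B WB.
have -> : rho l (param (c l) x) * B + - s * (rho l (param (c l) x) * W) =
    rho l (param (c l) x) * (B - s * W) by ring.
exact: mulr_ge0.
Qed.

End AreaEstimate.

Theorem proposition1p19 (R : realType) (n : nat)
    (M : manifold [set: 'rV[R]_(n.*2)]) (omega : M -> 'M[R]_(n.*2))
    (omega_symplectic : symplectic_form omega)
    (F G : M -> R)
    (F_Cc : smooth_compact_support F) (G_Cc : smooth_compact_support G)
    (J : R -> M -> 'M[R]_(n.*2))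
    (Sigma : R -> riemann_surface R)
    (u : forall s : R, Sigma s -> M)
    (C1 C2 : R) (C1_gt0 : 0 < C1) (C2_gt0 : 0 < C2)
    (J_almost_complex : forall s, parameter_interval omega F G s ->
       almost_complex (J s))
    (J_compatible : forall s, parameter_interval omega F G s ->
       compatible (J s) (perturbed_form omega F G s))
    (u_holomorphic : forall s, parameter_interval omega F G s ->
       holomorphic (J s) (u s))
    (area_bound : forall s, parameter_interval omega F G s ->
       exists2 v, is_surface_integral (pullback2 (u s) omega) v & v <= C1)
    (boundary_bound : forall s, parameter_interval omega F G s ->
       exists2 v, is_boundary_integral (pullback1 (u s) (fun_d F G)) v &
                  C2 <= v) :
  C2 / C1 <= max_norm (poisson omega F G).
Proof.
have [sw w_skew wu _] := omega_symplectic.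
have [sF cF] := F_Cc; have [sG _] := G_Cc.
have fM := @forward_closed_setT R (n.*2).
have bP := poisson_bounded fM sw wu F_Cc sG.
set N := max_norm _.
have key s : parameter_interval omega F G s -> s * C2 <= C1.
  move=> Is; have [a ha aC] := area_bound s Is.
  have [l hl lC] := boundary_bound s Is.
  apply: le_trans aC; apply: le_trans _ (area_ge_boundary fM sw w_skew sF sG
    (J_compatible s Is) (u_holomorphic s Is) ha hl).
  by rewrite ler_wpM2l //; case: Is.
rewrite leNgt; apply/negP => NC.
have N0 : 0 <= N by exact: max_norm_ge0.
have [P0|nP0] := pselect (forall p, poisson omega F G p = 0).
  (* When the bracket vanishes identically every [s >= 0] is admissible, and any value beyond
     [C1 / C2] contradicts [key]. *)
  have s0 : 0 <= C1 / C2 + 1 by rewrite addr_ge0 // divr_ge0 // ltW.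
  have := key (C1 / C2 + 1) (conj s0 (or_introl P0)).
  by rewrite mulrDl divfK ?gt_eqF // mul1r leNgt ltrDl C2_gt0.
have Npos : 0 < N.
  rewrite lt0r N0 andbT; apply/eqP => N00; apply: nP0 => p.
  exact: max_norm_eq0 N00.
have lt : C1 / C2 < N^-1.
  by rewrite -[C1 / C2]invrK invf_div ltf_pV2 // ?posrE ?divr_gt0.
(* The midpoint of [C1 / C2] and [N^-1] is admissible, being below [N^-1], and violates [key], being
   above [C1 / C2]. *)
have [s1 s2] := midf_lt lt.
set s := (C1 / C2 + N^-1) / 2 in s1 s2.
have s0 : 0 <= s.
  by apply: ltW; apply: lt_trans s1; rewrite divr_gt0.
have := key s (conj s0 (or_intror s2)).
by rewrite leNgt -ltr_pdivrMr // s1.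
Qed.
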